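(* Let $G$ be a linear algebraic group over $\mathbb C$ acting on an affine dg manifold $\mathrm{Spec}(R^\bullet)$ and let $d\in\mathbb Z$. Suppose that $G$ is linearly reductive. Then the inclusion of the complex of strictly $G$-invariant homotopically closed $2$-forms of degree $d$ $$\overline{\boldsymbol\Omega}^\bullet_{2,d}([\mathrm{Spec}(R^\bullet)/G])\hookrightarrow\boldsymbol\Omega^\bullet_{2,d}([\mathrm{Spec}(R^\bullet)/G])$$ is a weak equivalence of non-positively graded cochain complexes of $\mathbb C$-vector spaces.
   Context: An affine dg manifold is $\mathrm{Spec}(R^\bullet)$ for a non-positively graded commutative dg $\mathbb C$-algebra $R^\bullet$ with $R^0$ finitely generated and smooth and the underlying graded algebra freely generated over $R^0$ by a finite sequence of finitely generated projective modules. Put $\Omega^\bullet_{R}:=\bigoplus_{i\ge0}\mathrm{Sym}^i_{R}(\Omega_{R}[1])$, where $\Omega_R$ is the complex of Kähler differentials and $[1]$ the suspension (shift down by $1$); $\delta$ is the cohomological differential (degree $1$, weight $0$), $\mathfrak d$ the de Rham differential (degree $-1$, weight $1$); an $i$-form has weight $i$, and its cohomological degree includes the suspension. The action and group structure give a simplicial diagram $\{\mathrm{Spec}(R^\bullet)\times G^{\times j}\}_{j\ge0}$, with homotopy colimit the quotient stack. The complex $\boldsymbol\Omega^\bullet_{2,d}([\mathrm{Spec}(R^\bullet)/G])=\bigoplus_{r\le0}\boldsymbol\Omega^r_{2,d}$ consists in degree $r$ of formal series $\sum_{i,j\ge0}\sigma^j\tau^i\omega^j_{2+i}$, where $\omega^j_{2+i}$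 is a $(2+i)$-form on $\mathrm{Spec}(R^\bullet)\times G^{\times j}$ of degree $r+d-2-2i-2j$; the degree here is the mixed degree, i.e. cohomological degree minus $j$. The differential is $\delta+\tau\mathfrak d+\sigma\Delta$ with $\Delta$ the alternating sum of all pullbacks over face maps (with the standard sign $(-1)^j$ on $\delta+\tau\mathfrak d$ in cosimplicial dimension $j$); elements in degree $r=0$ are required to be cocycles. $\overline{\boldsymbol\Omega}^\bullet_{2,d}([\mathrm{Spec}(R^\bullet)/G])$ is the subcomplex of those $\sum_{i,j\ge0}\sigma^j\tau^i\omega^j_{2+i}$ such that $\sum_{i\ge0}\tau^i\omega^0_{2+i}$ is invariant with respect to the action of $G$ on $\Omega^\bullet_{R}$, and for all $j>0$, $i\ge0$ the form $\omega^j_{2+i}$ belongs to the ideal $\mathfrak I_j\subseteq\Omega^\bullet_{\mathrm{Spec}(R^\bullet)\times G^{\times j}}$ generated by the pullbacks of forms of positive weight on $G^{\times j}$ along the projection $\mathrm{Spec}(R^\bullet)\times G^{\times j}\to G^{\times j}$. *)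

(* Defs.v *)
From HB Require Import structures.
From mathcomp Require Import all_boot all_order all_algebra.
From mathcomp Require Import generic_quotient boolp classical_sets functions.
From mathcomp Require Import reals complex.

Set Implicit Arguments.
Unset Strict Implicit.
Unset Printing Implicit Defensive.

Import GRing.Theory.
Local Open Scope ring_scope.
Local Open Scope quotient_scope.

Inductive rterm (T : Type) : Type :=
  | RGen of T
  | RZero
  | ROne
  | ROpp of rterm T
  | RAdd of rterm T & rterm T
  | RMul of rterm T & rterm T.
Arguments RZero {T}.
Arguments ROne {T}.

HB.instance Definition _ (T : Type) := gen_eqMixin (rterm T).
HB.instance Definition _ (T : Type) := gen_choiceMixin (rterm T).

Section PresentedRing.
Variables (T : Type) (rl : rterm T -> rterm T -> Prop).

Inductive rcong : rterm T -> rterm T -> Prop :=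
  | rc_rel x y : rl x y -> rcong x y
  | rc_refl x : rcong x x
  | rc_sym x y : rcong x y -> rcong y x
  | rc_trans x y z : rcong x y -> rcong y z -> rcong x z
  | rc_opp x y : rcong x y -> rcong (ROpp x) (ROpp y)
  | rc_add x x' y y' : rcong x x' -> rcong y y' -> rcong (RAdd x y) (RAdd x' y')
  | rc_mul x x' y y' : rcong x x' -> rcong y y' -> rcong (RMul x y) (RMul x' y')
  | rc_addA x y z : rcong (RAdd x (RAdd y z)) (RAdd (RAdd x y) z)
  | rc_addC x y : rcong (RAdd x y) (RAdd y x)
  | rc_add0 x : rcong (RAdd RZero x) x
  | rc_addN x : rcong (RAdd (ROpp x) x) RZero
  | rc_mulA x y z : rcong (RMul x (RMul y z)) (RMul (RMul x y) z)
  | rc_mul1l x : rcong (RMul ROne x) x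
  | rc_mul1r x : rcong (RMul x ROne) x
  | rc_mulDl x y z : rcong (RMul (RAdd x y) z) (RAdd (RMul x z) (RMul y z))
  | rc_mulDr x y z : rcong (RMul x (RAdd y z)) (RAdd (RMul x y) (RMul x z)).

Definition rcongb : rel (rterm T) := fun x y => `[< rcong x y >].

Fact rcongb_refl : reflexive rcongb.
Proof. by move=> x; apply/asboolP; apply: rc_refl. Qed.
Fact rcongb_sym : symmetric rcongb.
Proof. by move=> x y; apply/asboolP/asboolP; apply: rc_sym. Qed.
Fact rcongb_trans : transitive rcongb.
Proof.
by move=> y x z /asboolP xy /asboolP yz; apply/asboolP; apply: rc_trans yz.
Qed.

Canonical rcong_equiv := EquivRel rcongb rcongb_refl rcongb_sym rcongb_trans.

Definition pring := {eq_quot rcong_equiv}.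
HB.instance Definition _ := Choice.on pring.
HB.instance Definition _ := EqQuotient.on pring.

Definition rpi (x : rterm T) : pring := \pi x.

Lemma rpiP x y : rpi x = rpi y <-> rcong x y.
Proof.
rewrite /rpi; split=> [/eqP|xy]; last by apply/eqmodP/asboolP.
by rewrite eqmodE => /asboolP.
Qed.

Lemma rpi_repr (q : pring) : rpi (repr q) = q.
Proof. exact: reprK. Qed.

Lemma rcong_repr x : rcong (repr (rpi x)) x.
Proof. by apply/rpiP; rewrite rpi_repr. Qed.

Definition pr_opp (p : pring) := rpi (ROpp (repr p)).
Definition pr_add (p q : pring) := rpi (RAdd (repr p) (repr q)).
Definition pr_mul (p q : pring) := rpi (RMul (repr p) (repr q)).

Lemma pr_oppE x : pr_opp (rpi x) = rpi (ROpp x).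
Proof. by apply/rpiP; apply: rc_opp; apply: rcong_repr. Qed.
Lemma pr_addE x y : pr_add (rpi x) (rpi y) = rpi (RAdd x y).
Proof. by apply/rpiP; apply: rc_add; apply: rcong_repr. Qed.
Lemma pr_mulE x y : pr_mul (rpi x) (rpi y) = rpi (RMul x y).
Proof. by apply/rpiP; apply: rc_mul; apply: rcong_repr. Qed.

Lemma rpi_ind (P : pring -> Prop) : (forall x, P (rpi x)) -> forall q, P q.
Proof. by move=> Px q; rewrite -(rpi_repr q). Qed.

Fact pr_addrA : associative pr_add.
Proof.
elim/rpi_ind=> x; elim/rpi_ind=> y; elim/rpi_ind=> z.
by rewrite !pr_addE; apply/rpiP/rc_addA.
Qed.
Fact pr_addrC : commutative pr_add.
Proof.
by elim/rpi_ind=> x; elim/rpi_ind=> y; rewrite !pr_addE; apply/rpiP/rc_addC.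
Qed.
Fact pr_add0r : left_id (rpi RZero) pr_add.
Proof. by elim/rpi_ind=> x; rewrite !pr_addE; apply/rpiP/rc_add0. Qed.
Fact pr_addNr : left_inverse (rpi RZero) pr_opp pr_add.
Proof. by elim/rpi_ind=> x; rewrite pr_oppE pr_addE; apply/rpiP/rc_addN. Qed.
Fact pr_mulrA : associative pr_mul.
Proof.
elim/rpi_ind=> x; elim/rpi_ind=> y; elim/rpi_ind=> z.
by rewrite !pr_mulE; apply/rpiP/rc_mulA.
Qed.
Fact pr_mul1r : left_id (rpi ROne) pr_mul.
Proof. by elim/rpi_ind=> x; rewrite !pr_mulE; apply/rpiP/rc_mul1l. Qed.
Fact pr_mulr1 : right_id (rpi ROne) pr_mul.
Proof. by elim/rpi_ind=> x; rewrite !pr_mulE; apply/rpiP/rc_mul1r. Qed.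
Fact pr_mulrDl : left_distributive pr_mul pr_add.
Proof.
elim/rpi_ind=> x; elim/rpi_ind=> y; elim/rpi_ind=> z.
by rewrite !(pr_addE, pr_mulE); apply/rpiP/rc_mulDl.
Qed.
Fact pr_mulrDr : right_distributive pr_mul pr_add.
Proof.
elim/rpi_ind=> x; elim/rpi_ind=> y; elim/rpi_ind=> z.
by rewrite !(pr_addE, pr_mulE); apply/rpiP/rc_mulDr.
Qed.

HB.instance Definition _ := GRing.isPzRing.Build pring
  pr_addrA pr_addrC pr_add0r pr_addNr
  pr_mulrA pr_mul1r pr_mulr1 pr_mulrDl pr_mulrDr.

Definition rgen (t : T) : pring := rpi (RGen t).

Lemma rpi0 : rpi RZero = 0. Proof. by []. Qed.
Lemma rpi1 : rpi ROne = 1. Proof. by []. Qed.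
Lemma rpiN x : rpi (ROpp x) = - rpi x. Proof. by rewrite -pr_oppE. Qed.
Lemma rpiD x y : rpi (RAdd x y) = rpi x + rpi y.
Proof. by rewrite -pr_addE. Qed.
Lemma rpiM x y : rpi (RMul x y) = rpi x * rpi y.
Proof. by rewrite -pr_mulE. Qed.
Definition rpiE := (rpi0, rpi1, rpiN, rpiD, rpiM).

Lemma pring_ind (P : pring -> Prop) :
    (forall t, P (rgen t)) -> P 0 -> P 1 -> (forall x, P x -> P (- x)) ->
    (forall x y, P x -> P y -> P (x + y)) ->
    (forall x y, P x -> P y -> P (x * y)) ->
  forall x, P x.
Proof.
move=> Pg P0 P1 PN PD PM; elim/rpi_ind; elim=> //.
- by move=> x; rewrite rpiN; apply: PN.
- by move=> x Px y Py; rewrite rpiD; apply: PD.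
- by move=> x Px y Py; rewrite rpiM; apply: PM.
Qed.

Section Lift.
Variables (S : pzRingType) (f : T -> S).

Fixpoint reval (x : rterm T) : S :=
  match x with
  | RGen t => f t
  | RZero => 0
  | ROne => 1
  | ROpp x => - reval x
  | RAdd x y => reval x + reval y
  | RMul x y => reval x * reval y
  end.

Definition rlift (q : pring) : S := reval (repr q).

Hypothesis frel : forall x y, rl x y -> reval x = reval y.

Lemma reval_cong x y : rcong x y -> reval x = reval y.
Proof.
elim=> //= {x y}.
- by move=> x y z _ -> _ ->.
- by move=> x y _ ->.
- by move=> x x' y y' _ -> _ ->.
- by move=> x x' y y' _ -> _ ->.
- by move=> *; rewrite addrA.
- by move=> *; rewrite addrC.
- by move=> *; rewrite add0r.
- by move=> *; rewrite addNr.
- by move=> *; rewrite mulrA.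
- by move=> *; rewrite mul1r.
- by move=> *; rewrite mulr1.
- by move=> *; rewrite mulrDl.
- by move=> *; rewrite mulrDr.
Qed.

Lemma rlift_pi x : rlift (rpi x) = reval x.
Proof. exact: reval_cong (rcong_repr x). Qed.

Lemma rlift_gen t : rlift (rgen t) = f t. Proof. exact: rlift_pi. Qed.
Lemma rlift0 : rlift 0 = 0. Proof. exact: rlift_pi. Qed.
Lemma rlift1 : rlift 1 = 1. Proof. exact: rlift_pi. Qed.
Lemma rliftN : {morph rlift : x / - x}.
Proof. by elim/rpi_ind=> x; rewrite -rpiN !rlift_pi. Qed.
Lemma rliftD : {morph rlift : x y / x + y}.
Proof. by elim/rpi_ind=> x; elim/rpi_ind=> y; rewrite -rpiD !rlift_pi. Qed.
Lemma rliftM : {morph rlift : x y / x * y}.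
Proof. by elim/rpi_ind=> x; elim/rpi_ind=> y; rewrite -rpiM !rlift_pi. Qed.

End Lift.

(* eps-derivations of a presented ring: D (x * y) = D x * y + eps x * D y *)
Section Der.
Variables (eps : pring -> pring) (g : T -> pring).

Fixpoint rderiv (x : rterm T) : pring :=
  match x with
  | RGen t => g t
  | RZero => 0
  | ROne => 0
  | ROpp x => - rderiv x
  | RAdd x y => rderiv x + rderiv y
  | RMul x y => rderiv x * rpi y + eps (rpi x) * rderiv y
  end.

Definition pder (q : pring) : pring := rderiv (repr q).

Hypothesis eps1 : eps 1 = 1.
Hypothesis epsD : {morph eps : x y / x + y}.
Hypothesis epsM : {morph eps : x y / x * y}.
Hypothesis grel : forall x y, rl x y -> rderiv x = rderiv y.

Lemma rderiv_cong x y : rcong x y -> rderiv x = rderiv y.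
Proof.
elim=> //= {x y}.
- by move=> x y z _ -> _ ->.
- by move=> x y _ ->.
- by move=> x x' y y' _ -> _ ->.
- by move=> x x' y y' /rpiP-> -> /rpiP-> ->.
- by move=> *; rewrite addrA.
- by move=> *; rewrite addrC.
- by move=> *; rewrite add0r.
- by move=> *; rewrite addNr.
- by move=> x y z; rewrite !rpiM epsM mulrDl mulrDr !mulrA addrA.
- by move=> x; rewrite rpi1 mul0r eps1 mul1r add0r.
- by move=> x; rewrite rpi1 mulr0 mulr1 addr0.
- by move=> x y z; rewrite rpiD epsD !mulrDl addrACA.
- by move=> x y z; rewrite rpiD !mulrDr addrACA.
Qed.

Lemma pder_pi x : pder (rpi x) = rderiv x.
Proof. exact: rderiv_cong (rcong_repr x). Qed.

Lemma pder_gen t : pder (rgen t) = g t. Proof. exact: pder_pi. Qed.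
Lemma pder0 : pder 0 = 0. Proof. exact: pder_pi. Qed.
Lemma pder1 : pder 1 = 0. Proof. exact: pder_pi. Qed.
Lemma pderN : {morph pder : x / - x}.
Proof. by elim/rpi_ind=> x; rewrite -rpiN !pder_pi. Qed.
Lemma pderD : {morph pder : x y / x + y}.
Proof. by elim/rpi_ind=> x; elim/rpi_ind=> y; rewrite -rpiD !pder_pi. Qed.
Lemma pderM x y : pder (x * y) = pder x * y + eps x * pder y.
Proof.
by elim/rpi_ind: x => x; elim/rpi_ind: y => y; rewrite -rpiM !pder_pi.
Qed.

End Der.
End PresentedRing.

Inductive mterm (A : Type) (T : Type) : Type :=
  | MGen of T
  | MZero
  | MAdd of mterm A T & mterm A T
  | MScale of A & mterm A T.
Arguments MGen {A T}.
Arguments MZero {A T}.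

HB.instance Definition _ (A T : Type) := gen_eqMixin (mterm A T).
HB.instance Definition _ (A T : Type) := gen_choiceMixin (mterm A T).

Section PresentedModule.
Variables (A : pzRingType) (T : Type) (rl : mterm A T -> mterm A T -> Prop).

Inductive mcong : mterm A T -> mterm A T -> Prop :=
  | mc_rel x y : rl x y -> mcong x y
  | mc_refl x : mcong x x
  | mc_sym x y : mcong x y -> mcong y x
  | mc_trans x y z : mcong x y -> mcong y z -> mcong x z
  | mc_add x x' y y' : mcong x x' -> mcong y y' -> mcong (MAdd x y) (MAdd x' y')
  | mc_scale a x y : mcong x y -> mcong (MScale a x) (MScale a y)
  | mc_addA x y z : mcong (MAdd x (MAdd y z)) (MAdd (MAdd x y) z)
  | mc_addC x y : mcong (MAdd x y) (MAdd y x)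
  | mc_add0 x : mcong (MAdd MZero x) x
  | mc_addN x : mcong (MAdd (MScale (-1) x) x) MZero
  | mc_scaleA a b x : mcong (MScale a (MScale b x)) (MScale (a * b) x)
  | mc_scale1 x : mcong (MScale 1 x) x
  | mc_scaleDr a x y : mcong (MScale a (MAdd x y)) (MAdd (MScale a x) (MScale a y))
  | mc_scaleDl a b x : mcong (MScale (a + b) x) (MAdd (MScale a x) (MScale b x)).

Definition mcongb : rel (mterm A T) := fun x y => `[< mcong x y >].

Fact mcongb_refl : reflexive mcongb.
Proof. by move=> x; apply/asboolP; apply: mc_refl. Qed.
Fact mcongb_sym : symmetric mcongb.
Proof. by move=> x y; apply/asboolP/asboolP; apply: mc_sym. Qed.
Fact mcongb_trans : transitive mcongb.
Proof.
by move=> y x z /asboolP xy /asboolP yz; apply/asboolP; apply: mc_trans yz.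
Qed.

Canonical mcong_equiv := EquivRel mcongb mcongb_refl mcongb_sym mcongb_trans.

Definition pmod := {eq_quot mcong_equiv}.
HB.instance Definition _ := Choice.on pmod.
HB.instance Definition _ := EqQuotient.on pmod.

Definition mpi (x : mterm A T) : pmod := \pi x.

Lemma mpiP x y : mpi x = mpi y <-> mcong x y.
Proof.
rewrite /mpi; split=> [/eqP|xy]; last by apply/eqmodP/asboolP.
by rewrite eqmodE => /asboolP.
Qed.

Lemma mpi_repr (q : pmod) : mpi (repr q) = q.
Proof. exact: reprK. Qed.

Lemma mcong_repr x : mcong (repr (mpi x)) x.
Proof. by apply/mpiP; rewrite mpi_repr. Qed.

Lemma mpi_ind (P : pmod -> Prop) : (forall x, P (mpi x)) -> forall q, P q.
Proof. by move=> Px q; rewrite -(mpi_repr q). Qed.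

Definition pm_scale a (p : pmod) := mpi (MScale a (repr p)).
Definition pm_add (p q : pmod) := mpi (MAdd (repr p) (repr q)).
Definition pm_opp p := pm_scale (-1) p.

Lemma pm_scaleE a x : pm_scale a (mpi x) = mpi (MScale a x).
Proof. by apply/mpiP; apply: mc_scale; apply: mcong_repr. Qed.
Lemma pm_addE x y : pm_add (mpi x) (mpi y) = mpi (MAdd x y).
Proof. by apply/mpiP; apply: mc_add; apply: mcong_repr. Qed.

Fact pm_addrA : associative pm_add.
Proof.
elim/mpi_ind=> x; elim/mpi_ind=> y; elim/mpi_ind=> z.
by rewrite !pm_addE; apply/mpiP/mc_addA.
Qed.
Fact pm_addrC : commutative pm_add.
Proof.
by elim/mpi_ind=> x; elim/mpi_ind=> y; rewrite !pm_addE; apply/mpiP/mc_addC.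
Qed.
Fact pm_add0r : left_id (mpi MZero) pm_add.
Proof. by elim/mpi_ind=> x; rewrite !pm_addE; apply/mpiP/mc_add0. Qed.
Fact pm_addNr : left_inverse (mpi MZero) pm_opp pm_add.
Proof.
by elim/mpi_ind=> x; rewrite /pm_opp pm_scaleE pm_addE; apply/mpiP/mc_addN.
Qed.

HB.instance Definition _ := GRing.isZmodule.Build pmod
  pm_addrA pm_addrC pm_add0r pm_addNr.

Fact pm_scalerA a b v : pm_scale a (pm_scale b v) = pm_scale (a * b) v.
Proof. by elim/mpi_ind: v => x; rewrite !pm_scaleE; apply/mpiP/mc_scaleA. Qed.
Fact pm_scale1r : left_id 1 pm_scale.
Proof. by elim/mpi_ind=> x; rewrite !pm_scaleE; apply/mpiP/mc_scale1. Qed.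
Fact pm_scalerDr : right_distributive pm_scale +%R.
Proof.
move=> a; elim/mpi_ind=> x; elim/mpi_ind=> y.
by rewrite [X in pm_scale a X]pm_addE !pm_scaleE [RHS]pm_addE; apply/mpiP/mc_scaleDr.
Qed.
Fact pm_scalerDl v : {morph pm_scale^~ v : a b / a + b}.
Proof.
elim/mpi_ind: v => x a b.
by rewrite !pm_scaleE [RHS]pm_addE; apply/mpiP/mc_scaleDl.
Qed.

HB.instance Definition _ := GRing.Zmodule_isLmodule.Build A pmod
  pm_scalerA pm_scale1r pm_scalerDr pm_scalerDl.

Definition mgen (t : T) : pmod := mpi (MGen t).

Lemma mpi0 : mpi MZero = 0. Proof. by []. Qed.
Lemma mpiD x y : mpi (MAdd x y) = mpi x + mpi y. Proof. by rewrite -pm_addE. Qed.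
Lemma mpiZ a x : mpi (MScale a x) = a *: mpi x. Proof. by rewrite -pm_scaleE. Qed.

Lemma pmod_ind (P : pmod -> Prop) :
    (forall t, P (mgen t)) -> P 0 -> (forall x y, P x -> P y -> P (x + y)) ->
    (forall a x, P x -> P (a *: x)) ->
  forall x, P x.
Proof.
move=> Pg P0 PD PZ; elim/mpi_ind; elim=> //.
- by move=> x Px y Py; rewrite mpiD; apply: PD.
- by move=> a x Px; rewrite mpiZ; apply: PZ.
Qed.

(* Additive maps F out of a presented module given on generators by g and
   on multiples by F (a *: x) = h a x (F x). *)
Section Lift.
Variables (N : zmodType) (g : T -> N) (h : A -> pmod -> N -> N).

Fixpoint mrec (x : mterm A T) : N :=
  match x with
  | MGen t => g t
  | MZero => 0
  | MAdd x y => mrec x + mrec y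
  | MScale a x => h a (mpi x) (mrec x)
  end.

Definition mlift (q : pmod) : N := mrec (repr q).

Hypothesis hDl : forall a b x n, h (a + b) x n = h a x n + h b x n.
Hypothesis hDr : forall a x y m n, h a (x + y) (m + n) = h a x m + h a y n.
Hypothesis hA : forall a b x n, h a (b *: x) (h b x n) = h (a * b) x n.
Hypothesis h1 : forall x n, h 1 x n = n.
Hypothesis grel : forall x y, rl x y -> mrec x = mrec y.

Lemma mrec_cong x y : mcong x y -> mrec x = mrec y.
Proof.
have h0 z n : h 0 z n = 0.
  by apply: (@addrI _ (h 0 z n)); rewrite -hDl !addr0.
elim=> //= {x y}.
- by move=> x y z _ -> _ ->.
- by move=> x x' y y' _ -> _ ->.
- by move=> a x y /mpiP-> ->.
- by move=> *; rewrite addrA.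
- by move=> *; rewrite addrC.
- by move=> *; rewrite add0r.
- by move=> x; rewrite -[X in _ + X](h1 (mpi x)) -hDl addNr h0.
- by move=> a b x; rewrite mpiZ hA.
- by move=> a x y; rewrite mpiD hDr.
Qed.

Lemma mlift_pi x : mlift (mpi x) = mrec x.
Proof. exact: mrec_cong (mcong_repr x). Qed.

Lemma mlift_gen t : mlift (mgen t) = g t. Proof. exact: mlift_pi. Qed.
Lemma mlift0 : mlift 0 = 0. Proof. exact: mlift_pi. Qed.
Lemma mliftD : {morph mlift : x y / x + y}.
Proof. by elim/mpi_ind=> x; elim/mpi_ind=> y; rewrite -mpiD !mlift_pi. Qed.
Lemma mliftZ a x : mlift (a *: x) = h a x (mlift x).
Proof. by elim/mpi_ind: x => x; rewrite -mpiZ !mlift_pi. Qed.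

End Lift.
End PresentedModule.

(* A non-positively graded, graded-commutative algebra over K, possibly zero.
   [part n] is the projection onto the component of cohomological degree
   [- n]; the elements of that component are its fixed points. *)
Record gca (K : fieldType) := Gca {
  gcar :> pzRingType;
  scal : {rmorphism K -> gcar};
  part : nat -> gcar -> gcar;
  part_add : forall n, {morph part n : x y / x + y};
  part_part : forall m n x,
    part m (part n x) = if m == n then part n x else 0;
  part_sum : forall x, exists N, x = \sum_(n < N) part n x;
  part_scal : forall k, part 0 (scal k) = scal k;
  part_mul : forall m n x y, part m x = x -> part n y = y ->
    part (m + n) (x * y) = x * y;
  part_comm : forall m n x y, part m x = x -> part n y = y ->
    x * y = (-1) ^+ (m * n) * (y * x)
}.

Definition homog (K : fieldType) (A : gca K) (n : nat) (x : A) : Prop :=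
  part n x = x.

Record cdga (K : fieldType) := Cdga {
  cdga_gca :> gca K;
  dif : cdga_gca -> cdga_gca;
  dif_add : {morph dif : x y / x + y};
  dif_homog : forall n x, homog n.+1 x -> homog n (dif x);
  dif_homog0 : forall x, homog 0 x -> dif x = 0;
  dif_mul : forall n x y, homog n x ->
    dif (x * y) = dif x * y + (-1) ^+ n * (x * dif y);
  dif_dif : forall x, dif (dif x) = 0
}.

Record gca_hom (K : fieldType) (A B : gca K) := GcaHom {
  gca_map :> {rmorphism A -> B};
  gca_map_scal : forall k, gca_map (scal A k) = scal B k;
  gca_map_part : forall n x, gca_map (part n x) = part n (gca_map x)
}.

Record cdga_hom (K : fieldType) (A B : cdga K) := CdgaHom {
  cdga_map :> gca_hom A B;
  cdga_map_dif : forall x, cdga_map (dif x) = dif (cdga_map x)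
}.

Lemma morph_add0 (U V : zmodType) (f : U -> V) :
  {morph f : x y / x + y} -> f 0 = 0.
Proof. by move=> fD; apply: (@addrI _ (f 0)); rewrite -fD !addr0. Qed.

Lemma morph_addN (U V : zmodType) (f : U -> V) :
  {morph f : x y / x + y} -> {morph f : x / - x}.
Proof.
move=> fD x; apply: (@addrI _ (f x)).
by rewrite -fD !addrN (morph_add0 fD).
Qed.

Lemma morph_add_sum (U V : zmodType) (f : U -> V) :
  {morph f : x y / x + y} -> forall (I : Type) (r : seq I) (P : pred I) F,
  f (\sum_(i <- r | P i) F i) = \sum_(i <- r | P i) f (F i).
Proof. by move=> fD I r P F; apply: (big_morph f fD (morph_add0 fD)). Qed.

Lemma signr_if (A : pzRingType) n (x : A) :
  (-1) ^+ n * x = if odd n then - x else x.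
Proof. by rewrite -signr_odd mulr_sign. Qed.

Lemma morph_sign (A B : pzRingType) (f : A -> B) :
  {morph f : x y / x + y} -> forall n x,
  f ((-1) ^+ n * x) = (-1) ^+ n * f x.
Proof.
by move=> fD n x; rewrite !signr_if; case: odd; rewrite // (morph_addN fD).
Qed.

Section Gca.
Variables (K : fieldType) (A : gca K).
Implicit Types x y : A.

Lemma part0 n : part n (0 : A) = 0.
Proof. exact: morph_add0 (@part_add _ A n). Qed.

Lemma partN n : {morph @part _ A n : x / - x}.
Proof. exact: morph_addN (@part_add _ A n). Qed.

Lemma part_bigsum n (I : Type) (r : seq I) (P : pred I) (F : I -> A) :
  part n (\sum_(i <- r | P i) F i) = \sum_(i <- r | P i) part n (F i).
Proof. exact: morph_add_sum (@part_add _ A n) _ _ _ _. Qed.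

Lemma homog_part n x : homog n (part n x).
Proof. by rewrite /homog part_part eqxx. Qed.

Lemma homog0 n : homog n (0 : A). Proof. exact: part0. Qed.

Lemma homogD n x y : homog n x -> homog n y -> homog n (x + y).
Proof. by rewrite /homog part_add => -> ->. Qed.

Lemma homogN n x : homog n x -> homog n (- x).
Proof. by rewrite /homog partN => ->. Qed.

Lemma homogM m n x y : homog m x -> homog n y -> homog (m + n) (x * y).
Proof. exact: part_mul. Qed.

Lemma homog_scal k : homog 0 (scal A k). Proof. exact: part_scal. Qed.

Lemma homog1 : homog 0 (1 : A).
Proof. by rewrite -(rmorph1 (scal A)); apply: homog_scal. Qed.

Lemma homog_sign m n x : homog n x -> homog n ((-1) ^+ m * x).
Proof. by rewrite signr_if; case: odd => //; apply: homogN. Qed.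

Lemma part_homog m n x : homog n x -> part m x = if m == n then x else 0.
Proof. by move=> xn; rewrite -{1}xn part_part; case: eqP => // _. Qed.

Lemma homog_comm m n x y : homog m x -> homog n y ->
  x * y = (-1) ^+ (m * n) * (y * x).
Proof. exact: part_comm. Qed.

Lemma part_bound x : exists N, forall M, (N <= M)%N ->
  x = \sum_(n < M) part n x.
Proof.
have [N xE] := part_sum x; exists N => M leNM.
have z n : (N <= n)%N -> part n x = 0.
  move=> leNn; rewrite xE part_bigsum big1 // => i _; rewrite part_part.
  by case: eqP => // ni; move: (ltn_ord i); rewrite -ni ltnNge leNn.
rewrite {1}xE (big_ord_widen M (fun n => part n x) leNM) big_mkcond /=.
by apply: eq_bigr => i _; case: ltnP => // /z.
Qed.

Lemma part_inj x y : (forall n, part n x = part n y) -> x = y.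
Proof.
move=> xy; have [N xE] := part_bound x; have [M yE] := part_bound y.
rewrite (xE _ (leq_maxl N M)) (yE _ (leq_maxr N M)).
by apply: eq_bigr => i _; rewrite xy.
Qed.

Lemma homog_ind (P : A -> Prop) :
    P 0 -> (forall x y, P x -> P y -> P (x + y)) ->
    (forall n x, homog n x -> P x) ->
  forall x, P x.
Proof.
move=> P0 PD Ph x; have [N ->] := part_sum x.
by elim/big_rec: _ => // i y _ Py; apply: PD Py; apply: Ph (homog_part i x).
Qed.

(* x |-> (-1)^|x| x *)
Definition parity x : A :=
  \sum_(n < projT1 (cid (part_sum x))) (-1) ^+ n * part n x.

Lemma part_parity n x : part n (parity x) = (-1) ^+ n * part n x.
Proof.
rewrite /parity; case: cid => N /= xE; rewrite part_bigsum.
under eq_bigr => i _ do rewrite (morph_sign (@part_add _ A n)).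
have [ltnN|leNn] := ltnP n N.
  rewrite (bigD1 (Ordinal ltnN)) //= part_part eqxx big1 ?addr0 // => i.
  rewrite -val_eqE /= eq_sym => /negbTE ni.
  by rewrite part_part ni mulr0.
have z (i : 'I_N) : part n (part i x) = 0.
  by rewrite part_part; case: eqP => // ni; move: (ltn_ord i); rewrite -ni ltnNge leNn.
rewrite {2}xE part_bigsum big1 ?[X in _ * X]big1 ?mulr0 // => i _;
by rewrite z ?mulr0.
Qed.

Lemma parity_homog n x : homog n x -> parity x = (-1) ^+ n * x.
Proof.
move=> xn; apply: part_inj => m; rewrite part_parity.
rewrite (morph_sign (@part_add _ A m)) (part_homog m xn).
by case: eqP => [->|]; rewrite // !mulr0.
Qed.

Lemma parityD : {morph parity : x y / x + y}.
Proof.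
move=> x y; apply: part_inj => n.
by rewrite part_add !part_parity part_add mulrDr.
Qed.

Lemma parityK : involutive parity.
Proof. by move=> x; apply: part_inj => n; rewrite !part_parity signrMK. Qed.

Lemma parityM : {morph parity : x y / x * y}.
Proof.
move=> x y; elim/homog_ind: x => [|x x' Hx Hx'|m x xm].
- by rewrite mul0r (morph_add0 parityD) mul0r.
- by rewrite mulrDl !parityD Hx Hx' mulrDl.
elim/homog_ind: y => [|y y' Hy Hy'|n y yn].
- by rewrite mulr0 (morph_add0 parityD) mulr0.
- by rewrite mulrDr !parityD Hy Hy' mulrDr.
rewrite (parity_homog xm) (parity_homog yn) (parity_homog (homogM xm yn)).
rewrite !signr_if oddD; case: (odd m); case: (odd n);
by rewrite /= ?mulrN ?mulNr ?opprK.
Qed.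

Lemma parity_scal k : parity (scal A k) = scal A k.
Proof. by rewrite (parity_homog (homog_scal k)) expr0 mul1r. Qed.

Lemma parity1 : parity 1 = 1.
Proof. by rewrite (parity_homog homog1) expr0 mul1r. Qed.

Lemma homog_parity n x : homog n x -> homog n (parity x).
Proof. by move=> xn; rewrite (parity_homog xn); apply: homog_sign. Qed.

End Gca.

Section GcaHom.
Variables (K : fieldType) (A B : gca K) (f : gca_hom A B).

Lemma homog_map n x : homog n x -> homog n (f x).
Proof. by move=> xn; rewrite /homog -gca_map_part xn. Qed.

Lemma parity_map x : parity (f x) = f (parity x).
Proof.
apply: part_inj => n; rewrite part_parity -!gca_map_part part_parity.
by rewrite (morph_sign (rmorphD f)).
Qed.
End GcaHom.

Section Cdga.
Variables (K : fieldType) (A : cdga K).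
Implicit Types x y : A.

Lemma dif0 : dif (0 : A) = 0. Proof. exact: morph_add0 (@dif_add _ A). Qed.
Lemma dif_scal k : dif (scal A k) = 0.
Proof. exact: dif_homog0 (homog_scal A k). Qed.
Lemma dif1 : dif (1 : A) = 0. Proof. exact: dif_homog0 (homog1 A). Qed.

Lemma dif_homogP n x : homog n x -> homog n.-1 (dif x).
Proof.
case: n => [x0|n]; last exact: dif_homog.
by rewrite (dif_homog0 x0); apply: homog0.
Qed.

Lemma difM x y : dif (x * y) = dif x * y + parity x * dif y.
Proof.
elim/homog_ind: x => [|x x' Hx Hx'|m x xm].
- by rewrite (morph_add0 (@parityD _ A)) !mul0r dif0 mul0r add0r.
- by rewrite parityD mulrDl !dif_add Hx Hx' !mulrDl addrACA.
- by rewrite (dif_mul _ xm) (parity_homog xm) mulrA.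
Qed.

Lemma dif_parity x : dif (parity x) = - parity (dif x).
Proof.
elim/homog_ind: x => [|x x' Hx Hx'|[|m] x xm].
- by rewrite !(morph_add0 (@parityD _ A), dif0) oppr0.
- by rewrite !(parityD, dif_add) Hx Hx' opprD.
- rewrite (parity_homog xm) expr0 mul1r (dif_homog0 xm).
  by rewrite (morph_add0 (@parityD _ A)) oppr0.
rewrite (parity_homog xm) (parity_homog (dif_homog xm)).
rewrite !signr_if /=; case: (odd m); rewrite /= ?opprK //.
by rewrite (morph_addN (@dif_add _ A)).
Qed.

End Cdga.

(* The dg module of Kaehler differentials over K: generated over A by the
   symbols d a, with d K-linear and, for the left module structure,
   d (a b) = a (d b) + (-1)^(|a||b|) b (d a). *)
Inductive kaehler_rel (K : fieldType) (A : cdga K) :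
    mterm A A -> mterm A A -> Prop :=
  | kr_add a b : kaehler_rel (MGen (a + b)) (MAdd (MGen a) (MGen b))
  | kr_scal k : kaehler_rel (MGen (scal A k)) MZero
  | kr_mul m n a b : homog m a -> homog n b ->
      kaehler_rel (MGen (a * b))
        (MAdd (MScale a (MGen b)) (MScale ((-1) ^+ (m * n) * b) (MGen a))).

Definition kaehler (K : fieldType) (A : cdga K) := pmod (@kaehler_rel K A).
HB.instance Definition _ (K : fieldType) (A : cdga K) :=
  GRing.Lmodule.on (kaehler A).

Definition kd (K : fieldType) (A : cdga K) (a : A) : kaehler A :=
  mgen (@kaehler_rel K A) a.

(* The component of cohomological degree - n. *)
Inductive khomog (K : fieldType) (A : cdga K) : nat -> kaehler A -> Prop :=
  | kh_gen n a : homog n a -> khomog n (kd a)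
  | kh_zero n : khomog n 0
  | kh_add n x y : khomog n x -> khomog n y -> khomog n (x + y)
  | kh_scale m n a x : homog m a -> khomog n x -> khomog (m + n) (a *: x).

Lemma scaler_signl (A : pzRingType) (V : lmodType A) n (a : A) (x : V) :
  ((-1) ^+ n * a) *: x = if odd n then - (a *: x) else a *: x.
Proof. by rewrite signr_if; case: odd; rewrite ?scaleNr. Qed.

Section Kaehler.
Variables (K : fieldType) (A : cdga K).
Local Notation rl := (@kaehler_rel K A).
Implicit Types (a b : A) (x y : kaehler A).

Lemma kdD : {morph @kd K A : a b / a + b}.
Proof.
by move=> a b; rewrite /kd /mgen -mpiD; apply/mpiP/mc_rel/kr_add.
Qed.

Lemma kd_scal k : kd (scal A k) = 0.
Proof. exact/mpiP/mc_rel/kr_scal. Qed.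

Lemma kd0 : kd (0 : A) = 0. Proof. exact: morph_add0 kdD. Qed.
Lemma kdN : {morph @kd K A : a / - a}. Proof. exact: morph_addN kdD. Qed.
Lemma kd1 : kd (1 : A) = 0.
Proof. by rewrite -(rmorph1 (scal A)) kd_scal. Qed.

Lemma kdM m n a b : homog m a -> homog n b ->
  kd (a * b) = a *: kd b + ((-1) ^+ (m * n) * b) *: kd a.
Proof.
move=> am bn; rewrite /kd /mgen -!mpiZ -mpiD.
by apply/mpiP/mc_rel; apply: kr_mul.
Qed.

Lemma kd_sign n a : kd ((-1) ^+ n * a) = if odd n then - kd a else kd a.
Proof. by rewrite signr_if; case: odd; rewrite ?kdN. Qed.

Lemma kaehler_ind (P : kaehler A -> Prop) :
    (forall a, P (kd a)) -> P 0 -> (forall x y, P x -> P y -> P (x + y)) ->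
    (forall a x, P x -> P (a *: x)) ->
  forall x, P x.
Proof. exact: pmod_ind. Qed.

Definition kparity : kaehler A -> kaehler A :=
  mlift (fun a => kd (parity a)) (fun a _ y => parity a *: y).

Definition kdif : kaehler A -> kaehler A :=
  mlift (fun a => kd (dif a)) (fun a x y => dif a *: x + parity a *: y).

Section KparityDef.
Let h := fun a (x y : kaehler A) => parity a *: y.
Let hDl a b x y : h (a + b) x y = h a x y + h b x y.
Proof. by rewrite /h parityD scalerDl. Qed.
Let hDr a x x' y y' : h a (x + x') (y + y') = h a x y + h a x' y'.
Proof. by rewrite /h scalerDr. Qed.
Let hA a b x y : h a (b *: x) (h b x y) = h (a * b) x y.
Proof. by rewrite /h scalerA parityM. Qed.
Let h1 x y : h 1 x y = y.
Proof. by rewrite /h parity1 scale1r. Qed.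
Let hrel u v : rl u v ->
  mrec (fun a => kd (parity a)) h u = mrec (fun a => kd (parity a)) h v.
Proof.
case=> /= [a b|k|m n a b am bn]; rewrite /h.
- by rewrite parityD kdD.
- by rewrite parity_scal kd_scal.
rewrite parityM (kdM (homog_parity am) (homog_parity bn)).
by congr (_ + _ *: _); rewrite (morph_sign (@parityD _ A)).
Qed.

Lemma kparity_kd a : kparity (kd a) = kd (parity a).
Proof. exact: (mlift_gen hDl hDr hA h1 hrel). Qed.
Lemma kparityD : {morph kparity : x y / x + y}.
Proof. exact: (mliftD hDl hDr hA h1 hrel). Qed.
Lemma kparityZ a x : kparity (a *: x) = parity a *: kparity x.
Proof. exact: (mliftZ hDl hDr hA h1 hrel). Qed.
End KparityDef.

Section KdifDef.
Let h := fun a (x y : kaehler A) => dif a *: x + parity a *: y.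
Let hDl a b x y : h (a + b) x y = h a x y + h b x y.
Proof. by rewrite /h parityD dif_add !scalerDl addrACA. Qed.
Let hDr a x x' y y' : h a (x + x') (y + y') = h a x y + h a x' y'.
Proof. by rewrite /h !scalerDr addrACA. Qed.
Let hA a b x y : h a (b *: x) (h b x y) = h (a * b) x y.
Proof.
by rewrite /h parityM difM scalerDr !scalerA scalerDl addrA.
Qed.
Let h1 x y : h 1 x y = y.
Proof. by rewrite /h parity1 scale1r dif1 scale0r add0r. Qed.
Let hrel u v : rl u v ->
  mrec (fun a => kd (dif a)) h u = mrec (fun a => kd (dif a)) h v.
Proof.
case=> /= [a b|k|m n a b am bn]; rewrite /h.
- by rewrite dif_add kdD.
- by rewrite dif_scal kd0.
rewrite difM kdD (kdM (dif_homogP am) bn) (kdM (homog_parity am) (dif_homogP bn)).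
rewrite (morph_sign (@parityD _ A)) (morph_sign (@dif_add _ A)).
rewrite (parity_homog am) (parity_homog bn) !(kd_sign, scaler_signl).
case: m am => [|m] am; case: n bn => [|n] bn;
  rewrite ?(dif_homog0 am) ?(dif_homog0 bn) ?kd0 ?scale0r ?scaler0 ?oppr0;
  rewrite ?(oddD, oddM, oddS) /=. all: try case: (odd m); try case: (odd n) => /=. all: rewrite ?(if_same, oppr0, addr0, add0r, opprK) //.
all: by rewrite ?scalerN ?opprK addrACA; congr (_ + _); exact: addrC.
Qed.

Lemma kdif_kd a : kdif (kd a) = kd (dif a).
Proof. exact: (mlift_gen hDl hDr hA h1 hrel). Qed.
Lemma kdifD : {morph kdif : x y / x + y}.
Proof. exact: (mliftD hDl hDr hA h1 hrel). Qed.
Lemma kdifZ a x : kdif (a *: x) = dif a *: x + parity a *: kdif x.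
Proof. exact: (mliftZ hDl hDr hA h1 hrel). Qed.
End KdifDef.

Lemma khomogN n x : khomog n x -> khomog n (- x).
Proof.
move=> xn; rewrite -scaleN1r -[n]add0n; apply: kh_scale xn.
exact: homogN (homog1 A).
Qed.

Lemma khomog_sign m n x : khomog n x -> khomog n ((-1) ^+ m *: x).
Proof.
by move=> xn; rewrite -signr_odd scaler_sign; case: odd; first exact: khomogN.
Qed.

Lemma kparity_khomog n x : khomog n x -> kparity x = (-1) ^+ n *: x.
Proof.
elim=> {n x} [n a an|n|n x y _ Hx _ Hy|m n a x am _ Hx].
- by rewrite kparity_kd (parity_homog an) kd_sign -signr_odd scaler_sign.
- by rewrite (morph_add0 kparityD) scaler0.
- by rewrite kparityD Hx Hy scalerDr.
rewrite kparityZ Hx (parity_homog am) !scalerA; congr (_ *: _).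
rewrite -!(signr_odd _ m) -!(signr_odd _ n) -(signr_odd _ (m + n)) oddD.
by case: (odd m); case: (odd n); rewrite /= ?(expr0, expr1, mul1r, mulr1, mulrN1, mulNr, opprK).
Qed.

Lemma kdif_khomogP n x : khomog n x -> khomog n.-1 (kdif x) /\
  (n = 0 -> kdif x = 0).
Proof.
elim=> {n x} [n a an|n|n x y _ [Hx Hx0] _ [Hy Hy0]|m n a x am xn [Hx Hx0]].
- rewrite kdif_kd; split; first exact/kh_gen/dif_homogP.
  by move=> n0; move: an; rewrite n0 => /dif_homog0->; rewrite kd0.
- by rewrite (morph_add0 kdifD); split=> // ; apply: kh_zero.
- rewrite kdifD; split=> [|n0]; first exact: kh_add.
  by rewrite Hx0 // Hy0 // addr0.
rewrite kdifZ; split=> [|/eqP]; last first.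
  rewrite addn_eq0 => /andP[/eqP m0 /eqP n0]; rewrite (Hx0 n0) scaler0 addr0.
  by move: am; rewrite m0 => /dif_homog0->; rewrite scale0r.
apply: kh_add.
  case: m am => [am|m am]; last exact: kh_scale (dif_homog am) xn.
  by rewrite (dif_homog0 am) scale0r; apply: kh_zero.
case: n xn Hx Hx0 => [|n] xn Hx Hx0.
  by rewrite Hx0 // scaler0; apply: kh_zero.
by rewrite addnS; apply: kh_scale => //; apply: homog_parity.
Qed.

Lemma kdif_khomog n x : khomog n x -> khomog n.-1 (kdif x).
Proof. by case/kdif_khomogP. Qed.
Lemma kdif_khomog0 x : khomog 0 x -> kdif x = 0.
Proof. by case/kdif_khomogP=> _; apply. Qed.

End Kaehler.

Section KaehlerMap.
Variables (K : fieldType) (A B : cdga K) (f : gca_hom A B).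

(* d a |-> d (f a) *)
Definition kmap : kaehler A -> kaehler B :=
  mlift (fun a => kd (f a)) (fun a _ y => f a *: y).

Let h := fun (a : A) (x : kaehler A) (y : kaehler B) => f a *: y.
Let hDl a b x y : h (a + b) x y = h a x y + h b x y.
Proof. by rewrite /h rmorphD scalerDl. Qed.
Let hDr a x x' y y' : h a (x + x') (y + y') = h a x y + h a x' y'.
Proof. by rewrite /h scalerDr. Qed.
Let hA a b x y : h a (b *: x) (h b x y) = h (a * b) x y.
Proof. by rewrite /h scalerA rmorphM. Qed.
Let h1 x y : h 1 x y = y.
Proof. by rewrite /h rmorph1 scale1r. Qed.
Let hrel u v : @kaehler_rel K A u v ->
  mrec (fun a => kd (f a)) h u = mrec (fun a => kd (f a)) h v.
Proof.
case=> /= [a b|k|m n a b am bn]; rewrite /h.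
- by rewrite rmorphD kdD.
- by rewrite gca_map_scal kd_scal.
rewrite rmorphM (kdM (homog_map f am) (homog_map f bn)).
by congr (_ + _ *: _); rewrite (morph_sign (rmorphD f)).
Qed.

Lemma kmap_kd a : kmap (kd a) = kd (f a).
Proof. exact: (mlift_gen hDl hDr hA h1 hrel). Qed.
Lemma kmapD : {morph kmap : x y / x + y}.
Proof. exact: (mliftD hDl hDr hA h1 hrel). Qed.
Lemma kmapZ a x : kmap (a *: x) = f a *: kmap x.
Proof. exact: (mliftZ hDl hDr hA h1 hrel). Qed.

Lemma kmap_khomog n x : khomog n x -> khomog n (kmap x).
Proof.
elim=> {n x} [n a an|n|n x y _ Hx _ Hy|m n a x am _ Hx].
- by rewrite kmap_kd; apply/kh_gen/homog_map.
- by rewrite (morph_add0 kmapD); apply: kh_zero.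
- by rewrite kmapD; apply: kh_add.
- by rewrite kmapZ; apply: kh_scale => //; apply: homog_map.
Qed.

End KaehlerMap.

(* The de Rham algebra Sym_A (Omega_A[1]): the graded-commutative algebra
   generated by A and the suspensions s x of the x in Omega_A. The suspension
   has degree - 1, whence s (a x) = (-1)^|a| a (s x). *)
Definition rsign (T : Type) (n : nat) (t : rterm T) : rterm T :=
  if odd n then ROpp t else t.

Inductive dR_rel (K : fieldType) (A : cdga K) :
    rterm (A + kaehler A) -> rterm (A + kaehler A) -> Prop :=
  | dr_add a b : dR_rel (RGen (inl (a + b)))
      (RAdd (RGen (inl a)) (RGen (inl b)))
  | dr_one : dR_rel (RGen (inl 1)) ROne
  | dr_mul a b : dR_rel (RGen (inl (a * b)))
      (RMul (RGen (inl a)) (RGen (inl b)))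
  | dr_sadd x y : dR_rel (RGen (inr (x + y)))
      (RAdd (RGen (inr x)) (RGen (inr y)))
  | dr_smul m a x : homog m a -> dR_rel (RGen (inr (a *: x)))
      (rsign m (RMul (RGen (inl a)) (RGen (inr x))))
  | dr_comm m n x a : khomog m x -> homog n a ->
      dR_rel (RMul (RGen (inr x)) (RGen (inl a)))
        (rsign (m.+1 * n) (RMul (RGen (inl a)) (RGen (inr x))))
  | dr_scomm m n x y : khomog m x -> khomog n y ->
      dR_rel (RMul (RGen (inr x)) (RGen (inr y)))
        (rsign (m.+1 * n.+1) (RMul (RGen (inr y)) (RGen (inr x)))).

Definition dR (K : fieldType) (A : cdga K) := pring (@dR_rel K A).
HB.instance Definition _ (K : fieldType) (A : cdga K) :=
  GRing.PzRing.on (dR A).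

Definition din (K : fieldType) (A : cdga K) (a : A) : dR A :=
  rgen (@dR_rel K A) (inl a).
Definition dsu (K : fieldType) (A : cdga K) (x : kaehler A) : dR A :=
  rgen (@dR_rel K A) (inr x).

(* forms of weight p and cohomological degree - n *)
Inductive dhomog (K : fieldType) (A : cdga K) : nat -> nat -> dR A -> Prop :=
  | dh_in n a : homog n a -> dhomog 0 n (din a)
  | dh_su n x : khomog n x -> dhomog 1 n.+1 (dsu x)
  | dh_zero p n : dhomog p n 0
  | dh_add p n w z : dhomog p n w -> dhomog p n z -> dhomog p n (w + z)
  | dh_mul p q m n w z : dhomog p m w -> dhomog q n z ->
      dhomog (p + q) (m + n) (w * z).

Lemma rpi_sign (T : Type) rl n (x : rterm T) :
  rpi rl (rsign n x) = (-1) ^+ n * rpi rl x.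
Proof. by rewrite signr_if /rsign; case: odd; rewrite ?rpiN. Qed.

Section DR.
Variables (K : fieldType) (A : cdga K).
Implicit Types (a b : A) (x y : kaehler A) (w z : dR A).

Lemma dinD : {morph @din K A : a b / a + b}.
Proof. by move=> a b; rewrite /din /rgen -rpiD; apply/rpiP/rc_rel/dr_add. Qed.
Lemma din1 : din (1 : A) = 1.
Proof. exact/rpiP/rc_rel/dr_one. Qed.
Lemma dinM : {morph @din K A : a b / a * b}.
Proof. by move=> a b; rewrite /din /rgen -rpiM; apply/rpiP/rc_rel/dr_mul. Qed.
Lemma dsuD : {morph @dsu K A : x y / x + y}.
Proof. by move=> x y; rewrite /dsu /rgen -rpiD; apply/rpiP/rc_rel/dr_sadd. Qed.
Lemma din0 : din (0 : A) = 0. Proof. exact: morph_add0 dinD. Qed.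
Lemma dinN : {morph @din K A : a / - a}. Proof. exact: morph_addN dinD. Qed.
Lemma dsu0 : dsu (0 : kaehler A) = 0. Proof. exact: morph_add0 dsuD. Qed.
Lemma dsuN : {morph @dsu K A : x / - x}. Proof. exact: morph_addN dsuD. Qed.

Lemma dsuZ a x : dsu (a *: x) = din (parity a) * dsu x.
Proof.
elim/homog_ind: a => [|a b Ha Hb|m a am].
- by rewrite scale0r dsu0 (morph_add0 (@parityD _ A)) din0 mul0r.
- by rewrite scalerDl dsuD Ha Hb parityD dinD mulrDl.
rewrite (parity_homog am) (morph_sign dinD) -mulrA.
by rewrite /dsu /din /rgen -rpiM -rpi_sign; apply/rpiP/rc_rel/dr_smul.
Qed.

Lemma dsu_din m n x a : khomog m x -> homog n a ->
  dsu x * din a = (-1) ^+ (m.+1 * n) * (din a * dsu x).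
Proof.
move=> xm an; rewrite /dsu /din /rgen -!rpiM -rpi_sign.
exact/rpiP/rc_rel/dr_comm.
Qed.

Lemma dsu_dsu m n x y : khomog m x -> khomog n y ->
  dsu x * dsu y = (-1) ^+ (m.+1 * n.+1) * (dsu y * dsu x).
Proof.
move=> xm yn; rewrite /dsu /din /rgen -!rpiM -rpi_sign.
exact/rpiP/rc_rel/dr_scomm.
Qed.

Lemma dR_ind (P : dR A -> Prop) :
    (forall a, P (din a)) -> (forall x, P (dsu x)) ->
    (forall w z, P w -> P z -> P (w + z)) ->
    (forall w z, P w -> P z -> P (w * z)) ->
  forall w, P w.
Proof.
move=> Pi Ps PD PM; apply: pring_ind => //.
- by case.
- by rewrite -din0.
- by rewrite -din1.
- by move=> w Pw; rewrite -mulN1r -din1 -dinN; apply: PM.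
Qed.

Lemma dhomogN p n w : dhomog p n w -> dhomog p n (- w).
Proof.
move=> wp; rewrite -mulN1r -din1 -dinN -[p]add0n -[n]add0n.
by apply: dh_mul wp; apply/dh_in/homogN/homog1.
Qed.

Lemma dhomog_comm p q m n w z : dhomog p m w -> dhomog q n z ->
  w * z = (-1) ^+ (m * n) * (z * w).
Proof.
have sgnC k (u v : dR A) : u * ((-1) ^+ k * v) = (-1) ^+ k * (u * v).
  by rewrite !signr_if; case: odd; rewrite ?mulrN.
move=> wp; elim: wp q n z => {p m w} [m a am|m x xm|p m|p m w w' _ Hw _ Hw'|
    p p' m m' w w' _ Hw _ Hw'] q n z zq.
- elim: zq => {q n z} [n b bn|n y yn|q n|q n z z' _ Hz _ Hz'|
    q q' n n' z z' _ Hz _ Hz'].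
  + by rewrite -!dinM (homog_comm am bn) (morph_sign dinD).
  + by rewrite (dsu_din yn am) mulnC signrMK.
  + by rewrite mulr0 mul0r mulr0.
  + by rewrite mulrDr Hz Hz' mulrDl mulrDr.
  by rewrite mulrA Hz -!mulrA Hz' [z * _]sgnC !mulrA -exprD mulnDr.
- elim: zq => {q n z} [n b bn|n y yn|q n|q n z z' _ Hz _ Hz'|
    q q' n n' z z' _ Hz _ Hz'].
  + exact: dsu_din.
  + exact: dsu_dsu.
  + by rewrite mulr0 mul0r mulr0.
  + by rewrite mulrDr Hz Hz' mulrDl mulrDr.
  by rewrite mulrA Hz -!mulrA Hz' [z * _]sgnC !mulrA -exprD mulnDr.
- by rewrite mulr0 mul0r mulr0.
- by rewrite mulrDl (Hw _ _ _ zq) (Hw' _ _ _ zq) mulrDr mulrDr.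
rewrite -mulrA (Hw' _ _ _ zq) sgnC [w * (z * _)]mulrA (Hw _ _ _ zq) !mulrA.
by rewrite -exprD mulnDl addnC.
Qed.

(* s (d (a b)), the Leibniz rule for a |-> s (d a) *)
Lemma dsu_kdM a b :
  dsu (kd (a * b)) = dsu (kd a) * din b + din (parity a) * dsu (kd b).
Proof.
elim/homog_ind: a => [|a a' Ha Ha'|m a am].
- by rewrite mul0r kd0 dsu0 (morph_add0 (@parityD _ A)) din0 !mul0r addr0.
- by rewrite mulrDl !(kdD, dsuD, parityD, dinD, mulrDl) Ha Ha' addrACA.
elim/homog_ind: b => [|b b' Hb Hb'|n b bn].
- by rewrite mulr0 kd0 dsu0 din0 !mulr0 addr0.
- by rewrite mulrDr !(kdD, dsuD, dinD, mulrDr) Hb Hb' addrACA.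
rewrite (kdM am bn) dsuD !dsuZ addrC; congr (_ + _).
rewrite (dsu_din (kh_gen am) bn) (morph_sign (@parityD _ A)) (parity_homog bn).
rewrite !(morph_sign dinD) mulrA mulrA -exprD -mulrA mulSn.
by rewrite addnC mulrA.
Qed.

(* w |-> (-1)^|w| w *)
Definition dparity : dR A -> dR A :=
  rlift (fun t => match t with inl a => din (parity a)
                             | inr x => - dsu (kparity x) end).

Section DparityDef.
Let g (t : A + kaehler A) : dR A :=
  match t with inl a => din (parity a) | inr x => - dsu (kparity x) end.
Let reval_sign n t : reval g (rsign n t) = (-1) ^+ n * reval g t.
Proof. by rewrite signr_if /rsign; case: odd. Qed.
Let grel u v : @dR_rel K A u v -> reval g u = reval g v.
Proof.
case=> {u v} [a b||a b|x y|m a x am|m n x a xm an|m n x y xm yn];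
  rewrite ?reval_sign /=.
- by rewrite parityD dinD.
- by rewrite parity1 din1.
- by rewrite parityM dinM.
- by rewrite kparityD dsuD opprD.
- rewrite kparityZ dsuZ parityK (parity_homog am) (morph_sign dinD) -mulrA.
  by rewrite signrMK mulrN.
- rewrite (kparity_khomog xm) (parity_homog an).
  by rewrite !(mulNr, mulrN) (dsu_din (khomog_sign _ xm) (homog_sign _ an)).
- rewrite (kparity_khomog xm) (kparity_khomog yn) !mulrNN.
  by rewrite (dsu_dsu (khomog_sign _ xm) (khomog_sign _ yn)).
Qed.

Lemma dparity_din a : dparity (din a) = din (parity a).
Proof. exact: (rlift_gen grel). Qed.
Lemma dparity_dsu x : dparity (dsu x) = - dsu (kparity x).
Proof. exact: (rlift_gen grel). Qed.
Lemma dparity1 : dparity 1 = 1. Proof. exact: (rlift1 grel). Qed.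
Lemma dparityD : {morph dparity : w z / w + z}.
Proof. exact: (rliftD grel). Qed.
Lemma dparityM : {morph dparity : w z / w * z}.
Proof. exact: (rliftM grel). Qed.
End DparityDef.

Lemma dparity_dsu_homog n x : khomog n x ->
  dparity (dsu x) = (-1) ^+ n.+1 * dsu x.
Proof.
move=> xn; rewrite dparity_dsu (kparity_khomog xn) !signr_if /=.
by rewrite -signr_odd scaler_sign; case: odd; rewrite /= ?dsuN ?opprK.
Qed.

End DR.

Section DRdif.
Variables (K : fieldType) (A : cdga K).
Implicit Types (a b : A) (x y : kaehler A) (w z : dR A).

(* the differential delta, with delta (s x) = - s (delta x) *)
Definition ddif : dR A -> dR A :=
  pder (@dparity K A) (fun t => match t with inl a => din (dif a)
                                    | inr x => - dsu (kdif x) end).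

Section DdifDef.
Let g (t : A + kaehler A) : dR A :=
  match t with inl a => din (dif a) | inr x => - dsu (kdif x) end.
Let rderiv_sign n t :
  rderiv (@dparity K A) g (rsign n t) = (-1) ^+ n * rderiv (@dparity K A) g t.
Proof. by rewrite signr_if /rsign; case: odd. Qed.
Let dsu_kdif_din m n x a : khomog m x -> homog n a ->
  dsu (kdif x) * din a = (-1) ^+ (m * n) * (din a * dsu (kdif x)).
Proof.
case: m => [|m] xm an; last exact: (dsu_din (kdif_khomog xm) an).
by rewrite (kdif_khomog0 xm) dsu0 mulr0 mul0r mulr0.
Qed.
Let dsu_din_dif m n x a : khomog m x -> homog n a ->
  dsu x * din (dif a) = (-1) ^+ (m.+1 * n.+1) * (din (dif a) * dsu x).
Proof.
case: n => [|n] xm an.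
  by rewrite (dif_homog0 an) din0 mulr0 mul0r mulr0.
by rewrite (dsu_din xm (dif_homog an)) !signr_if !oddM /= negbK.
Qed.
Let dsu_kdif_dsu m n x y : khomog m x -> khomog n y ->
  dsu (kdif x) * dsu y = (-1) ^+ (m * n.+1) * (dsu y * dsu (kdif x)).
Proof.
case: m => [|m] xm yn; last exact: (dsu_dsu (kdif_khomog xm) yn).
by rewrite (kdif_khomog0 xm) dsu0 mulr0 mul0r mulr0.
Qed.
Let grel u v : @dR_rel K A u v ->
  rderiv (@dparity K A) g u = rderiv (@dparity K A) g v.
Proof.
case=> {u v} [a b||a b|x y|m a x am|m n x a xm an|m n x y xm yn];
  rewrite ?rderiv_sign /= -?/(rgen _ _) -?/(din _) -?/(dsu _).
- by rewrite dif_add dinD.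
- by rewrite dif1 din0.
- by rewrite dparity_din difM dinD !dinM.
- by rewrite kdifD dsuD opprD.
- rewrite kdifZ dsuD !dsuZ parityK dparity_din -[parity (dif a)]opprK.
  rewrite -dif_parity (parity_homog am) (morph_sign (@dif_add _ A)) dinN.
  rewrite !(morph_sign (@dinD K A)) !signr_if; case: odd;
    by rewrite ?(mulNr, mulrN, opprK, opprD).
- rewrite (dparity_dsu_homog xm) dparity_din (parity_homog an).
  rewrite (morph_sign (@dinD K A)) mulNr mulrN -!mulrA (dsu_kdif_din xm an).
  rewrite (dsu_din_dif xm an) !signr_if !oddM /=.
  case: (odd m); case: (odd n) => /=; rewrite ?(mulNr, mulrN, opprK, opprD) //;
    by rewrite addrC.
- rewrite (dparity_dsu_homog xm) (dparity_dsu_homog yn).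
  rewrite !(mulNr, mulrN) -!mulrA (dsu_kdif_dsu xm yn).
  have := dsu_kdif_dsu yn xm; move/(congr1 (fun z => (-1) ^+ (n * m.+1) * z)).
  rewrite signrMK => <-; rewrite !signr_if !oddM /=.
  case: (odd m); case: (odd n) => /=; rewrite ?(mulNr, mulrN, opprK, opprD) //;
    by rewrite addrC.
Qed.

Lemma ddif_din a : ddif (din a) = din (dif a).
Proof. exact: (pder_gen (@dparity1 K A) (@dparityD K A) (@dparityM K A) grel). Qed.
Lemma ddif_dsu x : ddif (dsu x) = - dsu (kdif x).
Proof. exact: (pder_gen (@dparity1 K A) (@dparityD K A) (@dparityM K A) grel). Qed.
Lemma ddifD : {morph ddif : w z / w + z}.
Proof. exact: (pderD (@dparity1 K A) (@dparityD K A) (@dparityM K A) grel). Qed.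
Lemma ddifM w z : ddif (w * z) = ddif w * z + dparity w * ddif z.
Proof. exact: (pderM (@dparity1 K A) (@dparityD K A) (@dparityM K A) grel). Qed.
End DdifDef.

(* x |-> the de Rham differential of s x, that is a (d b) |-> +- d a d b *)
Definition kappa : kaehler A -> dR A :=
  mlift (fun _ => 0)
    (fun a x w => dsu (kd (parity a)) * dsu x + din a * w).

Section KappaDef.
Let g (a : A) : dR A := 0.
Let h := fun (a : A) (x : kaehler A) (w : dR A) =>
  dsu (kd (parity a)) * dsu x + din a * w.
Let hDl a b x w : h (a + b) x w = h a x w + h b x w.
Proof. by rewrite /h parityD kdD dsuD dinD !mulrDl addrACA. Qed.
Let hDr a x y w z : h a (x + y) (w + z) = h a x w + h a y z.
Proof. by rewrite /h dsuD !mulrDr addrACA. Qed.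
Let hA a b x w : h a (b *: x) (h b x w) = h (a * b) x w.
Proof.
rewrite /h dsuZ parityM dsu_kdM parityK dinM mulrDr mulrDl !mulrA.
by rewrite addrA.
Qed.
Let h1 x w : h 1 x w = w.
Proof. by rewrite /h parity1 kd1 dsu0 mul0r add0r din1 mul1r. Qed.
Let hrel u v : @kaehler_rel K A u v -> mrec g h u = mrec g h v.
Proof.
case=> /= [a b|k|m n a b am bn]; rewrite /h /g ?addr0 ?mulr0 ?addr0 //.
rewrite -/(mgen _ _) -/(kd b) -/(mgen _ _) -/(kd a).
rewrite (morph_sign (@parityD _ A)) (parity_homog am) (parity_homog bn).
rewrite !kd_sign.
have := dsu_dsu (kh_gen bn) (kh_gen am).
rewrite !signr_if !oddM /=.
by case: (odd m); case: (odd n) => /= E;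
  rewrite ?(dsuN, mulNr, opprK) E ?(addrN, addNr).
Qed.

Lemma kappa_kd a : kappa (kd a) = 0.
Proof. exact: (mlift_gen hDl hDr hA h1 hrel). Qed.
Lemma kappaD : {morph kappa : x y / x + y}.
Proof. exact: (mliftD hDl hDr hA h1 hrel). Qed.
Lemma kappaZ a x :
  kappa (a *: x) = dsu (kd (parity a)) * dsu x + din a * kappa x.
Proof. exact: (mliftZ hDl hDr hA h1 hrel). Qed.
End KappaDef.

Lemma kappa_dhomog n x : khomog n x -> dhomog 2 n.+2 (kappa x).
Proof.
elim=> {n x} [n a an|n|n x y _ Hx _ Hy|m n a x am xn Hx].
- by rewrite kappa_kd; apply: dh_zero.
- by rewrite (morph_add0 kappaD); apply: dh_zero.
- by rewrite kappaD; apply: dh_add.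
rewrite kappaZ; apply: dh_add; last first.
  by rewrite -!addnS; apply: (@dh_mul _ _ 0 2) => //; apply: dh_in.
have -> : (m + n).+2 = (m.+1 + n.+1)%N by rewrite addSn addnS.
apply: (@dh_mul _ _ 1 1); last exact: dh_su.
exact/dh_su/kh_gen/homog_parity.
Qed.

(* the de Rham differential, with a |-> s (d a) and s (d a) |-> 0 *)
Definition ddR : dR A -> dR A :=
  pder (@dparity K A) (fun t => match t with inl a => dsu (kd a)
                                           | inr x => kappa x end).

Section DdRDef.
Let g (t : A + kaehler A) : dR A :=
  match t with inl a => dsu (kd a) | inr x => kappa x end.
Let rderiv_sign n t :
  rderiv (@dparity K A) g (rsign n t) = (-1) ^+ n * rderiv (@dparity K A) g t.
Proof. by rewrite signr_if /rsign; case: odd. Qed.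
Let grel u v : @dR_rel K A u v ->
  rderiv (@dparity K A) g u = rderiv (@dparity K A) g v.
Proof.
case=> {u v} [a b||a b|x y|m a x am|m n x a xm an|m n x y xm yn];
  rewrite ?rderiv_sign /= -?/(rgen _ _) -?/(din _) -?/(dsu _).
- by rewrite kdD dsuD.
- by rewrite kd1 dsu0.
- by rewrite dparity_din dsu_kdM.
- by rewrite kappaD.
- rewrite kappaZ dparity_din (parity_homog am) (morph_sign (@dinD K A)).
  rewrite kd_sign !signr_if; case: odd;
    by rewrite ?(dsuN, mulNr, mulrN, opprD, opprK).
- rewrite (dparity_dsu_homog xm) dparity_din (parity_homog an) -!mulrA.
  rewrite (dhomog_comm (kappa_dhomog xm) (dh_in an)) (dsu_dsu xm (kh_gen an)).
  rewrite (morph_sign (@dinD K A)) !signr_if !oddM /= negbK.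
  case: (odd m); case: (odd n) => /=; rewrite ?(mulNr, mulrN, opprK, opprD) //;
    by rewrite addrC.
- rewrite (dparity_dsu_homog xm) (dparity_dsu_homog yn) -!mulrA.
  rewrite (dhomog_comm (kappa_dhomog xm) (dh_su yn)).
  have := dhomog_comm (kappa_dhomog yn) (dh_su xm).
  move/(congr1 (fun z => (-1) ^+ (n.+2 * m.+1) * z)); rewrite signrMK => <-.
  rewrite !signr_if !oddM /= !negbK.
  case: (odd m); case: (odd n) => /=; rewrite ?(mulNr, mulrN, opprK, opprD) //;
    by rewrite addrC.
Qed.

Lemma ddR_din a : ddR (din a) = dsu (kd a).
Proof. exact: (pder_gen (@dparity1 K A) (@dparityD K A) (@dparityM K A) grel). Qed.
Lemma ddR_dsu x : ddR (dsu x) = kappa x.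
Proof. exact: (pder_gen (@dparity1 K A) (@dparityD K A) (@dparityM K A) grel). Qed.
Lemma ddR_add : {morph ddR : w z / w + z}.
Proof. exact: (pderD (@dparity1 K A) (@dparityD K A) (@dparityM K A) grel). Qed.
Lemma ddR_mul w z : ddR (w * z) = ddR w * z + dparity w * ddR z.
Proof. exact: (pderM (@dparity1 K A) (@dparityD K A) (@dparityM K A) grel). Qed.
Lemma ddR_dsu_kd a : ddR (dsu (kd a)) = 0.
Proof. by rewrite ddR_dsu kappa_kd. Qed.
End DdRDef.


End DRdif.

Section DRmap.
Variables (K : fieldType) (A B : cdga K) (f : gca_hom A B).
Implicit Types (a b : A) (x y : kaehler A) (w z : dR A).

(* pullback of forms *)
Definition dmap : dR A -> dR B :=
  rlift (fun t => match t with inl a => din (f a)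
                             | inr x => dsu (kmap f x) end).

Section DmapDef.
Let g (t : A + kaehler A) : dR B :=
  match t with inl a => din (f a) | inr x => dsu (kmap f x) end.
Let reval_sign n t : reval g (rsign n t) = (-1) ^+ n * reval g t.
Proof. by rewrite signr_if /rsign; case: odd. Qed.
Let grel u v : @dR_rel K A u v -> reval g u = reval g v.
Proof.
case=> {u v} [a b||a b|x y|m a x am|m n x a xm an|m n x y xm yn];
  rewrite ?reval_sign /=.
- by rewrite rmorphD dinD.
- by rewrite rmorph1 din1.
- by rewrite rmorphM dinM.
- by rewrite kmapD dsuD.
- rewrite kmapZ dsuZ parity_map (parity_homog am) (morph_sign (rmorphD f)).
  by rewrite (morph_sign (@dinD K B)) mulrA.
- exact: (dsu_din (kmap_khomog f xm) (homog_map f an)).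
- exact: (dsu_dsu (kmap_khomog f xm) (kmap_khomog f yn)).
Qed.

Lemma dmap_din a : dmap (din a) = din (f a).
Proof. exact: (rlift_gen grel). Qed.
Lemma dmap_dsu x : dmap (dsu x) = dsu (kmap f x).
Proof. exact: (rlift_gen grel). Qed.
Lemma dmap1 : dmap 1 = 1. Proof. exact: (rlift1 grel). Qed.
Lemma dmapD : {morph dmap : w z / w + z}. Proof. exact: (rliftD grel). Qed.
Lemma dmapM : {morph dmap : w z / w * z}. Proof. exact: (rliftM grel). Qed.
End DmapDef.

Lemma dmap_dhomog p n w : dhomog p n w -> dhomog p n (dmap w).
Proof.
elim=> {p n w} [n a an|n x xn|p n|p n w z _ Hw _ Hz|p q m n w z _ Hw _ Hz].
- by rewrite dmap_din; apply/dh_in/homog_map.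
- by rewrite dmap_dsu; apply/dh_su/kmap_khomog.
- by rewrite (morph_add0 dmapD); apply: dh_zero.
- by rewrite dmapD; apply: dh_add.
- by rewrite dmapM; apply: dh_mul.
Qed.

End DRmap.

(* the algebra of functions generated by a set of K-valued functions *)
Inductive fun_alg (K : fieldType) (T : Type) (S : set (T -> K)) :
    (T -> K) -> Prop :=
  | fa_gen f : S f -> fun_alg S f
  | fa_const k : fun_alg S (fun=> k)
  | fa_add f g : fun_alg S f -> fun_alg S g -> fun_alg S (fun t => f t + g t)
  | fa_mul f g : fun_alg S f -> fun_alg S g -> fun_alg S (fun t => f t * g t).

(* When S generates the algebra O(T) of regular functions on an affine variety
   T, these are the functions T -> A in the image of the injection of
   A (x) O(T) into all functions. *)
Inductive regval (K : fieldType) (T : Type) (S : set (T -> K)) (A : gca K) :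
    (T -> A) -> Prop :=
  | rv_zero : regval S (fun=> 0)
  | rv_tensor f a : fun_alg S f -> regval S (fun t => scal A (f t) * a)
  | rv_add F G : regval S F -> regval S G -> regval S (fun t => F t + G t).

Section RegvalTheory.
Variables (K : fieldType) (A : gca K).

Lemma scalC k (x : A) : scal A k * x = x * scal A k.
Proof.
elim/homog_ind: x => [|x y Hx Hy|n x xn]; first by rewrite mulr0 mul0r.
  by rewrite mulrDl mulrDr Hx Hy.
by rewrite (homog_comm (homog_scal A k) xn) mul0n expr0 mul1r.
Qed.

Lemma part_scalM n k (x : A) : part n (scal A k * x) = scal A k * part n x.
Proof.
elim/homog_ind: x => [|x y Hx Hy|m x xm]; first by rewrite mulr0 part0 mulr0.
  by rewrite mulrDr !part_add Hx Hy mulrDr.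
rewrite (part_homog n xm) (part_homog n (homogM (homog_scal A k) xm)) add0n.
by case: eqP; rewrite // mulr0.
Qed.

Variables (T : Type) (S : set (T -> K)).

Lemma regval_const a : regval S (fun=> a : A).
Proof.
have -> : (fun=> a) = (fun t => scal A ((fun=> 1) t) * a) :> (T -> A).
  by apply/funext => t; rewrite rmorph1 mul1r.
by apply: rv_tensor; apply: fa_const.
Qed.

Lemma regvalN (F : T -> A) : regval S F -> regval S (fun t => - F t).
Proof.
elim=> [|f a Sf|F1 F2 _ H1 _ H2].
- by rewrite oppr0; apply: rv_zero.
- have -> : (fun t => - (scal A (f t) * a)) = (fun t => scal A (f t) * - a).
    by apply/funext => t; rewrite mulrN.
  exact: rv_tensor.
have -> : (fun t => - (F1 t + F2 t)) = (fun t => - F1 t + - F2 t).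
  by apply/funext => t; rewrite opprD.
exact: rv_add.
Qed.

Lemma regvalM (F G : T -> A) :
  regval S F -> regval S G -> regval S (fun t => F t * G t).
Proof.
move=> SF; elim: SF G => [|f a Sf|F1 F2 _ H1 _ H2] G SG.
- have -> : (fun t => 0 * G t) = (fun=> 0).
    by apply/funext => t; rewrite mul0r.
  exact: rv_zero.
- elim: SG => [|g b Sg|G1 G2 _ H1 _ H2].
  + have -> : (fun t => scal A (f t) * a * 0) = (fun=> 0).
      by apply/funext => t; rewrite mulr0.
    exact: rv_zero.
  + have -> : (fun t => scal A (f t) * a * (scal A (g t) * b)) =
              (fun t => scal A (f t * g t) * (a * b)).
      apply/funext => t; rewrite rmorphM -!mulrA; congr (_ * _).
      by rewrite mulrA -scalC -mulrA.
    by apply: rv_tensor; apply: fa_mul.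
  have -> : (fun t => scal A (f t) * a * (G1 t + G2 t)) =
            (fun t => scal A (f t) * a * G1 t + scal A (f t) * a * G2 t).
    by apply/funext => t; rewrite mulrDr.
  exact: rv_add.
have -> : (fun t => (F1 t + F2 t) * G t) = (fun t => F1 t * G t + F2 t * G t).
  by apply/funext => t; rewrite mulrDl.
by apply: rv_add; [apply: H1|apply: H2].
Qed.

(* post-composition with a K-linear map *)
Lemma regval_lin (B : gca K) (l : A -> B) (F : T -> A) :
    {morph l : x y / x + y} -> (forall k x, l (scal A k * x) = scal B k * l x) ->
  regval S F -> regval S (fun t => l (F t)).
Proof.
move=> lD lZ; elim=> [|f a Sf|F1 F2 _ H1 _ H2].
- by rewrite (morph_add0 lD); apply: rv_zero.
- have -> : (fun t => l (scal A (f t) * a)) = (fun t => scal B (f t) * l a).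
    by apply/funext => t; rewrite lZ.
  exact: rv_tensor.
have -> : (fun t => l (F1 t + F2 t)) = (fun t => l (F1 t) + l (F2 t)).
  by apply/funext => t; rewrite lD.
exact: rv_add.
Qed.

Lemma regval_part n (F : T -> A) : regval S F -> regval S (fun t => part n (F t)).
Proof. exact: (regval_lin (@part_add _ A n) (@part_scalM n)). Qed.

Lemma regval_bound (F : T -> A) : regval S F ->
  exists N, forall M, (N <= M)%N -> forall t, F t = \sum_(n < M) part n (F t).
Proof.
elim=> [|f a Sf|F1 F2 _ [N1 H1] _ [N2 H2]].
- by exists 0 => M _ t; rewrite big1 // => i _; rewrite part0.
- have [N aE] := part_bound a; exists N => M NM t.
  rewrite {1}(aE M NM) mulr_sumr; apply: eq_bigr => i _.
  by rewrite part_scalM.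
exists (maxn N1 N2) => M; rewrite geq_max => /andP[N1M N2M] t.
rewrite {1}(H1 M N1M t) {1}(H2 M N2M t) -big_split /=.
by apply: eq_bigr => i _; rewrite part_add.
Qed.

Lemma regval_comp (T' : Type) (S' : set (T' -> K)) (phi : T' -> T) (F : T -> A) :
    (forall f, S f -> fun_alg S' (fun t => f (phi t))) ->
  regval S F -> regval S' (fun t => F (phi t)).
Proof.
move=> Sphi; elim=> [|f a Sf|F1 F2 _ H1 _ H2]; first exact: rv_zero.
  have: fun_alg S' (fun t => f (phi t)).
    elim: Sf => {f} [f /Sphi//|k|f g _ Hf _ Hg|f g _ Hf _ Hg].
    - exact: fa_const.
    - exact: fa_add.
    - exact: fa_mul.
  exact: (@rv_tensor _ _ S' A (fun t => f (phi t)) a).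
exact: (@rv_add _ _ S' A (fun t => F1 (phi t)) (fun t => F2 (phi t))).
Qed.

End RegvalTheory.

Section Tensor.
Variables (K : fieldType) (T : Type) (S : set (T -> K)).

Section TensorGca.
Variable A : gca K.

Definition regval_pred : pred (T -> A) := fun F => `[< regval S F >].

(* A (x) O(T) *)
Record tens_car := TensCar { tval :> T -> A; _ : regval_pred tval }.

HB.instance Definition _ := [isSub for tval].
HB.instance Definition _ := [Choice of tens_car by <:].

Fact regval_subring : subring_closed regval_pred.
Proof.
split=> [|F G /asboolP SF /asboolP SG|F G /asboolP SF /asboolP SG].
- exact/asboolP/regval_const.
- by apply/asboolP/rv_add => //; apply: regvalN.
- exact/asboolP/regvalM.
Qed.

HB.instance Definition _ :=
  GRing.SubChoice_isSubPzRing.Build (T -> A) regval_pred tens_car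
    regval_subring.

Lemma tvalP (F : tens_car) : regval S F.
Proof. by case: F => F /= /asboolP. Qed.

Definition mktens (F : T -> A) (SF : regval S F) : tens_car :=
  TensCar (introT (asboolP _) SF).

Lemma tens_eq (F G : tens_car) : (forall t, F t = G t) -> F = G.
Proof. by move=> FG; apply: val_inj; apply/funext. Qed.

Lemma tvalD (F G : tens_car) t : (F + G) t = F t + G t. Proof. by []. Qed.
Lemma tvalM (F G : tens_car) t : (F * G) t = F t * G t. Proof. by []. Qed.
Lemma tval1 t : (1 : tens_car) t = 1. Proof. by []. Qed.
Lemma tval0 t : (0 : tens_car) t = 0. Proof. by []. Qed.
Lemma tvalN (F : tens_car) t : (- F) t = - F t. Proof. by []. Qed.
Lemma tval_sign n (F : tens_car) t : ((-1) ^+ n * F) t = (-1) ^+ n * F t.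
Proof. by rewrite !signr_if; case: odd. Qed.
Lemma tval_sum (I : Type) (r : seq I) (P : pred I) (F : I -> tens_car) t :
  (\sum_(i <- r | P i) F i) t = \sum_(i <- r | P i) F i t.
Proof. by elim/big_rec2: _ => // i x y _ <-. Qed.

Definition tens_scal_fun (k : K) : tens_car :=
  mktens (regval_const S (scal A k)).

Fact tens_scal_zmod : zmod_morphism tens_scal_fun.
Proof. by move=> k l; apply: tens_eq => t; rewrite /= rmorphB. Qed.
Fact tens_scal_monoid : monoid_morphism tens_scal_fun.
Proof.
by split=> [|k l]; apply: tens_eq => t; rewrite /= ?rmorph1 ?rmorphM.
Qed.
HB.instance Definition _ := GRing.isZmodMorphism.Build K tens_car
  tens_scal_fun tens_scal_zmod.
HB.instance Definition _ := GRing.isMonoidMorphism.Build K tens_car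
  tens_scal_fun tens_scal_monoid.

Definition tens_part n (F : tens_car) : tens_car :=
  mktens (regval_part n (tvalP F)).

Fact tens_part_add n : {morph tens_part n : F G / F + G}.
Proof. by move=> F G; apply: tens_eq => t; rewrite /= part_add. Qed.
Fact tens_part_part m n F :
  tens_part m (tens_part n F) = if m == n then tens_part n F else 0.
Proof.
by apply: tens_eq => t; rewrite /= part_part; case: eqP.
Qed.
Fact tens_part_sum F : exists N, F = \sum_(n < N) tens_part n F.
Proof.
have [N FE] := regval_bound (tvalP F); exists N; apply: tens_eq => t.
by rewrite (FE N) // tval_sum.
Qed.
Fact tens_part_scal k : tens_part 0 (tens_scal_fun k) = tens_scal_fun k.
Proof. by apply: tens_eq => t; rewrite /= part_scal. Qed.
Lemma tens_homog n F : tens_part n F = F <-> forall t, homog n (F t).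
Proof.
split=> [FE t|FE]; last exact: tens_eq.
by rewrite /homog -{2}FE.
Qed.
Fact tens_part_mul m n F G : tens_part m F = F -> tens_part n G = G ->
  tens_part (m + n) (F * G) = F * G.
Proof.
move=> /tens_homog Fm /tens_homog Gn; apply/tens_homog => t.
exact: homogM.
Qed.
Fact tens_part_comm m n F G : tens_part m F = F -> tens_part n G = G ->
  F * G = (-1) ^+ (m * n) * (G * F).
Proof.
move=> /tens_homog Fm /tens_homog Gn; apply: tens_eq => t.
by rewrite tval_sign tvalM (homog_comm (Fm t) (Gn t)).
Qed.

Definition tens_gca : gca K := @Gca K tens_car tens_scal_fun tens_part
  tens_part_add tens_part_part tens_part_sum tens_part_scal
  tens_part_mul tens_part_comm.

End TensorGca.

Section TensorCdga.
Variable A : cdga K.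

Lemma dif_scalM k (x : A) : dif (scal A k * x) = scal A k * dif x.
Proof. by rewrite (dif_mul x (homog_scal A k)) dif_scal mul0r add0r expr0 mul1r. Qed.

Definition tens_dif (F : tens_gca A) : tens_gca A :=
  mktens (regval_lin (@dif_add _ A) (@dif_scalM) (tvalP F)).

Fact tens_dif_add : {morph tens_dif : F G / F + G}.
Proof. by move=> F G; apply: tens_eq => t; rewrite /= dif_add. Qed.
Fact tens_dif_homog n F : homog n.+1 F -> homog n (tens_dif F).
Proof.
move=> /tens_homog Fn; apply/tens_homog => t; exact: dif_homog (Fn t).
Qed.
Fact tens_dif_homog0 F : homog 0 F -> tens_dif F = 0.
Proof.
by move=> /tens_homog F0; apply: tens_eq => t; apply: dif_homog0 (F0 t).
Qed.
Fact tens_dif_mul n F G : homog n F ->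
  tens_dif (F * G) = tens_dif F * G + (-1) ^+ n * (F * tens_dif G).
Proof.
move=> /tens_homog Fn; apply: tens_eq => t.
by rewrite tvalD tval_sign /= (dif_mul _ (Fn t)).
Qed.
Fact tens_dif_dif F : tens_dif (tens_dif F) = 0.
Proof. by apply: tens_eq => t; rewrite /= dif_dif. Qed.

Definition tens : cdga K := Cdga tens_dif_add tens_dif_homog tens_dif_homog0
  tens_dif_mul tens_dif_dif.

End TensorCdga.
End Tensor.

(* The map F |-> (t |-> alpha_t (F (phi t))) *)
Section TensorMap.
Variables (K : fieldType) (T T' : Type) (S : set (T -> K)) (S' : set (T' -> K)).
Variables (A B : cdga K) (phi : T' -> T) (alpha : T' -> cdga_hom A B).
Hypothesis alphaP : forall F, regval S F ->
  regval S' (fun t => alpha t (F (phi t))).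

Definition tens_map_fun (F : tens S A) : tens S' B :=
  mktens (alphaP (tvalP F)).

Fact tens_map_zmod : zmod_morphism tens_map_fun.
Proof. by move=> F G; apply: tens_eq => t; rewrite /= rmorphB. Qed.
Fact tens_map_monoid : monoid_morphism tens_map_fun.
Proof. by split=> [|F G]; apply: tens_eq => t; rewrite /= ?rmorph1 ?rmorphM. Qed.
HB.instance Definition _ := GRing.isZmodMorphism.Build (tens S A) (tens S' B)
  tens_map_fun tens_map_zmod.
HB.instance Definition _ := GRing.isMonoidMorphism.Build (tens S A) (tens S' B)
  tens_map_fun tens_map_monoid.

Fact tens_map_scal k : tens_map_fun (scal (tens S A) k) = scal (tens S' B) k.
Proof. by apply: tens_eq => t; rewrite /= gca_map_scal. Qed.
Fact tens_map_part n F : tens_map_fun (part n F) = part n (tens_map_fun F).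
Proof. by apply: tens_eq => t; rewrite /= gca_map_part. Qed.
Fact tens_map_dif F : tens_map_fun (dif F) = dif (tens_map_fun F).
Proof. by apply: tens_eq => t; rewrite /= cdga_map_dif. Qed.

Definition tens_map : cdga_hom (tens S A) (tens S' B) :=
  @CdgaHom _ (tens S A) (tens S' B)
    (@GcaHom _ (tens S A) (tens S' B) tens_map_fun tens_map_scal tens_map_part)
    tens_map_dif.
End TensorMap.

(* a |-> a (x) 1 *)
Section TensorConst.
Variables (K : fieldType) (T : Type) (S : set (T -> K)) (A : cdga K).

Definition tens_const_fun (a : A) : tens S A := mktens (regval_const S a).
Fact tens_const_zmod : zmod_morphism tens_const_fun.
Proof. by move=> a b; apply: tens_eq => t. Qed.
Fact tens_const_monoid : monoid_morphism tens_const_fun.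
Proof. by split=> [|a b]; apply: tens_eq => t. Qed.
HB.instance Definition _ := GRing.isZmodMorphism.Build A (tens S A)
  tens_const_fun tens_const_zmod.
HB.instance Definition _ := GRing.isMonoidMorphism.Build A (tens S A)
  tens_const_fun tens_const_monoid.
Fact tens_const_scal k : tens_const_fun (scal A k) = scal (tens S A) k.
Proof. exact: tens_eq. Qed.
Fact tens_const_part n a : tens_const_fun (part n a) = part n (tens_const_fun a).
Proof. exact: tens_eq. Qed.
Fact tens_const_dif a : tens_const_fun (dif a) = dif (tens_const_fun a).
Proof. exact: tens_eq. Qed.

Definition tens_const : cdga_hom A (tens S A) :=
  @CdgaHom _ A (tens S A)
    (@GcaHom _ A (tens S A) tens_const_fun tens_const_scal tens_const_part)
    tens_const_dif.
End TensorConst.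

Definition cdga_id (K : fieldType) (A : cdga K) : cdga_hom A A :=
  @CdgaHom _ A A (@GcaHom _ A A idfun (fun=> erefl) (fun _ _ => erefl))
    (fun=> erefl).

(* the ground field, in degree 0 *)
Section Ground.
Variable K : fieldType.

Definition ground_part (n : nat) (x : K) : K := if n == 0 then x else 0.
Fact ground_part_add n : {morph ground_part n : x y / x + y}.
Proof. by move=> x y; rewrite /ground_part; case: eqP; rewrite ?addr0. Qed.
Fact ground_part_part m n x :
  ground_part m (ground_part n x) = if m == n then ground_part n x else 0.
Proof. by case: m n => [|m] [|n] //=; rewrite /ground_part //= if_same. Qed.
Fact ground_part_sum x : exists N, x = \sum_(n < N) ground_part n x.
Proof. by exists 1; rewrite big_ord1. Qed.
Fact ground_homog n x : ground_part n x = x -> n = 0 \/ x = 0.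
Proof. by case: n => [|n] xn; [left|right] => //; exact: (esym xn). Qed.
Fact ground_part_mul m n x y : ground_part m x = x -> ground_part n y = y ->
  ground_part (m + n) (x * y) = x * y.
Proof.
move=> /ground_homog[->|->] /ground_homog[->|->];
  by rewrite ?(mulr0, mul0r) /ground_part // if_same.
Qed.
Fact ground_part_comm m n x y : ground_part m x = x -> ground_part n y = y ->
  x * y = (-1) ^+ (m * n) * (y * x).
Proof.
move=> /ground_homog[->|->] /ground_homog[->|->];
  by rewrite ?(mulr0, mul0r) ?muln0 ?expr0 ?mul1r // mulrC.
Qed.
Definition ground_gca : gca K := @Gca K K idfun ground_part
  ground_part_add ground_part_part ground_part_sum (fun=> erefl)
  ground_part_mul ground_part_comm.

Definition ground_dif (x : ground_gca) : ground_gca := 0.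
Fact ground_dif_add : {morph ground_dif : x y / x + y}.
Proof. by move=> x y; rewrite addr0. Qed.
Fact ground_dif_homog n x : homog n.+1 x -> homog n (ground_dif x).
Proof. by move=> _; apply: homog0. Qed.
Fact ground_dif_mul n x y : homog n x ->
  ground_dif (x * y) = ground_dif x * y + (-1) ^+ n * (x * ground_dif y).
Proof. by move=> _; rewrite mul0r !mulr0 addr0. Qed.
Definition ground : cdga K := @Cdga K ground_gca ground_dif ground_dif_add
  ground_dif_homog (fun _ _ => erefl) ground_dif_mul (fun=> erefl).

Variable A : cdga K.
Fact ground_map_part n x : scal A (ground_part n x) = part n (scal A x).
Proof.
rewrite (part_homog n (homog_scal A x)) /ground_part.
by case: eqP; rewrite // rmorph0.
Qed.
Fact ground_map_dif (x : ground) : scal A (dif x) = dif (scal A x).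
Proof. by rewrite dif_scal rmorph0. Qed.
Definition ground_map : cdga_hom ground A :=
  @CdgaHom _ ground A
    (@GcaHom _ ground A (scal A) (fun=> erefl) ground_map_part) ground_map_dif.
End Ground.

(* A linear algebraic group over an algebraically closed field K: a Zariski
   closed subgroup of GL_n(K), identified with its set of K-points. *)
Record linalg_group (K : fieldType) := LinalgGroup {
  lg_rank : nat;
  lg_set : 'M[K]_lg_rank -> Prop;
  lg_closed : exists2 E : set ('M[K]_lg_rank -> K),
    (forall p, E p ->
       fun_alg (fun f : 'M[K]_lg_rank -> K => exists i k, f = fun M => M i k) p) &
    (forall M, lg_set M <-> M \in unitmx /\ forall p, E p -> p M = 0);
  lg_set1 : lg_set 1%:M;
  lg_setM : forall M N, lg_set M -> lg_set N -> lg_set (M *m N);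
  lg_setV : forall M, lg_set M -> lg_set (invmx M)
}.

Record lg_pt (K : fieldType) (G : linalg_group K) := LgPt {
  lg_mx :> 'M[K]_(lg_rank G);
  lg_mxP : lg_set lg_mx
}.

Section Group.
Variables (K : fieldType) (G : linalg_group K).

Definition lg_one : lg_pt G := LgPt (lg_set1 G).
Definition lg_mul (g h : lg_pt G) : lg_pt G :=
  LgPt (lg_setM (lg_mxP g) (lg_mxP h)).

Lemma lg_unit (g : lg_pt G) : lg_mx g \in unitmx.
Proof. by have [E _ GE] := lg_closed G; case/GE: (lg_mxP g). Qed.

(* generators of O(G): the matrix entries and the inverse of the determinant *)
Definition lg_gen : set (lg_pt G -> K) :=
  fun f => (exists i k, f = fun g => lg_mx g i k) \/
           f = fun g => (\det (lg_mx g))^-1.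

Definition lpow (j : nat) : Type := 'I_j -> lg_pt G.

(* generators of O(G^j) = O(G) (x) ... (x) O(G) *)
Definition lpow_gen (j : nat) : set (lpow j -> K) :=
  fun f => exists a : 'I_j, exists2 h, lg_gen h & f = fun g => h (g a).

Definition rational_rep (m : nat) (rho : lg_pt G -> 'M[K]_m) : Prop :=
  [/\ rho lg_one = 1%:M,
      forall g h, rho (lg_mul g h) = rho g *m rho h &
      forall i k, fun_alg lg_gen (fun g => rho g i k)].

(* Every finite-dimensional rational representation is completely reducible;
   following mxalgebra, rho g acts on row vectors by right multiplication and
   subspaces are row spaces. *)
Definition linearly_reductive : Prop :=
  forall (m : nat) (rho : lg_pt G -> 'M[K]_m), rational_rep rho ->
  forall U : 'M[K]_m, (forall g, stablemx U (rho g)) ->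
  exists W : 'M[K]_m, [/\ forall g, stablemx W (rho g),
    (U + W == 1%:M)%MS & (U :&: W == (0 : 'M[K]_m))%MS].

Lemma fun_alg_sum (T : Type) (S : set (T -> K)) (I : Type) (r : seq I)
    (F : I -> T -> K) : (forall i, fun_alg S (F i)) ->
  fun_alg S (fun t => \sum_(i <- r) F i t).
Proof.
move=> SF; elim: r => [|i r Hr].
  have -> : (fun t => \sum_(i <- [::]) F i t) = (fun=> 0).
    by apply/funext => t; rewrite big_nil.
  exact: fa_const.
have -> : (fun t => \sum_(i <- i :: r) F i t) =
          (fun t => F i t + (fun t => \sum_(i <- r) F i t) t).
  by apply/funext => t; rewrite big_cons.
exact: fa_add.
Qed.

Lemma lpow_gen_coord j (a : 'I_j) f : lg_gen f ->
  fun_alg (@lpow_gen j) (fun g => f (g a)).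
Proof. by move=> Gf; apply: fa_gen; exists a; exists f. Qed.

Lemma lpow_gen_mul j (a b : 'I_j) f : lg_gen f ->
  fun_alg (@lpow_gen j) (fun g => f (lg_mul (g a) (g b))).
Proof.
case=> [[i [k ->]]|->].
  have -> : (fun g : lpow j => lg_mx (lg_mul (g a) (g b)) i k) =
    (fun g => \sum_l (fun g : lpow j => lg_mx (g a) i l * lg_mx (g b) l k) g).
    by apply/funext => g; rewrite mxE.
  apply: fun_alg_sum => l; apply: fa_mul.
    by apply: (@lpow_gen_coord j a (fun g => lg_mx g i l)); left; exists i, l.
  by apply: (@lpow_gen_coord j b (fun g => lg_mx g l k)); left; exists l, k.
have -> : (fun g : lpow j => (\det (lg_mx (lg_mul (g a) (g b))))^-1) =
  (fun g => (\det (lg_mx (g a)))^-1 * (\det (lg_mx (g b)))^-1).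
  by apply/funext => g; rewrite det_mulmx invfM.
by apply: fa_mul; apply: (@lpow_gen_coord j _ (fun g => (\det (lg_mx g))^-1));
  right.
Qed.

End Group.

(* A rational left action of G on A by automorphisms of the cdga, that is, a
   right action of G on Spec A by g^* = act g; [act_rational] says that
   a |-> (g |-> act g a) is a coaction A -> A (x) O(G). *)
Record action (K : fieldType) (G : linalg_group K) (A : cdga K) := Action {
  act :> lg_pt G -> cdga_hom A A;
  act_one : forall a, act (lg_one G) a = a;
  act_mul : forall g h a, act (lg_mul g h) a = act g (act h a);
  act_rational : forall a, regval (@lg_gen K G) (fun g => act g a)
}.

Section Simplicial.
Variables (K : fieldType) (G : linalg_group K) (A : cdga K) (rho : action G A).

(* functions on Spec A x G^j *)
Definition lvl (j : nat) : cdga K := tens (@lpow_gen K G j) A.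

(* The face maps of Spec A x G^j:
   d_0 (x, g_0, .., g_j) = (x g_0, g_1, .., g_j),
   d_k (x, g_0, .., g_j) = (x, g_0, .., g_(k-1) g_k, .., g_j) for 0 < k <= j,
   d_(j+1) (x, g_0, .., g_j) = (x, g_0, .., g_(j-1)).
   [face_pt] is the component in G^j; [face_act] is the family of pullbacks
   along the component in Spec A, for fixed (g_0, .., g_j). *)
Definition face_pt (j k : nat) (g : lpow G j.+1) : lpow G j :=
  fun i => if (i.+1 < k)%N then g (widen_ord (leqnSn j) i)
           else if i.+1 == k then
             lg_mul (g (widen_ord (leqnSn j) i)) (g (lift ord0 i))
           else g (lift ord0 i).

Definition face_act (j k : nat) (g : lpow G j.+1) : cdga_hom A A :=
  if k == 0 then rho (g ord0) else cdga_id A.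

Lemma face_ptP j k f : lpow_gen f ->
  fun_alg (@lpow_gen K G j.+1) (fun g => f (@face_pt j k g)).
Proof.
case=> i [h Gh ->]; rewrite /face_pt.
case: (i.+1 < k)%N; first exact: (lpow_gen_coord (widen_ord (leqnSn j) i) Gh).
case: (i.+1 == k); last exact: (lpow_gen_coord (lift ord0 i) Gh).
exact: lpow_gen_mul.
Qed.

Lemma face_actP j k (F : lpow G j -> A) : regval (@lpow_gen K G j) F ->
  regval (@lpow_gen K G j.+1) (fun g => face_act k g (F (face_pt k g))).
Proof.
move=> SF; rewrite /face_act; case: eqP => [k0|_]; last first.
  exact: (regval_comp (@face_ptP j k) SF).
elim: SF => [|f a Sf|F1 F2 _ H1 _ H2].
- have -> : (fun g : lpow G j.+1 => rho (g ord0) 0) = (fun=> 0).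
    by apply/funext => g; rewrite rmorph0.
  exact: rv_zero.
- have -> : (fun g => rho (g ord0) (scal A (f (face_pt k g)) * a)) =
      (fun g => scal A (f (@face_pt j k g)) * rho (g ord0) a).
    by apply/funext => g; rewrite rmorphM gca_map_scal.
  apply: regvalM.
    rewrite -[X in regval _ X]/(fun g => (fun g' => scal A (f g')) (face_pt k g)).
    apply: (regval_comp (@face_ptP j k)).
    have -> : (fun g' => scal A (f g')) = (fun g' => scal A (f g') * 1).
      by apply/funext => g'; rewrite mulr1.
    exact: rv_tensor.
  apply: (regval_comp (F := fun g => rho g a) _ (act_rational rho a)) => h Gh.
  exact: lpow_gen_coord.
have -> : (fun g : lpow G j.+1 =>
    rho (g ord0) (F1 (face_pt k g) + F2 (face_pt k g))) =
  (fun g => rho (g ord0) (F1 (face_pt k g)) + rho (g ord0) (F2 (face_pt k g))).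
  by apply/funext => g; rewrite rmorphD.
exact: rv_add.
Qed.

Definition face (j k : nat) : cdga_hom (lvl j) (lvl j.+1) :=
  tens_map (@face_actP j k).

Definition Delta (j : nat) (w : dR (lvl j)) : dR (lvl j.+1) :=
  \sum_(k < j.+2) (-1) ^+ k * dmap (face j k) w.

End Simplicial.

Section DRVect.
Variables (K : fieldType) (A : cdga K).
Definition dR_scale (k : K) (w : dR A) : dR A := din (scal A k) * w.
Fact dR_scalerA a b w : dR_scale a (dR_scale b w) = dR_scale (a * b) w.
Proof. by rewrite /dR_scale rmorphM dinM mulrA. Qed.
Fact dR_scale1r : left_id 1 dR_scale.
Proof. by move=> w; rewrite /dR_scale rmorph1 din1 mul1r. Qed.
Fact dR_scalerDr : right_distributive dR_scale +%R.
Proof. by move=> a w z; rewrite /dR_scale mulrDr. Qed.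
Fact dR_scalerDl w : {morph dR_scale^~ w : a b / a + b}.
Proof. by move=> a b; rewrite /dR_scale rmorphD dinD mulrDl. Qed.
HB.instance Definition _ := GRing.Zmodule_isLmodule.Build K (dR A)
  dR_scalerA dR_scale1r dR_scalerDr dR_scalerDl.
End DRVect.

Section Series.
Variables (K : fieldType) (V : nat -> lmodType K).

(* w j i is the coefficient of sigma^j tau^i *)
Definition series : Type := forall j : nat, nat -> V j.
HB.instance Definition _ := gen_eqMixin series.
HB.instance Definition _ := gen_choiceMixin series.

Lemma series_eq (w z : series) : (forall j i, w j i = z j i) -> w = z.
Proof.
move=> wz; apply: functional_extensionality_dep => j.
by apply: functional_extensionality_dep => i.
Qed.

Definition ser_zero : series := fun j i => 0.
Definition ser_opp (w : series) : series := fun j i => - w j i.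
Definition ser_add (w z : series) : series := fun j i => w j i + z j i.
Definition ser_scale (k : K) (w : series) : series := fun j i => k *: w j i.

Fact ser_addrA : associative ser_add.
Proof. by move=> x y z; apply: series_eq => j i; apply: addrA. Qed.
Fact ser_addrC : commutative ser_add.
Proof. by move=> x y; apply: series_eq => j i; apply: addrC. Qed.
Fact ser_add0r : left_id ser_zero ser_add.
Proof. by move=> x; apply: series_eq => j i; apply: add0r. Qed.
Fact ser_addNr : left_inverse ser_zero ser_opp ser_add.
Proof. by move=> x; apply: series_eq => j i; apply: addNr. Qed.
HB.instance Definition _ := GRing.isZmodule.Build series
  ser_addrA ser_addrC ser_add0r ser_addNr.

Fact ser_scalerA a b w : ser_scale a (ser_scale b w) = ser_scale (a * b) w.
Proof. by apply: series_eq => j i; apply: scalerA. Qed.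
Fact ser_scale1r : left_id 1 ser_scale.
Proof. by move=> w; apply: series_eq => j i; apply: scale1r. Qed.
Fact ser_scalerDr : right_distributive ser_scale +%R.
Proof. by move=> a w z; apply: series_eq => j i; apply: scalerDr. Qed.
Fact ser_scalerDl w : {morph ser_scale^~ w : a b / a + b}.
Proof. by move=> a b; apply: series_eq => j i; apply: scalerDl. Qed.
HB.instance Definition _ := GRing.Zmodule_isLmodule.Build K series
  ser_scalerA ser_scale1r ser_scalerDr ser_scalerDl.
End Series.

Inductive ideal_gen (A : pzRingType) (S : A -> Prop) : A -> Prop :=
  | ig_gen x : S x -> ideal_gen S x
  | ig_zero : ideal_gen S 0
  | ig_add x y : ideal_gen S x -> ideal_gen S y -> ideal_gen S (x + y)
  | ig_mull a x : ideal_gen S x -> ideal_gen S (a * x)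
  | ig_mulr a x : ideal_gen S x -> ideal_gen S (x * a).

Section ClosedForms.
Variables (K : fieldType) (G : linalg_group K) (A : cdga K) (rho : action G A).

(* forms of weight p and cohomological degree c *)
Definition form (B : cdga K) (p : nat) (c : int) (w : dR B) : Prop :=
  match c with
  | Posz 0 => dhomog p 0 w
  | Posz _.+1 => w = 0
  | Negz n => dhomog p n.+1 w
  end.

Definition fseries := series (fun j => dR (lvl G A j) : lmodType K).

Definition prev (V : nat -> zmodType) (T : forall j, V j -> V j.+1)
    (w : forall j, V j) (j : nat) : V j :=
  match j with 0 => 0 | j'.+1 => T j' (w j') end.

(* delta + tau d + sigma Delta, with sign (-1)^j on the first two terms *)
Definition Dtot (w : fseries) : fseries := fun j i =>
  (-1) ^+ j * (ddif (w j i) + (if i is i'.+1 then ddR (w j i') else 0))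
  + prev (Delta rho) (fun j' => w j' i) j.

(* Degree - k of the complex of homotopically closed 2-forms of degree d; the
   mixed degree of omega^j_(2+i) is - k + d - 2 - 2 i - 2 j, and adding j gives
   its cohomological degree. *)
Definition closed2 (d : int) (k : nat) (w : fseries) : Prop :=
  (forall j i, form (2 + i)
    ((- k%:Z + d - 2 - 2 * i%:Z - 2 * j%:Z) + j%:Z) (w j i)) /\
  (k = 0 -> Dtot w = 0).

Definition invariant_form (eta : dR A) : Prop :=
  forall g, dmap (rho g) eta = eta.

Fact proj_pullbackP j (F : lpow G j -> ground K) :
  regval (@lpow_gen K G j) F ->
  regval (@lpow_gen K G j) (fun g => ground_map A (F g)).
Proof. by apply: regval_lin => [x y|k x]; rewrite ?rmorphD ?rmorphM. Qed.

(* pullback along the projection Spec A x G^j -> G^j *)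
Definition proj_pullback (j : nat) :
    cdga_hom (tens (@lpow_gen K G j) (ground K)) (lvl G A j) :=
  tens_map (phi := id) (alpha := fun=> ground_map A) (@proj_pullbackP j).

Definition Gideal (j : nat) : dR (lvl G A j) -> Prop :=
  ideal_gen (fun w => exists2 eta : dR (tens (@lpow_gen K G j) (ground K)),
    (exists p n, (0 < p)%N /\ dhomog p n eta) &
    w = dmap (proj_pullback j) eta).

Definition strict2 (d : int) (k : nat) (w : fseries) : Prop :=
  [/\ closed2 d k w,
      forall i, exists2 eta : dR A, invariant_form eta &
        w 0 i = dmap (tens_const (@lpow_gen K G 0) A) eta &
      forall j i, (0 < j)%N -> Gideal (w j i)].

End ClosedForms.

Section Complexes.
Variables (K : fieldType) (E : lmodType K) (D : E -> E).

(* C k is the term of cohomological degree - k of a cochain complex of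
   subspaces of E with differential D *)
Definition is_complex (C : nat -> E -> Prop) : Prop :=
  [/\ forall k, C k 0 /\ forall a x y, C k x -> C k y -> C k (a *: x + y),
      forall k a x y, C k.+1 x -> C k.+1 y -> D (a *: x + y) = a *: D x + D y,
      forall k x, C k.+1 x -> C k (D x) &
      forall k x, C k.+2 x -> D (D x) = 0].

Definition cocycle (C : nat -> E -> Prop) (k : nat) (x : E) : Prop :=
  C k x /\ ((0 < k)%N -> D x = 0).
Definition coboundary (C : nat -> E -> Prop) (k : nat) (x : E) : Prop :=
  exists2 y, C k.+1 y & D y = x.

(* C' is a subcomplex of C and the inclusion induces isomorphisms in
   cohomology *)
Definition inclusion_is_weak_equivalence (C' C : nat -> E -> Prop) : Prop :=
  [/\ is_complex C', is_complex C, forall k x, C' k x -> C k x &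
      forall k,
        (forall x, cocycle C' k x -> coboundary C k x -> coboundary C' k x) /\
        (forall x, cocycle C k x ->
          exists2 x', cocycle C' k x' & coboundary C k (x - x'))].
End Complexes.

Section DegreeZero.
Variables (K : fieldType) (A : gca K).

Definition deg0_pred : pred A := [pred x | part 0 x == x].

Record deg0 := Deg0 { deg0_val :> A; _ : deg0_pred deg0_val }.
HB.instance Definition _ := [isSub for deg0_val].
HB.instance Definition _ := [Choice of deg0 by <:].

Fact deg0_subring : subring_closed deg0_pred.
Proof.
split=> [|x y /eqP x0 /eqP y0|x y /eqP x0 /eqP y0]; apply/eqP.
- exact: homog1.
- by rewrite part_add partN x0 y0.
- exact: (homogM x0 y0).
Qed.
HB.instance Definition _ :=
  GRing.SubChoice_isSubPzRing.Build A deg0_pred deg0 deg0_subring.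

Lemma deg0P (x : deg0) : homog 0 (x : A).
Proof. by case: x => x /= /eqP. Qed.

Fact deg0_mulC : commutative (@GRing.mul deg0).
Proof.
move=> x y; apply: val_inj; rewrite /= (homog_comm (deg0P x) (deg0P y)).
by rewrite expr0 mul1r.
Qed.
HB.instance Definition _ := GRing.PzRing_hasCommutativeMul.Build deg0 deg0_mulC.

Definition deg0_scal (k : K) : deg0 := Deg0 (introT eqP (homog_scal A k)).

End DegreeZero.

Section Manifold.
Variables (K : fieldType) (A : gca K).
Local Notation A0 := (deg0 A).

Inductive subalg_gen (S : A0 -> Prop) : A0 -> Prop :=
  | sg_gen x : S x -> subalg_gen S x
  | sg_scal k : subalg_gen S (deg0_scal A k)
  | sg_add x y : subalg_gen S x -> subalg_gen S y -> subalg_gen S (x + y)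
  | sg_mul x y : subalg_gen S x -> subalg_gen S y -> subalg_gen S (x * y).

Definition deg0_finitely_generated : Prop :=
  exists s : seq A0, forall x, subalg_gen (fun y => y \in s) x.

(* the infinitesimal lifting property; together with finite generation over
   the field K this is the definition of smoothness *)
Definition deg0_formally_smooth : Prop :=
  forall (B B' : comAlgType K) (p : {lrmorphism B -> B'}),
    (forall y, exists x, p x = y) ->
    (forall x y, p x = 0 -> p y = 0 -> x * y = 0) ->
  forall f : {rmorphism A0 -> B'}, (forall k, f (deg0_scal A k) = k%:A) ->
  exists g : {rmorphism A0 -> B},
    (forall k, g (deg0_scal A k) = k%:A) /\ (forall x, p (g x) = f x).

Definition finitely_generated_module (S : pzRingType) (P : lmodType S) : Prop :=
  exists s : seq P, forall x, exists a : nat -> S,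
    x = \sum_(i < size s) a i *: s`_i.

Definition projective_module (S : pzRingType) (P : lmodType S) : Prop :=
  forall (M N : lmodType S) (p : {linear M -> N}), (forall y, exists x, p x = y) ->
  forall f : {linear P -> N}, exists g : {linear P -> M}, forall x, p (g x) = f x.

(* A is the free graded-commutative A^0-algebra on finitely generated
   projective modules P_0, .., P_(n-1), with P_i in cohomological degree
   - (i + 1). *)
Definition freely_generated : Prop :=
  exists (n : nat) (P : 'I_n -> lmodType A0) (iota : forall i, P i -> A),
  [/\ forall i, finitely_generated_module (P i) /\ projective_module (P i),
      forall i a x y, iota i (a *: x + y) = (a : A) * iota i x + iota i y,
      forall (i : 'I_n) (x : P i), homog i.+1 (iota i x) &
      forall (B : gca K) (f0 : {rmorphism A0 -> B}) (f : forall i, P i -> B),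
        (forall k, f0 (deg0_scal A k) = scal B k) ->
        (forall a, homog 0 (f0 a)) ->
        (forall i a x y, f i (a *: x + y) = f0 a * f i x + f i y) ->
        (forall (i : 'I_n) (x : P i), homog i.+1 (f i x)) ->
      let extends (F : gca_hom A B) :=
        (forall a, F (deg0_val a) = f0 a) /\ (forall i x, F (iota i x) = f i x) in
      (exists F, extends F) /\
      (forall F F', extends F -> extends F' -> F =1 F')].

Definition affine_dg_manifold : Prop :=
  [/\ deg0_finitely_generated, deg0_formally_smooth & freely_generated].

End Manifold.

(* Main.v *)
(* A linearly reductive group has an invariant average on its regular functions:
   the projection of a finite-dimensional translation invariant space of
   functions onto the constants is a finite combination of evaluations, and any
   left and any right invariant combination agree by exchanging the two sums.
   Averaging the pullbacks along the sections
   (x, g_0, .., g_(j-1)) |-> (x, g_0, .., g_(j-1), t) over t gives an operator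
   from forms on Spec A x G^(j+1) to forms on Spec A x G^j, which commutes with
   delta and d. With the sign (-1)^(j+1) it is a homotopy H of degree - 1.
   Modulo the ideal of forms of positive weight along G^j, a form on Spec A x G^j
   is a combination of functions on G^j with values in forms on Spec A, hence by
   invariance of the average w - D H w - H D w is strict for all w; moreover H
   preserves strict series. If D y is strict, y - D H y is a strict series with
   the same differential, and a cocycle x is cohomologous to x - D H x. *)
From HB Require Import structures.
Require Import Defs.
From mathcomp Require Import all_boot all_order all_algebra.
From mathcomp Require Import boolp classical_sets functions.
From mathcomp Require Import reals complex zify.

Set Implicit Arguments.
Unset Strict Implicit.
Unset Printing Implicit Defensive.

Import GRing.Theory.
Local Open Scope ring_scope.

(** * Calculus of differential forms *)

(** Every function of [t] that gets averaged is a finite sum of regular functions times fixed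
    vectors, so finitely many weighted points compute its average. A weighted sum of values makes
    sense in any vector space and commutes with linear maps; presentations as tensors, which are not
    unique, never have to be compared. The price is that the points depend on the function.

    The ideal is needed because [t] enters as a constant and its differentials are lost. Averaging a
    form in [g_j t] over [t] can leave an invariant form in the direction of [g_j], such as [dg/g]
    on the multiplicative group, whereas averaging over the last coordinate and then pulling back
    along the projection that forgets [g_j] cannot.

    Invariance is a condition at each point of [G], membership in the ideal an algebraic one.
    Interpolation connects them: a finite-dimensional space of functions has a basis dual to
    evaluations at points. The same basis turns the projection onto the constants into weighted
    points. *)

Section DRTheory.
Variables (K : fieldType) (A : cdga K).
Implicit Types (a b : A) (x y : kaehler A) (w z : dR A).

Lemma kparity_kdif x : kparity (kdif x) = - kdif (kparity x).
Proof.
elim/kaehler_ind: x => [a||x y Hx Hy|a x Hx].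
- by rewrite kparity_kd !kdif_kd kparity_kd dif_parity kdN opprK.
- by rewrite !(morph_add0 (@kparityD _ A), morph_add0 (@kdifD _ A)) oppr0.
- by rewrite !(kparityD, kdifD) Hx Hy opprD.
- rewrite kdifZ kparityD !kparityZ Hx kdifZ dif_parity parityK.
  by rewrite scaleNr scalerN opprD opprK.
Qed.

Lemma kdif_kdif x : kdif (kdif x) = 0.
Proof.
elim/kaehler_ind: x => [a||x y Hx Hy|a x Hx].
- by rewrite !kdif_kd dif_dif kd0.
- by rewrite !(morph_add0 (@kdifD _ A)).
- by rewrite !kdifD Hx Hy addr0.
- rewrite kdifZ kdifD !kdifZ Hx scaler0 dif_dif scale0r dif_parity scaleNr.
  by rewrite add0r addr0 addrN.
Qed.

Lemma kappa_kparity x : dparity (kappa x) = kappa (kparity x).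
Proof.
elim/kaehler_ind: x => [a||x y Hx Hy|a x Hx].
- by rewrite kparity_kd !kappa_kd (morph_add0 (@dparityD _ A)).
- by rewrite !(morph_add0 (@kparityD _ A), morph_add0 (@kappaD _ A),
               morph_add0 (@dparityD _ A)).
- by rewrite !(kparityD, kappaD, dparityD) Hx Hy.
- rewrite kparityZ !kappaZ dparityD !dparityM !dparity_dsu dparity_din Hx.
  by rewrite kparity_kd mulrNN.
Qed.

Lemma kappa_kdif x : kappa (kdif x) = ddif (kappa x).
Proof.
elim/kaehler_ind: x => [a||x y Hx Hy|a x Hx].
- by rewrite kdif_kd !kappa_kd (morph_add0 (@ddifD _ A)).
- by rewrite !(morph_add0 (@kdifD _ A), morph_add0 (@kappaD _ A),
               morph_add0 (@ddifD _ A)).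
- by rewrite !(kdifD, kappaD, ddifD) Hx Hy.
- rewrite kdifZ kappaD !kappaZ ddifD !ddifM ddif_din !ddif_dsu dparity_dsu.
  rewrite dparity_din Hx kdif_kd dif_parity kparity_kd parityK kdN dsuN opprK.
  by rewrite mulrNN addrACA.
Qed.

Lemma dparity_ddif w : dparity (ddif w) = - ddif (dparity w).
Proof.
have dpN := morph_addN (@dparityD _ A); have ddN := morph_addN (@ddifD _ A).
elim/dR_ind: w => [a|x|w z Hw Hz|w z Hw Hz].
- by rewrite dparity_din !ddif_din dparity_din dif_parity dinN opprK.
- rewrite ddif_dsu dpN !dparity_dsu ddN ddif_dsu kparity_kdif dsuN.
  by rewrite !opprK.
- by rewrite !(dparityD, ddifD) Hw Hz opprD.
- by rewrite ddifM dparityD !dparityM Hw Hz ddifM !(mulNr, mulrN) -opprD.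
Qed.

Lemma dparity_ddR w : dparity (ddR w) = - ddR (dparity w).
Proof.
have dpN := morph_addN (@dparityD _ A); have ddN := morph_addN (@ddR_add _ A).
elim/dR_ind: w => [a|x|w z Hw Hz|w z Hw Hz].
- by rewrite dparity_din !ddR_din dparity_dsu kparity_kd.
- by rewrite dparity_dsu ddN !ddR_dsu kappa_kparity opprK.
- by rewrite !(dparityD, ddR_add) Hw Hz opprD.
- by rewrite ddR_mul dparityD !dparityM Hw Hz ddR_mul !(mulNr, mulrN) -opprD.
Qed.

Lemma ddif_ddif w : ddif (ddif w) = 0.
Proof.
have ddN := morph_addN (@ddifD _ A).
elim/dR_ind: w => [a|x|w z Hw Hz|w z Hw Hz].
- by rewrite !ddif_din dif_dif din0.
- by rewrite ddif_dsu ddN ddif_dsu kdif_kdif dsu0 !oppr0.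
- by rewrite !ddifD Hw Hz addr0.
- rewrite ddifM ddifD !ddifM Hw Hz mulr0 mul0r dparity_ddif mulNr.
  by rewrite add0r addr0 addNr.
Qed.

Lemma ddR_ddR w : ddR (ddR w) = 0.
Proof.
elim/dR_ind: w => [a|x|w z Hw Hz|w z Hw Hz].
- by rewrite ddR_din ddR_dsu kappa_kd.
- rewrite ddR_dsu; elim/kaehler_ind: x => [a||x y Hx Hy|a x Hx].
  + by rewrite kappa_kd (morph_add0 (@ddR_add _ A)).
  + by rewrite (morph_add0 (@kappaD _ A)) (morph_add0 (@ddR_add _ A)).
  + by rewrite kappaD ddR_add Hx Hy addr0.
  rewrite kappaZ ddR_add !ddR_mul Hx ddR_dsu_kd ddR_din ddR_dsu dparity_dsu.
  by rewrite kparity_kd parityK mul0r mulr0 add0r addr0 mulNr addNr.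
- by rewrite !ddR_add Hw Hz addr0.
- rewrite ddR_mul ddR_add !ddR_mul Hw Hz mulr0 mul0r dparity_ddR mulNr.
  by rewrite add0r addr0 addNr.
Qed.

Lemma ddif_ddR w : ddif (ddR w) = - ddR (ddif w).
Proof.
have ddN := morph_addN (@ddR_add _ A).
elim/dR_ind: w => [a|x|w z Hw Hz|w z Hw Hz].
- by rewrite ddR_din ddif_dsu ddif_din ddR_din kdif_kd.
- by rewrite ddR_dsu ddif_dsu ddN ddR_dsu kappa_kdif opprK.
- by rewrite !(ddR_add, ddifD) Hw Hz opprD.
- rewrite ddR_mul ddifD !ddifM ddR_add !ddR_mul Hw Hz dparity_ddR dparity_ddif.
  rewrite !(mulNr, mulrN, opprD, opprK) -!addrA; congr (_ + _).
  by rewrite addrCA.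
Qed.

Lemma dparity_dhomog p n w : dhomog p n w -> dparity w = (-1) ^+ n * w.
Proof.
elim=> {p n w} [n a an|n x xn|p n|p n w z _ Hw _ Hz|p q m n w z _ Hw _ Hz].
- by rewrite dparity_din (parity_homog an) (morph_sign (@dinD _ A)).
- exact: dparity_dsu_homog.
- by rewrite (morph_add0 (@dparityD _ A)) mulr0.
- by rewrite dparityD Hw Hz mulrDr.
rewrite dparityM Hw Hz !signr_if oddD; case: odd; case: odd => //=;
  by rewrite ?(mulNr, mulrN, opprK).
Qed.

Lemma dhomog_sign m p n w : dhomog p n w -> dhomog p n ((-1) ^+ m * w).
Proof. by rewrite signr_if; case: odd => //; apply: dhomogN. Qed.

Lemma ddif_dhomog p n w : dhomog p n w -> dhomog p n.-1 (ddif w) /\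
  (n = 0 -> ddif w = 0).
Proof.
elim=> {p n w} [n a an|n x xn|p n|p n w z _ [Hw Hw0] _ [Hz Hz0]|
    p q m n w z wm [Hw Hw0] zn [Hz Hz0]].
- rewrite ddif_din; split; first exact/dh_in/dif_homogP.
  by move=> n0; move: an; rewrite n0 => /dif_homog0->; rewrite din0.
- rewrite ddif_dsu; split=> //; case: n xn => [|n] xn.
    by rewrite (kdif_khomog0 xn) dsu0 oppr0; apply: dh_zero.
  exact/dhomogN/dh_su/(kdif_khomog xn).
- by rewrite (morph_add0 (@ddifD _ A)); split=> //; apply: dh_zero.
- rewrite ddifD; split=> [|n0]; first exact: dh_add.
  by rewrite Hw0 // Hz0 // addr0.
rewrite ddifM; split=> [|/eqP]; last first.
  rewrite addn_eq0 => /andP[/eqP m0 /eqP n0].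
  by rewrite Hw0 // Hz0 // mul0r mulr0 addr0.
apply: dh_add.
  case: m wm Hw Hw0 => [|m] wm Hw Hw0; last exact: dh_mul Hw zn.
  by rewrite Hw0 // mul0r; apply: dh_zero.
case: n zn Hz Hz0 => [|n] zn Hz Hz0; last 
  by rewrite addnS (dparity_dhomog wm); apply: dh_mul Hz; apply: dhomog_sign.
by rewrite Hz0 // mulr0; apply: dh_zero.
Qed.

Lemma ddR_dhomog p n w : dhomog p n w -> dhomog p.+1 n.+1 (ddR w).
Proof.
elim=> {p n w} [n a an|n x xn|p n|p n w z _ Hw _ Hz|p q m n w z wm Hw zn Hz].
- by rewrite ddR_din; apply/dh_su/kh_gen.
- by rewrite ddR_dsu; apply: kappa_dhomog.
- by rewrite (morph_add0 (@ddR_add _ A)); apply: dh_zero.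
- by rewrite ddR_add; apply: dh_add.
rewrite ddR_mul; apply: dh_add; first exact: dh_mul Hw zn.
rewrite -!addnS (dparity_dhomog wm); apply: dh_mul Hz; exact: dhomog_sign.
Qed.

Lemma dR_scaleE (k : K) w : k *: w = din (scal A k) * w.
Proof. by []. Qed.

Lemma dinZ k a : din (scal A k * a) = k *: din a.
Proof. exact: dinM. Qed.

(** For scalars this makes products of forms bilinear over [K]; functions on [G^j] can by it be
    moved past forms on Spec A. *)
Lemma din_central a w : homog 0 a -> din a * w = w * din a.
Proof.
move=> a0; elim/dR_ind: w => [b|x|w z Hw Hz|w z Hw Hz].
- rewrite -!dinM; congr (din _); elim/homog_ind: b => [|b c Hb Hc|n b bn].
  + by rewrite mulr0 mul0r.
  + by rewrite mulrDr mulrDl Hb Hc.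
  + by rewrite (homog_comm a0 bn) expr0 mul1r.
- elim/kaehler_ind: x => [b||x y Hx Hy|b x Hx].
  + elim/homog_ind: b => [|b c Hb Hc|n b bn].
    * by rewrite kd0 dsu0 mulr0 mul0r.
    * by rewrite kdD dsuD mulrDr mulrDl Hb Hc.
    * by rewrite (dsu_din (kh_gen bn) a0) muln0 mul1r.
  + by rewrite dsu0 mulr0 mul0r.
  + by rewrite dsuD mulrDr mulrDl Hx Hy.
  rewrite dsuZ -mulrA -Hx !mulrA -!dinM; congr (din _ * _).
  elim/homog_ind: (parity b) => [|c c' Hb Hc|n c cn].
  + by rewrite mulr0 mul0r.
  + by rewrite mulrDr mulrDl Hb Hc.
  + by rewrite (homog_comm a0 cn) expr0 mul1r.
- by rewrite mulrDr mulrDl Hw Hz.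
- by rewrite mulrA Hw -mulrA Hz mulrA.
Qed.

Lemma scalerAr_dR k w z : w * (k *: z) = k *: (w * z).
Proof.
by rewrite !dR_scaleE mulrA -(din_central _ (homog_scal A k)) mulrA.
Qed.

Lemma scalerAl_dR k w z : (k *: w) * z = k *: (w * z).
Proof. by rewrite !dR_scaleE mulrA. Qed.

Lemma dhomogZ p n k w : dhomog p n w -> dhomog p n (k *: w).
Proof.
by rewrite -[p]add0n -[n]add0n; apply/dh_mul/dh_in/homog_scal.
Qed.

Lemma ddifZ k w : ddif (k *: w) = k *: ddif w.
Proof.
rewrite !dR_scaleE ddifM ddif_din dif_scal din0 mul0r add0r dparity_din.
by rewrite parity_scal.
Qed.

Lemma ddRZ k w : ddR (k *: w) = k *: ddR w.
Proof.
rewrite !dR_scaleE ddR_mul ddR_din kd_scal dsu0 mul0r add0r dparity_din.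
by rewrite parity_scal.
Qed.

End DRTheory.

(** * Naturality of the differentials under pullback *)

Section DmapTheory.
Variables (K : fieldType) (A B : cdga K).
Implicit Types f g : cdga_hom A B.

Lemma dmapZ f k w : dmap f (k *: w) = k *: dmap f w.
Proof. by rewrite !dR_scaleE dmapM dmap_din gca_map_scal. Qed.

Lemma dmap0 f : dmap f 0 = 0.
Proof. exact: morph_add0 (@dmapD _ _ _ f). Qed.

Lemma kmap_kparity f x : kmap f (kparity x) = kparity (kmap f x).
Proof.
elim/kaehler_ind: x => [a||x y Hx Hy|a x Hx].
- by rewrite kparity_kd !kmap_kd kparity_kd parity_map.
- by rewrite !(morph_add0 (@kparityD _ _), morph_add0 (@kmapD _ _ _ f)).
- by rewrite !(kparityD, kmapD) Hx Hy.
- by rewrite !(kparityZ, kmapZ) Hx parity_map.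
Qed.

Lemma kmap_kdif f x : kmap f (kdif x) = kdif (kmap f x).
Proof.
elim/kaehler_ind: x => [a||x y Hx Hy|a x Hx].
- by rewrite kdif_kd !kmap_kd kdif_kd cdga_map_dif.
- by rewrite !(morph_add0 (@kdifD _ _), morph_add0 (@kmapD _ _ _ f)).
- by rewrite !(kdifD, kmapD) Hx Hy.
- by rewrite !(kdifZ, kmapD, kmapZ) Hx parity_map cdga_map_dif.
Qed.

Lemma dmap_kappa f x : dmap f (kappa x) = kappa (kmap f x).
Proof.
elim/kaehler_ind: x => [a||x y Hx Hy|a x Hx].
- by rewrite kmap_kd !kappa_kd dmap0.
- by rewrite !(morph_add0 (@kappaD _ _), morph_add0 (@kmapD _ _ _ f)) dmap0.
- by rewrite !(kappaD, dmapD, kmapD) Hx Hy.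
- rewrite kmapZ !kappaZ dmapD !dmapM !dmap_dsu dmap_din Hx kmap_kd.
  by rewrite parity_map.
Qed.

Lemma dmap_dparity f w : dmap f (dparity w) = dparity (dmap f w).
Proof.
elim/dR_ind: w => [a|x|w z Hw Hz|w z Hw Hz].
- by rewrite dparity_din !dmap_din dparity_din parity_map.
- rewrite dparity_dsu (morph_addN (@dmapD _ _ _ f)) !dmap_dsu dparity_dsu.
  by rewrite kmap_kparity.
- by rewrite !(dparityD, dmapD) Hw Hz.
- by rewrite !(dparityM, dmapM) Hw Hz.
Qed.

Lemma dmap_ddif f w : dmap f (ddif w) = ddif (dmap f w).
Proof.
elim/dR_ind: w => [a|x|w z Hw Hz|w z Hw Hz].
- by rewrite ddif_din !dmap_din ddif_din cdga_map_dif.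
- rewrite ddif_dsu (morph_addN (@dmapD _ _ _ f)) !dmap_dsu ddif_dsu.
  by rewrite kmap_kdif.
- by rewrite !(ddifD, dmapD) Hw Hz.
- by rewrite ddifM dmapD !dmapM Hw Hz ddifM dmap_dparity.
Qed.

Lemma dmap_ddR f w : dmap f (ddR w) = ddR (dmap f w).
Proof.
elim/dR_ind: w => [a|x|w z Hw Hz|w z Hw Hz].
- by rewrite ddR_din dmap_dsu dmap_din ddR_din kmap_kd.
- by rewrite dmap_dsu !ddR_dsu dmap_kappa.
- by rewrite !(ddR_add, dmapD) Hw Hz.
- by rewrite ddR_mul dmapD !dmapM Hw Hz ddR_mul dmap_dparity.
Qed.

Lemma dmap_id (f : cdga_hom A A) w : (forall a, f a = a) -> dmap f w = w.
Proof.
move=> fE; elim/dR_ind: w => [a|x|w z Hw Hz|w z Hw Hz].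
- by rewrite dmap_din fE.
- rewrite dmap_dsu; congr dsu; elim/kaehler_ind: x => [a||x y Hx Hy|a x Hx].
  + by rewrite kmap_kd fE.
  + exact: morph_add0 (@kmapD _ _ _ f).
  + by rewrite kmapD Hx Hy.
  + by rewrite kmapZ Hx fE.
- by rewrite dmapD Hw Hz.
- by rewrite dmapM Hw Hz.
Qed.

End DmapTheory.

(** Stated for squares, so that naturality applies without packaging composites as morphisms; the
    two paths need only be compared on elements of [A]. *)
Lemma dmap_square (K : fieldType) (A B B' C : cdga K) (f : cdga_hom B C)
    (g : cdga_hom A B) (f' : cdga_hom B' C) (g' : cdga_hom A B') w :
  (forall a, f (g a) = f' (g' a)) -> dmap f (dmap g w) = dmap f' (dmap g' w).
Proof.
move=> fg; elim/dR_ind: w => [a|x|w z Hw Hz|w z Hw Hz].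
- by rewrite !dmap_din fg.
- rewrite !dmap_dsu; congr dsu; elim/kaehler_ind: x => [a||x y Hx Hy|a x Hx].
  + by rewrite !kmap_kd fg.
  + by rewrite !(morph_add0 (@kmapD _ _ _ _)).
  + by rewrite !kmapD Hx Hy.
  + by rewrite !kmapZ Hx fg.
- by rewrite !dmapD Hw Hz.
- by rewrite !dmapM Hw Hz.
Qed.

Lemma dmap_comp (K : fieldType) (A B C : cdga K) (f : cdga_hom B C)
    (g : cdga_hom A B) (h : cdga_hom A C) w :
  (forall a, f (g a) = h a) -> dmap f (dmap g w) = dmap h w.
Proof.
move=> fg; rewrite -[RHS](@dmap_id _ _ (cdga_id C)) //.
exact: dmap_square.
Qed.


(** * Regular functions and invariant averages *)

Section EvaluationBasis.
Variables (K : fieldType) (T : Type).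
Implicit Types (f g : T -> K) (q : seq (T -> K)).

Definition in_span q f : Prop :=
  exists c : nat -> K, forall x, f x = \sum_(i < size q) c i * nth (fun=> 0) q i x.

Lemma in_span_catl q q' f : in_span q f -> in_span (q ++ q') f.
Proof.
case=> c fE; exists (fun i => if (i < size q)%N then c i else 0) => x.
rewrite size_cat big_split_ord /= [X in _ + X]big1 ?addr0 => [|i _].
  by rewrite fE; apply: eq_bigr => i _; rewrite nth_cat ltn_ord.
by rewrite ltnNge leq_addr mul0r.
Qed.

Lemma in_span_catr q q' f : in_span q' f -> in_span (q ++ q') f.
Proof.
case=> c fE; exists (fun i => if (i < size q)%N then 0 else c (i - size q)%N).
move=> x; rewrite size_cat big_split_ord /= big1 ?add0r => [|i _].
  rewrite fE; apply: eq_bigr => i _.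
  by rewrite nth_cat ltnNge leq_addr addKn.
by rewrite ltn_ord mul0r.
Qed.

Lemma in_span_lin q a f g :
  in_span q f -> in_span q g -> in_span q (fun x => a * f x + g x).
Proof.
move=> [c fE] [d gE]; exists (fun i => a * c i + d i) => x.
rewrite fE gE mulr_sumr -big_split /=; apply: eq_bigr => i _.
by rewrite mulrDl mulrA.
Qed.

Lemma in_span1 f : in_span [:: f] f.
Proof. by exists (fun=> 1) => x; rewrite big_ord1 mul1r. Qed.

(* A dual system of maximal size is a basis: its size is bounded by the rank of
   a factorization of the identity matrix, and a function in V vanishing at all
   the points t s could otherwise be used to enlarge it. *)
Lemma eval_basis (V : (T -> K) -> Prop) q :
    (forall a f g, V f -> V g -> V (fun x => a * f x + g x)) ->
    (forall f, V f -> in_span q f) ->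
  exists r (t : 'I_r -> T) (e : 'I_r -> T -> K),
    [/\ forall s, V (e s), forall s s', e s (t s') = (s == s')%:R &
        forall f, V f -> forall x, f x = \sum_s f (t s) * e s x].
Proof.
move=> VL Vq.
pose dual r (t : 'I_r -> T) (e : 'I_r -> T -> K) :=
  (forall s, V (e s)) /\ (forall s s', e s (t s') = (s == s')%:R).
pose P r := `[< exists t e, @dual r t e >].
have P0 : exists r, P r.
  exists 0%N; apply/asboolP.
  (* [T] may be empty, so no default point is at hand for the empty system. *)
  have [|nT] := pselect (exists t : 'I_0 -> T, True).
    by case=> t _; exists t, (fun=> fun=> 0); split; case.
  by case: nT; exists (fun i : 'I_0 => match notF (valP i) with end).
have Pb r : P r -> (r <= size q)%N.
  case/asboolP=> t [e [Ve et]].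
  have /choice[c cE] : forall s, exists c : nat -> K,
    forall x, e s x = \sum_(i < size q) c i * nth (fun=> 0) q i x.
    by move=> s; apply: Vq.
  have E : 1%:M = (\matrix_(s < r, i < size q) c s i) *m
      (\matrix_(i < size q, s < r) nth (fun=> 0) q i (t s)).
    apply/matrixP => s s'; rewrite !mxE -et cE.
    by apply: eq_bigr => i _; rewrite !mxE.
  by rewrite -(mxrank1 K r) E mulmx_max_rank.
case: (ex_maxnP P0 Pb) => r /asboolP[t [e [Ve et]]] rmax.
exists r, t, e; split=> // f Vf x; apply/eqP; rewrite -subr_eq0; apply/negPn.
apply/negP => nz.
pose f' x := f x - \sum_s f (t s) * e s x.
have Vlin n (a : 'I_n -> K) (h : 'I_n -> T -> K) g : (forall i, V (h i)) -> V g ->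
    V (fun x => g x + \sum_i a i * h i x).
  elim: n a h => [|n IHn] a h Vh Vg.
    by under eq_fun do rewrite big_ord0 addr0.
  under eq_fun do rewrite big_ord_recr /= addrA addrC.
  apply: VL => //.
  exact: (IHn (fun i => a (widen_ord (leqnSn n) i))
              (fun i => h (widen_ord (leqnSn n) i))).
have Vf' : V f'.
  have -> : f' = (fun x => f x + \sum_s (- f (t s)) * e s x).
    by apply/funext=> y; rewrite /f' -sumrN; under eq_bigr do rewrite -mulNr.
  exact: Vlin.
have f't s : f' (t s) = 0.
  rewrite /f' (bigD1 s) //= et eqxx mulr1 big1 ?addr0 ?subrr // => s' ss'.
  by rewrite et (negbTE ss') mulr0.
pose n y := (f' x)^-1 * f' y.
have nx : n x = 1 by rewrite /n mulVf.
have Vn : V n.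
  have -> : n = (fun y => ((f' x)^-1 - 1) * f' y + f' y).
    by apply/funext => y; rewrite /n mulrBl mul1r subrK.
  exact: VL.
have nt s : n (t s) = 0 by rewrite /n f't mulr0.
suff : P r.+1 by move/rmax; rewrite ltnn.
apply/asboolP.
(* The new pair [x], [n] gets index [ord0]. Subtracting [e s' x * n] makes each old function vanish
   at [x] and keeps its values at the old points, where [n] is zero. *)
exists (fun s => if unlift ord0 s is Some s' then t s' else x).
exists (fun s => if unlift ord0 s is Some s' then
                   fun y => - e s' x * n y + e s' y else n).
split=> [s|s s'].
  by case: unliftP => // s' _; apply: VL.
case: (unliftP ord0 s) => [u ->|->]; case: (unliftP ord0 s') => [v ->|->].
- by rewrite nt mulr0 add0r et (inj_eq lift_inj).
- by rewrite nx mulr1 addNr eq_sym (negbTE (neq_lift _ _)).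
- by rewrite nt (negbTE (neq_lift _ _)).
- by rewrite nx eqxx.
Qed.

End EvaluationBasis.

(** * Regular functions on products *)

Section FunAlg.
Variable K : fieldType.

Lemma fun_alg_comp (T T' : Type) (S : set (T -> K)) (S' : set (T' -> K))
    (phi : T' -> T) f :
    (forall h, S h -> fun_alg S' (fun t => h (phi t))) ->
  fun_alg S f -> fun_alg S' (fun t => f (phi t)).
Proof.
move=> Sphi; elim=> {f} [f /Sphi//|k|f g _ Hf _ Hg|f g _ Hf _ Hg].
- exact: fa_const.
- exact: (fa_add Hf Hg).
- exact: (fa_mul Hf Hg).
Qed.

Lemma fun_alg_lin (T : Type) (S : set (T -> K)) a f g :
  fun_alg S f -> fun_alg S g -> fun_alg S (fun t => a * f t + g t).
Proof. by move=> Sf Sg; apply: fa_add Sg; apply: fa_mul Sf; apply: fa_const. Qed.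

Lemma fun_alg_prod (T : Type) (S : set (T -> K)) (I : Type) (r : seq I)
    (F : I -> T -> K) : (forall i, fun_alg S (F i)) ->
  fun_alg S (fun t => \prod_(i <- r) F i t).
Proof.
move=> SF; elim: r => [|i r Hr].
  by under eq_fun do rewrite big_nil; apply: fa_const.
by under eq_fun do rewrite big_cons; apply: fa_mul.
Qed.

Lemma fun_alg_det (T : Type) (S : set (T -> K)) n (M : T -> 'M[K]_n) :
  (forall i k, fun_alg S (fun t => M t i k)) -> fun_alg S (fun t => \det (M t)).
Proof.
move=> SM; apply: fun_alg_sum => s; apply: fa_mul; first exact: fa_const.
exact: fun_alg_prod.
Qed.

(* functions on T1 * T2 in the image of O(T1) (x) O(T2) *)
Inductive fun_tens (T1 T2 : Type) (S1 : set (T1 -> K)) (S2 : set (T2 -> K)) :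
    (T1 -> T2 -> K) -> Prop :=
  | ft_prod f g : fun_alg S1 f -> fun_alg S2 g ->
      fun_tens S1 S2 (fun x y => f x * g y)
  | ft_add F G : fun_tens S1 S2 F -> fun_tens S1 S2 G ->
      fun_tens S1 S2 (fun x y => F x y + G x y).

Section FunTens.
Variables (T1 T2 : Type) (S1 : set (T1 -> K)) (S2 : set (T2 -> K)).
Local Notation ft := (fun_tens S1 S2).

Lemma ft_fst f : fun_alg S1 f -> ft (fun x _ => f x).
Proof.
move=> Sf.
have -> : (fun x _ => f x) = (fun x y => f x * (fun=> 1) y) :> (T1 -> T2 -> K).
  by apply/funext => x; apply/funext => y; rewrite mulr1.
by apply: ft_prod => //; apply: fa_const.
Qed.

Lemma ft_snd g : fun_alg S2 g -> ft (fun _ y => g y).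
Proof.
move=> Sg.
have -> : (fun _ y => g y) = (fun x y => (fun=> 1) x * g y) :> (T1 -> T2 -> K).
  by apply/funext => x; apply/funext => y; rewrite mul1r.
by apply: ft_prod => //; apply: fa_const.
Qed.

Lemma ft_mul F G : ft F -> ft G -> ft (fun x y => F x y * G x y).
Proof.
move=> SF; elim: SF G => {F} [f g Sf Sg|F1 F2 _ H1 _ H2] G SG; last first.
  have -> : (fun x y => (F1 x y + F2 x y) * G x y) =
            (fun x y => F1 x y * G x y + F2 x y * G x y).
    by apply/funext => x; apply/funext => y; rewrite mulrDl.
  by apply: ft_add; [apply: H1|apply: H2].
elim: SG => {G} [f' g' Sf' Sg'|G1 G2 _ H1 _ H2].
  have -> : (fun x y => f x * g y * (f' x * g' y)) =
            (fun x y => (f x * f' x) * (g y * g' y)).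
    by apply/funext => x; apply/funext => y; rewrite mulrACA.
  by apply: ft_prod; apply: fa_mul.
have -> : (fun x y => f x * g y * (G1 x y + G2 x y)) =
          (fun x y => f x * g y * G1 x y + f x * g y * G2 x y).
  by apply/funext => x; apply/funext => y; rewrite mulrDr.
exact: ft_add.
Qed.

Lemma ft_sum (I : Type) (r : seq I) (F : I -> T1 -> T2 -> K) :
  (forall i, ft (F i)) -> ft (fun x y => \sum_(i <- r) F i x y).
Proof.
move=> SF; elim: r => [|i r Hr].
  have -> : (fun x y => \sum_(i <- [::]) F i x y) = (fun _ _ => 0).
    by apply/funext => x; apply/funext => y; rewrite big_nil.
  exact/ft_fst/fa_const.
have -> : (fun x y => \sum_(i <- i :: r) F i x y) =
          (fun x y => F i x y + (fun x y => \sum_(i <- r) F i x y) x y).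
  by apply/funext => x; apply/funext => y; rewrite big_cons.
exact: ft_add.
Qed.

Lemma ft_comp (T : Type) (S : set (T -> K)) (psi : T1 -> T2 -> T) f :
    (forall h, S h -> ft (fun x y => h (psi x y))) ->
  fun_alg S f -> ft (fun x y => f (psi x y)).
Proof.
move=> Spsi; elim=> {f} [f /Spsi//|k|f g _ Hf _ Hg|f g _ Hf _ Hg].
- exact/ft_fst/fa_const.
- exact: (ft_add Hf Hg).
- exact: (ft_mul Hf Hg).
Qed.

Lemma ft_evalr F y : ft F -> fun_alg S1 (F^~ y).
Proof.
elim=> {F} [f g Sf _|F G _ HF _ HG]; last exact: (fa_add HF HG).
by apply: (fa_mul Sf); apply: fa_const.
Qed.

Lemma ft_evall F x : ft F -> fun_alg S2 (F x).
Proof.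
elim=> {F} [f g _ Sg|F G _ HF _ HG]; last exact: (fa_add HF HG).
by apply: fa_mul Sg; apply: fa_const.
Qed.

(** The second factors of one tensor expression of [F] serve for all [x]; applied to the
    multiplication of [G], this bounds the span of all translates. *)
Lemma ft_span F : ft F -> exists q, forall x, in_span q (F x).
Proof.
elim=> {F} [f g _ _|F G _ [q HF] _ [q' HG]].
  by exists [:: g] => x; exists (fun=> f x) => y; rewrite big_ord1.
exists (q ++ q') => x.
have -> : (fun y => F x y + G x y) = (fun y => 1 * F x y + G x y).
  by apply/funext => y; rewrite mul1r.
by apply: in_span_lin; [apply: in_span_catl|apply: in_span_catr].
Qed.

End FunTens.

Lemma ft_compl (T1 T1' T2 : Type) (S1 : set (T1 -> K)) (S1' : set (T1' -> K))
    (S2 : set (T2 -> K)) (phi : T1' -> T1) F :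
    (forall h, S1 h -> fun_alg S1' (fun t => h (phi t))) ->
  fun_tens S1 S2 F -> fun_tens S1' S2 (fun x y => F (phi x) y).
Proof.
move=> Sphi; elim=> {F} [f g Sf Sg|F F' _ HF _ HF']; last exact: ft_add HF HF'.
exact: ft_prod (fun_alg_comp Sphi Sf) Sg.
Qed.

End FunAlg.

(** * Multiplication and inversion on regular functions *)

Section GroupLaw.
Variables (K : fieldType) (G : linalg_group K).
Implicit Types g h t : lg_pt G.

Lemma lg_pt_eq g h : lg_mx g = lg_mx h -> g = h.
Proof.
case: g h => [M MP] [N NP] /= MN; rewrite -MN in NP *.
by congr LgPt; apply: Prop_irrelevance.
Qed.

Definition lg_inv g : lg_pt G := LgPt (lg_setV (lg_mxP g)).

Lemma lg_mulA g h t : lg_mul g (lg_mul h t) = lg_mul (lg_mul g h) t.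
Proof. by apply: lg_pt_eq; rewrite /= mulmxA. Qed.
Lemma lg_mul1g g : lg_mul (lg_one G) g = g.
Proof. by apply: lg_pt_eq; rewrite /= mul1mx. Qed.
Lemma lg_inv_mul g h : lg_inv (lg_mul g h) = lg_mul (lg_inv h) (lg_inv g).
Proof.
apply: lg_pt_eq => /=; have ug := lg_unit g; have uh := lg_unit h.
have ugh : lg_mx g *m lg_mx h \in unitmx by rewrite unitmx_mul ug.
rewrite -[RHS](mulKmx ugh) -(mulmxA (lg_mx g)) (mulKVmx uh).
by rewrite (mulmxV ug) mulmx1.
Qed.
Lemma lg_invK g : lg_inv (lg_inv g) = g.
Proof. by apply: lg_pt_eq => /=; apply: invmxK. Qed.

Lemma lg_gen_mul (f : lg_pt G -> K) : lg_gen f ->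
  fun_tens (@lg_gen K G) (@lg_gen K G) (fun g h => f (lg_mul g h)).
Proof.
case=> [[i [k ->]]|->].
  have -> : (fun g h => lg_mx (lg_mul g h) i k) =
    (fun g h => \sum_l lg_mx g i l * lg_mx h l k).
    by apply/funext => g; apply/funext => h; rewrite mxE.
  apply: ft_sum => l; apply: (@ft_prod _ _ _ _ _ (fun g => lg_mx g i l)
    (fun h => lg_mx h l k)); apply: fa_gen; left; by [exists i, l|exists l, k].
have -> : (fun g h => (\det (lg_mx (lg_mul g h)))^-1) =
  (fun g h => (\det (lg_mx g))^-1 * (\det (lg_mx h))^-1).
  by apply/funext => g; apply/funext => h; rewrite det_mulmx invfM.
by apply: (@ft_prod _ _ _ _ _ (fun g => (\det (lg_mx g))^-1)
    (fun h => (\det (lg_mx h))^-1)); apply: fa_gen; right.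
Qed.

Lemma fun_alg_lg_mul (f : lg_pt G -> K) : fun_alg (@lg_gen K G) f ->
  fun_tens (@lg_gen K G) (@lg_gen K G) (fun g h => f (lg_mul g h)).
Proof. exact: (ft_comp (@lg_gen_mul)). Qed.

(** Cramer's rule: the entries of the inverse are cofactors times the inverse of the determinant,
    which is a generator. *)
Lemma fun_alg_lg_inv (f : lg_pt G -> K) : fun_alg (@lg_gen K G) f ->
  fun_alg (@lg_gen K G) (fun g => f (lg_inv g)).
Proof.
have entry i k : fun_alg (@lg_gen K G) (fun g => lg_mx g i k).
  by apply: fa_gen; left; exists i, k.
apply: fun_alg_comp => {}f [[i [k ->]]|->]; last first.
  have -> : (fun g => (\det (lg_mx (lg_inv g)))^-1) =
      (fun g : lg_pt G => \det (lg_mx g)).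
    by apply/funext => g; rewrite /= det_inv invrK.
  exact: fun_alg_det.
have -> : (fun g => lg_mx (lg_inv g) i k) = (fun g : lg_pt G =>
    (\det (lg_mx g))^-1 * ((-1) ^+ (k + i) *
      \det (row' k (col' i (lg_mx g))))).
  by apply/funext => g; rewrite /= /invmx lg_unit !mxE.
apply: fa_mul; first by apply: fa_gen; right.
apply: fa_mul; first exact: fa_const.
apply: fun_alg_det => l m; under eq_fun do rewrite !mxE; exact: entry.
Qed.

End GroupLaw.


(** * Invariant averages of vector-valued regular functions *)

Section Average.
Variables (K : fieldType) (G : linalg_group K).
Local Notation regular := (fun_alg (@lg_gen K G)).
Local Notation quadrature := (seq (K * lg_pt G)).

(** Local finiteness of translation. The constant 1 is included because the average will be a
    projection onto the constants. *)
Lemma finite_translates n (f : nat -> lg_pt G -> K) : (forall i, regular (f i)) ->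
  exists q, in_span q (fun=> 1) /\
    forall i g, (i < n)%N -> in_span q (fun t => f i (lg_mul g t)).
Proof.
move=> Sf; elim: n => [|n [q [q1 qf]]].
  by exists [:: fun=> 1]; split=> //; apply: in_span1.
have [q' fq'] := ft_span (fun_alg_lg_mul (Sf n)).
exists (q ++ q'); split=> [|i g]; first exact: in_span_catl.
rewrite ltnS leq_eqVlt => /predU1P[->|/qf ?]; first exact: in_span_catr.
exact: in_span_catl.
Qed.

(** The components of [v] in [U] and [W] stay there under [f], so the projection along an invariant
    complement is equivariant. *)
Lemma stablemx_proj r (U W f : 'M[K]_r) :
  stablemx U f -> stablemx W f -> (U + W == 1%:M)%MS ->
  (U :&: W == (0 : 'M[K]_r))%MS ->
  forall v : 'rV_r, v *m f *m proj_mx U W = v *m proj_mx U W *m f.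
Proof.
move=> Uf Wf UW1 UW0 v.
have dUW : (U :&: W = 0)%MS by apply/eqP; rewrite -submx0 (eqmxP UW0) submx_refl.
have vUW (x : 'rV_r) : (x <= U + W)%MS by rewrite (eqmxP UW1) submx1.
rewrite -{1}(add_proj_mx dUW (vUW v)) !mulmxDl.
set x := v *m proj_mx U W; set y := v *m proj_mx W U.
have -> : x *m f *m proj_mx U W = x *m f.
  apply: (proj_mx_id dUW); apply: (submx_trans _ Uf); apply: submxMr.
  exact: proj_mx_sub.
have -> : y *m f *m proj_mx U W = 0; last by rewrite addr0.
apply: (proj_mx_0 dUW); apply: (submx_trans _ Wf); apply: submxMr.
exact: proj_mx_sub.
Qed.

(* The value at some point of the projection onto the constants, in a
   finite-dimensional translation invariant space V of regular functions, is a
   combination of evaluations since the evaluations span the dual of V. *)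
Lemma invariant_quadrature n (f : nat -> lg_pt G -> K) :
    linearly_reductive G -> (forall i, regular (f i)) ->
  exists Q : quadrature, \sum_(p <- Q) p.1 = 1 /\ forall i g, (i < n)%N ->
    \sum_(p <- Q) p.1 * f i (lg_mul g p.2) = \sum_(p <- Q) p.1 * f i p.2.
Proof.
move=> HG Sf; have [q [q1 qf]] := finite_translates n Sf.
(* Quantifying over all translates makes [V] translation invariant by construction; [g = 1] shows
   that it is finite-dimensional. *)
pose V h := regular h /\ forall g, in_span q (fun t => h (lg_mul g t)).
have VL a h k : V h -> V k -> V (fun t => a * h t + k t).
  move=> [Sh qh] [Sk qk]; split=> [|g]; first exact: fun_alg_lin.
  exact: in_span_lin.
have Vq h : V h -> in_span q h.
  by case=> _ /(_ (lg_one G)); under eq_fun do rewrite lg_mul1g.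
have V1 : V (fun=> 1) by split=> //; apply: fa_const.
have Vf i : (i < n)%N -> V (f i) by move=> lt_in; split=> // g; apply: qf.
have Vtr g h : V h -> V (fun t => h (lg_mul g t)).
  move=> [Sh qh]; split=> [|g']; first exact: (ft_evall g (fun_alg_lg_mul Sh)).
  by under eq_fun do rewrite lg_mulA; apply: qh.
have [r [t [e [Ve et eE]]]] := eval_basis VL Vq.
(* Coordinates in the dual basis are the values at the points [t s], so translation multiplies the
   row of values of [h] by [rho g] on the right. *)
pose rho g : 'M[K]_r := \matrix_(s, s') e s (lg_mul g (t s')).
have Hrho : rational_rep rho.
  split=> [|g h|s s'].
  - by apply/matrixP => s s'; rewrite !mxE lg_mul1g et.
  - apply/matrixP => s s'; rewrite !mxE -lg_mulA (eE _ (Vtr g _ (Ve s))).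
    by apply: eq_bigr => s'' _; rewrite !mxE.
  - under eq_fun do rewrite mxE.
    exact: (ft_evalr _ (fun_alg_lg_mul (Ve s).1)).
pose v h : 'rV[K]_r := \row_s h (t s).
have vtr g h : V h -> v (fun x => h (lg_mul g x)) = v h *m rho g.
  move=> Vh; apply/rowP => s; rewrite !mxE (eE _ Vh).
  by apply: eq_bigr => s' _; rewrite !mxE.
pose u := v (fun=> 1).
have uinv g : u *m rho g = u by rewrite -vtr.
have Ustab g : stablemx <<u>>%MS (rho g).
  by rewrite (eqmxMr _ (genmxE _)) genmxE uinv.
have [W [Wstab UW1 UW0]] := HG r rho Hrho _ Ustab.
pose P := proj_mx <<u>>%MS W.
have dUW : (<<u>> :&: W = 0)%MS.
  by apply/eqP; rewrite -submx0 (eqmxP UW0) submx_refl.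
(* Without points the space [V] would be zero, but it contains 1. *)
have [s0 _] : exists s0 : 'I_r, True.
  apply: contrapT => nor; have := eE _ V1 (lg_one G).
  rewrite big1 => [/eqP|s _]; first by rewrite oner_eq0.
  by case: nor; exists s.
(* The projection of [h] is a constant function, so any one coordinate [s0] gives its value; the
   weights form a column of [P]. *)
have Psum h : \sum_(p <- [seq (P s s0, t s) | s <- enum 'I_r]) p.1 * h p.2 =
    (v h *m P) 0 s0.
  rewrite big_map big_enum /= mxE; apply: eq_bigr => s _.
  by rewrite [X in _ = X * _]mxE mulrC.
exists [seq (P s s0, t s) | s <- enum 'I_r]; split=> [|i g /Vf Vfi].
  have := Psum (fun=> 1); under eq_bigr do rewrite mulr1; move->.
  by rewrite (proj_mx_id dUW) ?genmxE // mxE.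
rewrite (Psum (fun x => f i (lg_mul g x))) Psum vtr //.
rewrite (stablemx_proj (Ustab g) (Wstab g) UW1 UW0) -/P.
have /sub_rVP[a ->] : (v (f i) *m P <= u)%MS by rewrite -(genmxE u) proj_mx_sub.
by rewrite -scalemxAl uinv.
Qed.

Section Module.
Variable U : lmodType K.
Implicit Types F : lg_pt G -> U.

(** The image of [O(G) (x) U] in all functions; here [U] may be a space of forms. *)
Inductive regmod : (lg_pt G -> U) -> Prop :=
  | rm_zero : regmod (fun=> 0)
  | rm_tensor f u : regular f -> regmod (fun t => f t *: u)
  | rm_add F F' : regmod F -> regmod F' -> regmod (fun t => F t + F' t).

Lemma regmodP F : regmod F -> exists n (f : nat -> lg_pt G -> K) (u : nat -> U),
  (forall i, regular (f i)) /\ forall t, F t = \sum_(i < n) f i t *: u i.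
Proof.
elim=> {F} [|f u Sf|F F' _ [n [f [u [Sf FE]]]] _ [n' [f' [u' [Sf' FE']]]]].
- exists 0%N, (fun=> fun=> 0), (fun=> 0); split=> [_|t].
    exact: fa_const.
  by rewrite big_ord0.
- by exists 1%N, (fun=> f), (fun=> u); split=> // t; rewrite big_ord1.
exists (n + n')%N, (fun i => if (i < n)%N then f i else f' (i - n)%N).
exists (fun i => if (i < n)%N then u i else u' (i - n)%N).
split=> [i|t]; first by case: ifP.
rewrite big_split_ord FE FE'; congr (_ + _); apply: eq_bigr => i _ /=.
  by rewrite ltn_ord.
by rewrite ltnNge leq_addr addKn.
Qed.

Definition qsum (Q : quadrature) F : U := \sum_(p <- Q) p.1 *: F p.2.

(** Invariance is relative to one [F]: for infinite [G] no finite combination of evaluations with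
    total weight 1 is invariant on all of [O(G)]. *)
Definition lmean (Q : quadrature) F : Prop :=
  \sum_(p <- Q) p.1 = 1 /\
  forall g, qsum Q (fun t => F (lg_mul g t)) = qsum Q F.

Definition rmean (Q : quadrature) F : Prop :=
  \sum_(p <- Q) p.1 = 1 /\
  forall g, qsum Q (fun t => F (lg_mul t g)) = qsum Q F.

Lemma qsum_tensor (Q : quadrature) n (f : nat -> lg_pt G -> K) (u : nat -> U) :
  qsum Q (fun t => \sum_(i < n) f i t *: u i) =
  \sum_(i < n) (\sum_(p <- Q) p.1 * f i p.2) *: u i.
Proof.
rewrite /qsum; under eq_bigr do rewrite scaler_sumr.
rewrite exchange_big; apply: eq_bigr => i _; rewrite scaler_suml.
by apply: eq_bigr => p _; rewrite scalerA.
Qed.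

Lemma lmean_ex F : linearly_reductive G -> regmod F -> exists Q, lmean Q F.
Proof.
move=> HG /regmodP[n [f [u [Sf FE]]]].
have [Q [Q1 Qf]] := invariant_quadrature n HG Sf.
exists Q; split=> // g; have -> : F = fun t => \sum_(i < n) f i t *: u i.
  exact/funext.
rewrite qsum_tensor (qsum_tensor Q n (fun i t => f i (lg_mul g t))).
by apply: eq_bigr => i _; rewrite Qf.
Qed.

(** Inversion exchanges left and right translations, so a left invariant combination is inverted
    point by point. *)
Lemma rmean_ex F : linearly_reductive G -> regmod F -> exists Q, rmean Q F.
Proof.
move=> HG /regmodP[n [f [u [Sf FE]]]].
have [|Q [Q1 Qf]] := @invariant_quadrature n (fun i t => f i (lg_inv t)) HG.
  by move=> i; apply: fun_alg_lg_inv.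
exists [seq (p.1, lg_inv p.2) | p <- Q]; split=> [|g]; first by rewrite big_map.
have -> : F = fun t => \sum_(i < n) f i t *: u i by exact/funext.
rewrite qsum_tensor (qsum_tensor _ n (fun i t => f i (lg_mul t g))).
apply: eq_bigr => i _; rewrite !big_map /= -(Qf i (lg_inv g)) //.
by under [in RHS]eq_bigr do rewrite lg_inv_mul lg_invK.
Qed.

Lemma mean_uniq Q Q' F : lmean Q F -> rmean Q' F -> qsum Q F = qsum Q' F.
Proof.
move=> [Q1 Ql] [Q'1 Q'r].
rewrite -[LHS]scale1r -[RHS]scale1r -{1}Q'1 -{1}Q1 !scaler_suml.
under eq_bigr => p _ do rewrite -(Ql p.2) /qsum scaler_sumr.
rewrite exchange_big; apply: eq_bigr => p _ /=.
rewrite -(Q'r p.2) /qsum scaler_sumr; apply: eq_bigr => p' _.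
by rewrite !scalerA mulrC.
Qed.

Definition avg F : U :=
  if pselect (exists Q, lmean Q F) is left H then qsum (projT1 (cid H)) F else 0.

Hypothesis HG : linearly_reductive G.

(** Two left means agree because each agrees with one and the same right mean; the choice in [avg]
    is thus immaterial. *)
Lemma avgE Q F : regmod F -> lmean Q F -> avg F = qsum Q F.
Proof.
move=> SF QF; rewrite /avg; case: pselect => [H|]; last by case; exists Q.
case: cid => Q' Q'F /=; have [Q'' Q''F] := rmean_ex HG SF.
by rewrite (mean_uniq Q'F Q''F) (mean_uniq QF Q''F).
Qed.

Lemma avg_qsum F : regmod F -> exists2 Q, lmean Q F & avg F = qsum Q F.
Proof.
move=> SF; have [Q QF] := lmean_ex HG SF; exists Q => //; exact: avgE.
Qed.

Lemma avg_const u : avg (fun=> u) = u.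
Proof.
have [Q [Q1 _] ->] : exists2 Q, lmean Q (fun=> u) & avg (fun=> u) = qsum Q (fun=> u).
  apply: avg_qsum; have -> : (fun=> u) = (fun t => (fun=> 1) t *: u) :> (lg_pt G -> U).
    by apply/funext => t; rewrite scale1r.
  by apply: rm_tensor; apply: fa_const.
by rewrite /qsum -scaler_suml Q1 scale1r.
Qed.

Lemma avg_translate F g : regmod F -> avg (fun t => F (lg_mul g t)) = avg F.
Proof.
move=> SF; have [Q QF ->] := avg_qsum SF; have [Q1 Ql] := QF.
rewrite -(Ql g); apply: avgE; last first.
  by split=> // h; under [in LHS]eq_fun do rewrite lg_mulA; rewrite !Ql.
elim: SF => {F QF Ql} [|f u Sf|F F' _ HF _ HF'].
- exact: rm_zero.
- by apply: rm_tensor; apply: (ft_evall g (fun_alg_lg_mul Sf)).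
- exact: (rm_add HF HF').
Qed.

End Module.

Definition klinear (U V : lmodType K) (l : U -> V) : Prop :=
  {morph l : x y / x + y} /\ forall k x, l (k *: x) = k *: l x.

Lemma regmod_lin (U V : lmodType K) (l : U -> V) F :
  klinear l -> regmod F -> regmod (fun t => l (F t)).
Proof.
case=> lD lZ; elim=> {F} [|f u Sf|F F' _ HF _ HF'].
- by rewrite (morph_add0 lD); apply: rm_zero.
- by under eq_fun do rewrite lZ; apply: rm_tensor.
- by under eq_fun do rewrite lD; apply: rm_add.
Qed.

Lemma qsum_lin (U V : lmodType K) (l : U -> V) Q F :
  klinear l -> qsum Q (fun t => l (F t)) = l (qsum Q F).
Proof.
case=> lD lZ; rewrite /qsum (morph_add_sum lD).
by apply: eq_bigr => p _; rewrite lZ.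
Qed.

Hypothesis HG : linearly_reductive G.

(** A mean of [F] is also one of [l (F t)], so the same weighted points serve on both sides. *)
Lemma avg_lin (U V : lmodType K) (l : U -> V) F :
  klinear l -> regmod F -> avg (fun t => l (F t)) = l (avg F).
Proof.
move=> Hl SF; have [Q QF ->] := avg_qsum HG SF; rewrite -(qsum_lin _ _ Hl).
apply: avgE => //; first exact: regmod_lin.
case: QF => Q1 Ql; split=> // g.
by rewrite (qsum_lin Q (fun t => F (lg_mul g t)) Hl) Ql (qsum_lin _ _ Hl).
Qed.

(** The weighted points chosen for [F] and [F'] differ; averaging the pair gives common ones, and
    the sum and both projections are linear. *)
Lemma avgD (U : lmodType K) (F F' : lg_pt G -> U) : regmod F -> regmod F' ->
  avg (fun t => F t + F' t) = avg F + avg F'.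
Proof.
move=> SF SF'; pose P t : (U * U)%type := (F t, F' t).
have SP : regmod P.
  have -> : P = (fun t => (F t, 0) + (0, F' t)).
    by apply/funext => t; rewrite /P; congr (_, _); rewrite ?addr0 ?add0r.
  apply: rm_add.
    apply: (regmod_lin (l := fun x => (x, 0) : U * U) _ SF).
    by split=> [x y|k x]; congr (_, _); rewrite ?addr0 ?scaler0.
  apply: (regmod_lin (l := fun x => (0, x) : U * U) _ SF').
  by split=> [x y|k x]; congr (_, _); rewrite ?addr0 ?scaler0.
rewrite (avg_lin (l := fun p : U * U => p.1 + p.2) _ SP); last first.
  by split=> [x y|k x] /=; [rewrite addrACA|rewrite scalerDr].
congr (_ + _).
  by rewrite -(avg_lin (l := fun p : U * U => p.1) _ SP).
by rewrite -(avg_lin (l := fun p : U * U => p.2) _ SP).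
Qed.

Lemma regmod_bilin (U V W : lmodType K) (b : U -> V -> W) F F' :
    (forall u, klinear (b u)) -> (forall v, klinear (b^~ v)) ->
  regmod F -> regmod F' -> regmod (fun t => b (F t) (F' t)).
Proof.
move=> bl br SF; elim: SF F' => {F} [|f u Sf|F1 F2 _ H1 _ H2] F' SF'.
- by under eq_fun do rewrite (morph_add0 (br _).1); apply: rm_zero.
- elim: SF' => {F'} [|f' v Sf'|F1 F2 _ H1 _ H2].
  + by under eq_fun do rewrite (morph_add0 (bl _).1); apply: rm_zero.
  + under eq_fun do rewrite (br _).2 (bl _).2 scalerA.
    by apply: (rm_tensor (f := fun t => f t * f' t)); apply: fa_mul.
  + by under eq_fun do rewrite (bl _).1; apply: rm_add.
by under eq_fun do rewrite (br _).1; apply: rm_add; [apply: H1|apply: H2].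
Qed.

End Average.


(** * Forms on the product of Spec A with a power of G *)

(* alias of the carrier of A, with the K-module structure given by [scal A] *)
Definition amod (K : fieldType) (A : gca K) : Type := gcar A.

Section ScalarModule.
Variables (K : fieldType) (A : gca K).
HB.instance Definition _ := GRing.PzRing.on (amod A).
Definition amod_scale (k : K) (a : amod A) : amod A := scal A k * (a : A).
Fact amod_scalerA k l a : amod_scale k (amod_scale l a) = amod_scale (k * l) a.
Proof. by rewrite /amod_scale rmorphM mulrA. Qed.
Fact amod_scale1r : left_id 1 amod_scale.
Proof. by move=> a; rewrite /amod_scale rmorph1 mul1r. Qed.
Fact amod_scalerDr : right_distributive amod_scale +%R.
Proof. by move=> k a b; rewrite /amod_scale mulrDr. Qed.
Fact amod_scalerDl a : {morph amod_scale^~ a : k l / k + l}.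
Proof. by move=> k l; rewrite /amod_scale rmorphD mulrDl. Qed.
HB.instance Definition _ := GRing.Zmodule_isLmodule.Build K (amod A)
  amod_scalerA amod_scale1r amod_scalerDr amod_scalerDl.

Lemma amod_scaleE (k : K) (a : amod A) : k *: a = scal A k * (a : A).
Proof. by []. Qed.
End ScalarModule.

Section Klinear.
Variables (K : fieldType) (A : cdga K).

Lemma klinear_din : klinear (@din K A : amod A -> dR A).
Proof. by split=> [x y|k x]; [apply: dinD|apply: dinZ]. Qed.

Lemma klinear_dsu_kd : klinear ((fun a => dsu (kd a)) : amod A -> dR A).
Proof.
split=> [x y|k x]; first by rewrite kdD dsuD.
by rewrite dsu_kdM kd_scal dsu0 mul0r add0r parity_scal.
Qed.

Lemma klinear_ddif : klinear (@ddif K A : dR A -> dR A).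
Proof. by split=> [x y|k x]; [apply: ddifD|apply: ddifZ]. Qed.

Lemma klinear_ddR : klinear (@ddR K A : dR A -> dR A).
Proof. by split=> [x y|k x]; [apply: ddR_add|apply: ddRZ]. Qed.

Lemma klinear_mull (w : dR A) : klinear ( *%R w : dR A -> dR A).
Proof. by split=> [x y|k x]; [apply: mulrDr|apply: scalerAr_dR]. Qed.

Lemma klinear_mulr (w : dR A) : klinear ( *%R^~ w : dR A -> dR A).
Proof. by split=> [x y|k x]; [apply: mulrDl|apply: scalerAl_dR]. Qed.

End Klinear.

(** * Pullbacks depending regularly on a group element *)

Section RegularPullbacks.
Variables (K : fieldType) (A B : cdga K) (G : linalg_group K).

Lemma klinear_dmap (f : cdga_hom A B) : klinear (dmap f : dR A -> dR B).
Proof. by split=> [x y|k x]; [apply: dmapD|apply: dmapZ]. Qed.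

Lemma regmod_dmap (phi : lg_pt G -> cdga_hom A B) w :
    (forall a, regmod (fun t => phi t a : amod B)) ->
  regmod (fun t => dmap (phi t) w).
Proof.
move=> Sphi.
have mulP : forall F F' : lg_pt G -> dR B, regmod F -> regmod F' ->
    regmod (fun t => F t * F' t).
  move=> F F'; apply: (regmod_bilin (b := fun w z : dR B => w * z)) => u.
    exact: klinear_mull.
  exact: klinear_mulr.
elim/dR_ind: w => [a|x|w z Hw Hz|w z Hw Hz].
- under eq_fun do rewrite dmap_din.
  exact: regmod_lin (@klinear_din _ _) (Sphi a).
- under eq_fun do rewrite dmap_dsu.
  elim/kaehler_ind: x => [a||x y Hx Hy|a x Hx].
  + under eq_fun do rewrite kmap_kd.
    exact: regmod_lin (@klinear_dsu_kd _ _) (Sphi a).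
  + under eq_fun do rewrite (morph_add0 (@kmapD _ _ _ _)) dsu0.
    exact: rm_zero.
  + under eq_fun do rewrite kmapD dsuD.
    exact: rm_add.
  + under eq_fun do rewrite kmapZ dsuZ parity_map.
    apply: mulP => //; exact: regmod_lin (@klinear_din _ _) (Sphi _).
- under eq_fun do rewrite dmapD.
  exact: rm_add.
- under eq_fun do rewrite dmapM.
  exact: mulP.
Qed.

End RegularPullbacks.

Section Reindex.
Variables (K : fieldType) (T T' : Type) (S : set (T -> K)) (S' : set (T' -> K)).

Section Fixed.
Variables (A : cdga K) (phi : T' -> T).
Hypothesis Hphi : forall h, S h -> fun_alg S' (fun t => h (phi t)).

Fact precompP (F : T -> A) :
  regval S F -> regval S' (fun t => cdga_id A (F (phi t))).
Proof. exact: regval_comp. Qed.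

Definition precomp : cdga_hom (tens S A) (tens S' A) :=
  tens_map (phi := phi) (alpha := fun=> cdga_id A) precompP.

End Fixed.

Variables (A : cdga K) (G : linalg_group K) (psi : T' -> lg_pt G -> T).
Hypothesis Hpsi : forall h, S h ->
  fun_tens S' (@lg_gen K G) (fun x t => h (psi x t)).

(** The point [t] is frozen: this is the pullback along [psi^~ t], under which differentials in the
    direction of [t] disappear. *)
Definition precomp_at (B : cdga K) (t : lg_pt G) :
    cdga_hom (tens S B) (tens S' B) :=
  precomp B (phi := psi^~ t) (fun h Sh => ft_evalr t (Hpsi Sh)).

Lemma regmod_precomp (F : tens S A) :
  regmod (fun t => precomp_at A t F : amod (tens S' A)).
Proof.
have [F0 SF FE] : exists2 F0, regval S F0 & forall x, F x = F0 x.
  by exists F => //; apply: tvalP.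
elim: SF F FE => {F0} [|f a Sf|F1 F2 SF1 H1 SF2 H2] F FE.
- have -> : (fun t => precomp_at A t F : amod (tens S' A)) = fun=> 0.
    by apply/funext => t; apply: tens_eq => x /=; rewrite FE.
  exact: rm_zero.
(* After composition with [psi] a single function [f] becomes a sum of products in [x] and [t],
   hence a second induction. *)
- suff Ht H (Phi : lg_pt G -> tens S' A) : fun_tens S' (@lg_gen K G) H ->
      (forall t x, Phi t x = scal A (H x t) * a) ->
      regmod (Phi : lg_pt G -> amod (tens S' A)).
    by apply: Ht (ft_comp Hpsi Sf) _ => t x; apply: FE.
  move=> SH; elim: SH Phi => {H} [g g' Sg Sg'|H H' SH IH SH' IH'] Phi PhiE.
    pose u : amod (tens S' A) := mktens (rv_tensor a Sg).
    have -> : Phi = fun t => g' t *: u.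
      apply/funext => t; apply: tens_eq => x.
      by rewrite amod_scaleE PhiE tvalM /= mulrC rmorphM mulrA.
    exact: rm_tensor.
  pose P (H0 : T' -> lg_pt G -> K) (SH0 : fun_tens S' (@lg_gen K G) H0) t :=
    mktens (rv_tensor a (ft_evalr t SH0)).
  have -> : Phi = fun t => (P _ SH t : amod (tens S' A)) + P _ SH' t.
    apply/funext => t; apply: tens_eq => x.
    by rewrite PhiE tvalD /= rmorphD mulrDl.
  by apply: rm_add; [apply: IH|apply: IH'].
have -> : (fun t => precomp_at A t F : amod (tens S' A)) =
    fun t => (precomp_at A t (mktens SF1) : amod (tens S' A)) +
             precomp_at A t (mktens SF2).
  by apply/funext => t; apply: tens_eq => x; rewrite tvalD /= FE.
by apply: rm_add; [apply: H1|apply: H2].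
Qed.

End Reindex.

Section Evaluation.
Variables (K : fieldType) (T : Type) (S : set (T -> K)) (A : cdga K) (x : T).

Definition tens_ev_fun (F : tens S A) : A := F x.
Fact tens_ev_zmod : zmod_morphism tens_ev_fun. Proof. by []. Qed.
Fact tens_ev_monoid : monoid_morphism tens_ev_fun. Proof. by []. Qed.
HB.instance Definition _ := GRing.isZmodMorphism.Build (tens S A) A
  tens_ev_fun tens_ev_zmod.
HB.instance Definition _ := GRing.isMonoidMorphism.Build (tens S A) A
  tens_ev_fun tens_ev_monoid.
Definition tens_ev : cdga_hom (tens S A) A :=
  @CdgaHom _ (tens S A) A
    (@GcaHom _ (tens S A) A tens_ev_fun (fun=> erefl) (fun _ _ => erefl))
    (fun=> erefl).

End Evaluation.

(** Differentials of scalars vanish. This will be applied to the fibre of [G^j] at a point. *)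
Lemma dhomog_scal_eq0 (K : fieldType) (B : cdga K) p n (w : dR B) :
  (forall b : B, exists k, b = scal B k) -> dhomog p n w -> (0 < p)%N -> w = 0.
Proof.
move=> Bk; elim=> {p n w} //= [n x xn _|p n w z _ Hw _ Hz p0|
  p q m n w z _ Hw _ Hz].
- suff -> : x = 0 by rewrite dsu0.
  elim/kaehler_ind: x {xn} => [b||x y -> ->|b x ->] //.
  + by have [k ->] := Bk b; rewrite kd_scal.
  + by rewrite addr0.
  + by rewrite scaler0.
- by rewrite Hw // Hz // addr0.
by rewrite addn_gt0 => /orP[/Hw->|/Hz->]; rewrite ?mul0r ?mulr0.
Qed.

(** * The ideal of forms of positive weight along the group *)

Section Ideal.
Variables (K : fieldType) (G : linalg_group K) (A : cdga K).
Local Notation S j := (@lpow_gen K G j).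

Lemma GidealN j (w : dR (lvl G A j)) : Gideal w -> Gideal (- w).
Proof. by rewrite -mulN1r; apply: ig_mull. Qed.

Lemma Gideal_sign j n (w : dR (lvl G A j)) : Gideal w -> Gideal ((-1) ^+ n * w).
Proof. exact: ig_mull. Qed.

Lemma GidealZ j k (w : dR (lvl G A j)) : Gideal w -> Gideal (k *: w).
Proof. exact: ig_mull. Qed.

Lemma Gideal_sum j (I : Type) (r : seq I) (P : pred I) (F : I -> dR (lvl G A j)) :
  (forall i, P i -> Gideal (F i)) -> Gideal (\sum_(i <- r | P i) F i).
Proof.
move=> IF; elim/big_rec: _ => [|i x Pi Ix]; first exact: ig_zero.
by apply: ig_add => //; apply: IF.
Qed.

Lemma Gideal_map j j' (f : cdga_hom (lvl G A j) (lvl G A j'))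
    (g : cdga_hom (tens (S j) (ground K)) (tens (S j') (ground K))) w :
    (forall F, f (proj_pullback G A j F) = proj_pullback G A j' (g F)) ->
  Gideal w -> Gideal (dmap f w).
Proof.
move=> fg; elim=> {w} [w [eta [p [n [p0 hp]]] ->]||x y _ Hx _ Hy|a x _ Hx|a x _ Hx].
- apply: ig_gen; exists (dmap g eta); last exact: dmap_square.
  by exists p, n; split=> //; apply: dmap_dhomog.
- by rewrite dmap0; apply: ig_zero.
- by rewrite dmapD; apply: ig_add.
- by rewrite dmapM; apply: ig_mull.
- by rewrite dmapM; apply: ig_mulr.
Qed.

Lemma Gideal_dparity j (w : dR (lvl G A j)) : Gideal w -> Gideal (dparity w).
Proof.
elim=> {w} [w [eta [p [n [p0 hp]]] wE]||x y _ Hx _ Hy|a x _ Hx|a x _ Hx].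
- rewrite wE -dmap_dparity (dparity_dhomog hp).
  rewrite (morph_sign (@dmapD _ _ _ _)); apply/Gideal_sign/ig_gen.
  by exists eta => //; exists p, n.
- by rewrite (morph_add0 (@dparityD _ _)); apply: ig_zero.
- by rewrite dparityD; apply: ig_add.
- by rewrite dparityM; apply: ig_mull.
- by rewrite dparityM; apply: ig_mulr.
Qed.

(** Common to [ddif] and [ddR]. The derivation is a natural family over all cdgas, so on a generator
    it can be computed on [G^j], where the weight stays positive. *)
Lemma Gideal_der j (D : forall B : cdga K, dR B -> dR B) :
    (forall B, {morph D B : w z / w + z}) ->
    (forall B w z, D B (w * z) = D B w * z + dparity w * D B z) ->
    (forall B C (f : cdga_hom B C) w, D C (dmap f w) = dmap f (D B w)) ->
    (forall B p n w, (0 < p)%N -> dhomog p n w ->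
      exists q m, (0 < q)%N /\ dhomog q m (D B w)) ->
  forall w : dR (lvl G A j), Gideal w -> Gideal (D _ w).
Proof.
move=> DD DM Dmap Dhom w.
elim=> {w} [w [eta [p [n [p0 hp]]] ->]||x y Ix Hx Iy Hy|a x Ix Hx|a x Ix Hx].
- by rewrite Dmap; apply: ig_gen; exists (D _ eta) => //; apply: Dhom hp.
- by rewrite (morph_add0 (DD _)); apply: ig_zero.
- by rewrite DD; apply: ig_add.
- by rewrite DM; apply: ig_add; apply: ig_mull.
- rewrite DM; apply: ig_add; apply: ig_mulr => //.
  exact: Gideal_dparity.
Qed.

Lemma Gideal_ddif j (w : dR (lvl G A j)) : Gideal w -> Gideal (ddif w).
Proof.
apply: (Gideal_der (D := fun B => @ddif K B)) => [B|B|B C f z|B p n z p0 hp].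
- exact: ddifD.
- exact: ddifM.
- by rewrite dmap_ddif.
- by exists p, n.-1; split=> //; case: (ddif_dhomog hp).
Qed.

Lemma Gideal_ddR j (w : dR (lvl G A j)) : Gideal w -> Gideal (ddR w).
Proof.
apply: (Gideal_der (D := fun B => @ddR K B)) => [B|B|B C f z|B p n z p0 hp].
- exact: ddR_add.
- exact: ddR_mul.
- by rewrite dmap_ddR.
- by exists p.+1, n.+1; split=> //; apply: ddR_dhomog.
Qed.

(** On generators, evaluation at [x] factors through forms on a point. *)
Lemma Gideal_ev j x (w : dR (lvl G A j)) :
  Gideal w -> dmap (tens_ev (S j) A x) w = 0.
Proof.
elim=> {w} [w [eta [p [n [p0 hp]]] ->]||w z _ Hw _ Hz|a w _ Hw|a w _ Hw].
- rewrite (@dmap_square _ _ _ _ _ _ _ (ground_map A) (tens_ev (S j) (ground K) x)) //.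
  have -> : dmap (tens_ev (S j) (ground K) x) eta = 0; last exact: dmap0.
  apply: (dhomog_scal_eq0 _ (dmap_dhomog _ hp) p0) => b.
  by exists b.
- exact: dmap0.
- by rewrite dmapD Hw Hz addr0.
- by rewrite dmapM Hw mulr0.
- by rewrite dmapM Hw mul0r.
Qed.

Section Decomposition.
Variable j : nat.
Local Notation L := (lvl G A j).

Definition gfun (f : lpow G j -> K) (Sf : fun_alg (S j) f) (B : cdga K) :
    tens (S j) B :=
  mktens (rv_tensor 1 Sf).

Lemma gfun_homog f (Sf : fun_alg (S j) f) B : homog 0 (gfun Sf B).
Proof.
apply/tens_homog => x /=; exact: (homogM (homog_scal _ _) (homog1 _)).
Qed.

Inductive decomposable : dR L -> Prop :=
  | dec_ideal w : Gideal w -> decomposable w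
  | dec_tensor f (Sf : fun_alg (S j) f) eta :
      decomposable (din (gfun Sf A) * dmap (tens_const (S j) A) eta)
  | dec_add w z : decomposable w -> decomposable z -> decomposable (w + z).

Lemma decomposableM w z : decomposable w -> decomposable z -> decomposable (w * z).
Proof.
move=> Dw; elim: Dw z => {w} [w Iw|f Sf eta|w w' _ Hw _ Hw'] z Dz; last first.
- by rewrite mulrDl; apply: dec_add; [apply: Hw|apply: Hw'].
- elim: Dz => {z} [z Iz|f' Sf' eta'|z z' _ Hz _ Hz'].
  + exact/dec_ideal/ig_mull.
  + rewrite mulrA -(mulrA _ _ (din _)) -(din_central _ (gfun_homog Sf' A)).
    rewrite mulrA -mulrA -dinM -dmapM.
    have -> : gfun Sf A * gfun Sf' A = gfun (fa_mul Sf Sf') A.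
      by apply: tens_eq => x; rewrite tvalM /= !mulr1 rmorphM.
    exact: dec_tensor.
  + by rewrite mulrDr; apply: dec_add.
- exact/dec_ideal/ig_mulr.
Qed.

Lemma regval_tens_ind (P : L -> Prop) :
    P 0 -> (forall F F', P F -> P F' -> P (F + F')) ->
    (forall f (Sf : fun_alg (S j) f) a,
      P (gfun Sf A * tens_const (S j) A a)) ->
  forall F, P F.
Proof.
move=> P0 PD PT F.
have [F0 SF FE] : exists2 F0, regval (S j) F0 & forall x, F x = F0 x.
  by exists F => //; apply: tvalP.
elim: SF F FE => {F0} [|f a Sf|F1 F2 SF1 H1 SF2 H2] F FE.
- by have -> : F = 0 by apply: tens_eq.
- have -> : F = gfun Sf A * tens_const (S j) A a; last exact: PT.
  by apply: tens_eq => x; rewrite FE tvalM /= mulr1.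
have -> : F = mktens SF1 + mktens SF2 by apply: tens_eq.
by apply: PD; [apply: H1|apply: H2].
Qed.

(* d f lies in the ideal for f in O(G^j), so modulo the ideal only functions on
   G^j and forms on Spec A are left. *)
Lemma decomposableT w : decomposable w.
Proof.
have inT F : decomposable (din F).
  elim/regval_tens_ind: F => [|F F' HF HF'|f Sf a].
  - by rewrite din0; apply/dec_ideal/ig_zero.
  - by rewrite dinD; apply: dec_add.
  - by rewrite dinM -dmap_din; apply: dec_tensor.
elim/dR_ind: w => // [x|w z|w z]; [|exact: dec_add|exact: decomposableM].
elim/kaehler_ind: x => [F||x y Hx Hy|F x Hx].
- elim/regval_tens_ind: F => [|F F' HF HF'|f Sf a].
  + by rewrite kd0 dsu0; apply/dec_ideal/ig_zero.
  + by rewrite kdD dsuD; apply: dec_add.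
  rewrite dsu_kdM (parity_homog (gfun_homog Sf A)) expr0 mul1r.
  apply: dec_add; last by rewrite -kmap_kd -dmap_dsu; apply: dec_tensor.
  apply/dec_ideal/ig_mulr/ig_gen; exists (dsu (kd (gfun Sf (ground K)))).
    by exists 1, 1; split=> //; apply/dh_su/kh_gen/gfun_homog.
  rewrite dmap_dsu kmap_kd; congr (dsu (kd _)); apply: tens_eq => x /=.
  by rewrite !mulr1.
- by rewrite dsu0; apply/dec_ideal/ig_zero.
- by rewrite dsuD; apply: dec_add.
- by rewrite dsuZ; apply: decomposableM.
Qed.

(** Modulo the ideal [w] involves only finitely many functions on [G^j]. In a basis [e s] dual to
    evaluation at points [t s], the coefficient of [e s] is the restriction of [w] to the fibre over
    [t s]. *)
Lemma Gideal_ev_eq0 (w : dR L) :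
  (forall x, dmap (tens_ev (S j) A x) w = 0) -> Gideal w.
Proof.
pose approx r (t : 'I_r -> lpow G j) (e : 'I_r -> lpow G j -> K)
    (Se : forall s, fun_alg (S j) (e s)) (z : dR L) :=
  \sum_s din (gfun (Se s) A) *
    dmap (tens_const (S j) A) (dmap (tens_ev (S j) A (t s)) z).
(* The functions are collected before the points are chosen, because the summands of [w] must be
   interpolated in one common basis. *)
have [n [f [Sf wE]]] : exists n (f : nat -> lpow G j -> K),
    (forall i, fun_alg (S j) (f i)) /\
    forall r (t : 'I_r -> lpow G j) e (Se : forall s, fun_alg (S j) (e s)),
      (forall i, (i < n)%N -> forall x, f i x = \sum_s f i (t s) * e s x) ->
      Gideal (w - approx r t e Se w).
  elim: (decomposableT w) => {w} [w Iw|f Sf eta|w z _ [n [f [Sf Hw]]]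
      _ [m [g [Sg Hz]]]].
  - exists 0%N, (fun=> fun=> 0); split=> [_|r t e Se _]; first exact: fa_const.
    rewrite /approx big1 ?subr0 // => s _.
    by rewrite (Gideal_ev _ Iw) dmap0 mulr0.
  - exists 1%N, (fun=> f); split=> // r t e Se /(_ 0%N isT) fE.
    suff -> : approx r t e Se (din (gfun Sf A) * dmap (tens_const (S j) A) eta) =
        din (gfun Sf A) * dmap (tens_const (S j) A) eta.
      by rewrite subrr; apply: ig_zero.
    have evc x : dmap (tens_ev (S j) A x) (dmap (tens_const (S j) A) eta) = eta.
      by rewrite (dmap_comp _ (h := cdga_id A)) // dmap_id.
    rewrite /approx; under eq_bigr => s _.
      rewrite dmapM dmap_din evc dmapM dmap_din mulrA -dinM; over.
    rewrite -mulr_suml -(morph_add_sum (@dinD _ _)); congr (din _ * _).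
    apply: tens_eq => x; rewrite tval_sum.
    rewrite -[RHS]/(scal A (f x) * 1) mulr1 fE rmorph_sum.
    apply: eq_bigr => s _; rewrite tvalM mulrC.
    by rewrite -[LHS]/((scal A (e s x) * 1) * (scal A (f (t s)) * 1)) !mulr1 rmorphM.
  exists (n + m)%N, (fun i => if (i < n)%N then f i else g (i - n)%N).
  split=> [i|r t e Se fgE]; first by case: ifP.
  have -> : w + z - approx r t e Se (w + z) =
      (w - approx r t e Se w) + (z - approx r t e Se z).
    rewrite addrACA -opprD; congr (_ - _); rewrite /approx -big_split /=.
    by apply: eq_bigr => s _; rewrite !dmapD mulrDr.
  apply: ig_add.
    apply: Hw => i lt_in x.
    by have := fgE i (ltn_addr m lt_in) x; rewrite lt_in.
  apply: Hz => i lt_im x.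
  have := fgE (n + i)%N; rewrite ltn_add2l => /(_ lt_im x).
  by rewrite ltnNge leq_addr addKn.
move=> w0.
pose V h := fun_alg (S j) h /\ in_span (mkseq f n) h.
have [|h []//|r [t [e [Ve et eE]]]] := @eval_basis _ _ V (mkseq f n).
  move=> a h k [Sh qh] [Sk qk]; split; first exact: fun_alg_lin.
  exact: in_span_lin.
rewrite -[w]subr0 -[X in _ - X](_ : approx r t e (fun s => (Ve s).1) w = 0).
  apply: wE => i lt_in x; apply: eE; split=> //.
  exists (fun k => (k == i)%:R) => y; rewrite size_mkseq.
  rewrite (bigD1 (Ordinal lt_in)) //= eqxx mul1r nth_mkseq // big1 ?addr0 //.
  by move=> k; rewrite -val_eqE /= => /negbTE->; rewrite mul0r.
by rewrite /approx big1 // => s _; rewrite w0 dmap0 mulr0.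
Qed.

End Decomposition.
End Ideal.


(** * Faces and sections in coordinates on powers of the group *)

Section Points.
Variables (K : fieldType) (G : linalg_group K).
Local Notation S j := (@lpow_gen K G j).

(* the n-th component, defined for all n in order to compute with numbers
   instead of ordinals; it is 1 for n out of range *)
Definition component j (x : lpow G j) (n : nat) : lg_pt G :=
  oapp x (lg_one G) (insub n).
Definition mkpt j (u : nat -> lg_pt G) : lpow G j := fun i => u i.

Lemma comp_ord j (x : lpow G j) (i : 'I_j) : component x i = x i.
Proof. by rewrite /component valK. Qed.

Lemma comp_mkpt j u n : (n < j)%N -> component (@mkpt j u) n = u n.
Proof. by move=> ltnj; rewrite -[n]/(val (Ordinal ltnj)) comp_ord. Qed.

Lemma lpow_eq j (x y : lpow G j) :
  (forall n, (n < j)%N -> component x n = component y n) -> x = y.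
Proof. by move=> xy; apply/funext => i; rewrite -!comp_ord; apply: xy. Qed.

Lemma comp_face j k (x : lpow G j.+1) n : (n < j)%N ->
  component (face_pt k x) n = if (n.+1 < k)%N then component x n
    else if n.+1 == k then lg_mul (component x n) (component x n.+1)
    else component x n.+1.
Proof.
move=> ltnj; rewrite -{1}[n]/(val (Ordinal ltnj)) comp_ord /face_pt /=.
have -> : x (widen_ord (leqnSn j) (Ordinal ltnj)) = component x n.
  by rewrite -comp_ord.
by have -> : x (lift ord0 (Ordinal ltnj)) = component x n.+1 by rewrite -comp_ord.
Qed.

Lemma face_pt_face_pt j k l (x : lpow G j.+2) : (k < l)%N ->
  face_pt k (face_pt l x) = face_pt l.-1 (face_pt k x).
Proof.
move=> lt_kl; apply: lpow_eq => n lt_nj.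
rewrite !comp_face ?ltnS ?(ltnW lt_nj) //.
do ![case: ifP => ?]; try lia; rewrite ?lg_mulA //.
Qed.

(* The maps (x, t) |-> (x_0, .., x_(j-1), t), (x_0, .., x_(j-1), x_j t) and
   (x_0, .., x_(j-1), t); the first is defined on G^j x G, the other two on
   G^(j+1) x G. *)
Definition section_pt j (x : lpow G j) (t : lg_pt G) : lpow G j.+1 :=
  mkpt (fun n => if (n < j)%N then component x n else t).
Definition mulr_last j (x : lpow G j.+1) (t : lg_pt G) : lpow G j.+1 :=
  mkpt (fun n => if (n < j)%N then component x n else lg_mul (component x j) t).
Definition set_last j (x : lpow G j.+1) (t : lg_pt G) : lpow G j.+1 :=
  mkpt (fun n => if (n < j)%N then component x n else t).

Lemma fun_alg_comp_pt j n (h : lg_pt G -> K) : (n < j)%N -> lg_gen h ->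
  fun_alg (S j) (fun x => h (component x n)).
Proof.
move=> ltnj Sh; apply: fa_gen; exists (Ordinal ltnj); exists h => //.
by apply/funext => x; rewrite -comp_ord.
Qed.

Lemma section_ptP j h : S j.+1 h ->
  fun_tens (S j) (@lg_gen K G) (fun x t => h (section_pt x t)).
Proof.
case=> i [h0 Sh ->]; rewrite /section_pt /mkpt.
case: ltnP => [lt_ij|_]; last by apply: ft_snd; apply: fa_gen.
by apply: (ft_fst _ (f := fun x => h0 (component x i))); apply: fun_alg_comp_pt.
Qed.

Lemma set_lastP j h : S j.+1 h ->
  fun_tens (S j.+1) (@lg_gen K G) (fun x t => h (set_last x t)).
Proof.
case=> i [h0 Sh ->]; rewrite /set_last /mkpt.
case: ltnP => [lt_ij|_]; last by apply: ft_snd; apply: fa_gen.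
apply: (ft_fst _ (f := fun x : lpow G j.+1 => h0 (component x i))).
by apply: fun_alg_comp_pt => //; apply: ltnW.
Qed.

Lemma mulr_lastP j h : S j.+1 h ->
  fun_tens (S j.+1) (@lg_gen K G) (fun x t => h (mulr_last x t)).
Proof.
case=> i [h0 Sh ->]; rewrite /mulr_last /mkpt.
case: ltnP => [lt_ij|_].
  apply: (ft_fst _ (f := fun x : lpow G j.+1 => h0 (component x i))).
  by apply: fun_alg_comp_pt => //; apply: ltnW.
apply: (ft_compl (phi := fun x : lpow G j.+1 => component x j) _ (lg_gen_mul Sh)).
by move=> h' Sh'; apply: fun_alg_comp_pt.
Qed.

(** These faces do not touch the last coordinate [t]. Of the other two, one multiplies [t] into its
    neighbour and one drops it. *)
Lemma face_pt_section j k (x : lpow G j.+1) t : (k <= j)%N ->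
  face_pt k (section_pt x t) = section_pt (face_pt k x) t.
Proof.
move=> le_kj; apply: lpow_eq => n lt_nj.
rewrite comp_face // !comp_mkpt ?ltnS ?(ltnW lt_nj) //.
case: (ltnP n j) => [lt_nj'|]; last by do ![case: ifP => ?] => //; try lia.
rewrite (comp_face _ _ lt_nj'); do ![case: ifP => ?] => //; try lia.
Qed.

Lemma face_pt_section_mulr j (x : lpow G j.+1) t :
  face_pt j.+1 (section_pt x t) = mulr_last x t.
Proof.
apply: lpow_eq => n lt_nj; rewrite comp_face // !comp_mkpt ?ltnS ?(ltnW lt_nj) //.
do ![case: ifP => ?]; try lia; rewrite //.
by have -> : n = j by lia.
Qed.

Lemma face_pt_section_id j (x : lpow G j) t : face_pt j.+1 (section_pt x t) = x.
Proof.
apply: lpow_eq => n lt_nj; rewrite comp_face // !comp_mkpt ?ltnS ?(ltnW lt_nj) //.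
by do ![case: ifP => ?]; try lia.
Qed.

Lemma section_face_pt_last j (x : lpow G j.+1) t :
  section_pt (face_pt j.+1 x) t = set_last x t.
Proof.
apply: lpow_eq => n lt_nj; rewrite !comp_mkpt //; case: ltnP => // lt_nj'.
by rewrite comp_face // ltnS lt_nj'.
Qed.

End Points.

(** * Averages of forms modulo the ideal *)

Section Integration.
Variables (K : fieldType) (G : linalg_group K) (A : cdga K).
Hypothesis HG : linearly_reductive G.
Local Notation S j := (@lpow_gen K G j).
Local Notation L j := (lvl G A j).

Lemma Gideal_precomp j j' (phi : lpow G j' -> lpow G j)
    (Hphi : forall h, S j h -> fun_alg (S j') (fun x => h (phi x))) (w : dR (L j)) :
  Gideal w -> Gideal (dmap (precomp A Hphi) w).
Proof.
by apply: (Gideal_map (g := precomp (ground K) Hphi)) => F; apply: tens_eq.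
Qed.

Lemma Gideal_avg j (F : lg_pt G -> dR (L j)) :
  regmod F -> (forall t, Gideal (F t)) -> Gideal (avg F).
Proof.
move=> SF IF; have [Q _ ->] := avg_qsum HG SF.
by apply: Gideal_sum => p _; apply: GidealZ.
Qed.

Lemma dhomog_avg (B : cdga K) p n (F : lg_pt G -> dR B) :
  regmod F -> (forall t, dhomog p n (F t)) -> dhomog p n (avg F).
Proof.
move=> SF hF; have [Q _ ->] := avg_qsum HG SF.
rewrite /qsum; elim/big_rec: _ => [|q x _ hx]; first exact: dh_zero.
by apply: dh_add => //; apply: dhomogZ.
Qed.

Section CompareAverages.
Variables (j j' : nat) (psi psi' : lpow G j' -> lg_pt G -> lpow G j).
Hypothesis Hpsi : forall h, S j h ->
  fun_tens (S j') (@lg_gen K G) (fun x t => h (psi x t)).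
Hypothesis Hpsi' : forall h, S j h ->
  fun_tens (S j') (@lg_gen K G) (fun x t => h (psi' x t)).
Hypothesis psi_avg : forall f x, fun_alg (S j) f ->
  avg (fun t => f (psi x t) : K^o) = avg (fun t => f (psi' x t) : K^o).

(** Both averages preserve the ideal, and modulo it [w] is made of functions on [G^j] and forms from
    Spec A. The latter ignore [psi], so the comparison on scalar functions suffices. *)
Lemma Gideal_compare_avg (w : dR (L j)) :
  Gideal (avg (fun t => dmap (precomp_at Hpsi A t) w) -
          avg (fun t => dmap (precomp_at Hpsi' A t) w)).
Proof.
have Sd phi (Hphi : forall h, S j h -> fun_tens (S j') (@lg_gen K G)
    (fun x t => h (phi x t))) z : regmod (fun t => dmap (precomp_at Hphi A t) z).
  by apply: regmod_dmap => a; apply: regmod_precomp.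
elim: (decomposableT w) => {w} [w Iw|f Sf eta|w z _ Hw _ Hz].
- apply: ig_add; [|apply: GidealN]; apply: Gideal_avg => // t;
    exact: Gideal_precomp.
- suff avgT phi (Hphi : forall h, S j h -> fun_tens (S j') (@lg_gen K G)
      (fun x t => h (phi x t))) :
      avg (fun t => dmap (precomp_at Hphi A t)
        (din (gfun Sf A) * dmap (tens_const (S j) A) eta)) =
      din (avg (fun t => precomp_at Hphi A t (gfun Sf A) : amod (L j'))) *
        dmap (tens_const (S j') A) eta.
    rewrite !avgT.
    suff -> : avg (fun t => precomp_at Hpsi A t (gfun Sf A) : amod (L j')) =
              avg (fun t => precomp_at Hpsi' A t (gfun Sf A) : amod (L j')).
      by rewrite subrr; apply: ig_zero.
    apply: tens_eq => x.
    (* Evaluation at [x] is linear and passes under [avg], which leaves an average of scalars. *)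
    suff avgx phi (Hphi : forall h, S j h -> fun_tens (S j') (@lg_gen K G)
        (fun x t => h (phi x t))) :
        (avg (fun t => precomp_at Hphi A t (gfun Sf A) : amod (L j')) : L j') x =
        scal A (avg (fun t => f (phi x t) : K^o)) * 1.
      by rewrite !avgx psi_avg.
    have lx : klinear (fun F : amod (L j') => tens_ev (S j') A x F : amod A).
      by split.
    rewrite -[LHS]/(tens_ev (S j') A x _) -(avg_lin HG lx); last exact: regmod_precomp.
    have l1 : klinear (fun k : K^o => scal A k * 1 : amod A).
      split=> [k l|k l]; first by rewrite rmorphD mulrDl.
      by rewrite amod_scaleE rmorphM -mulrA.
    rewrite -(avg_lin HG l1) //.
    have -> : (fun t => f (phi x t) : K^o) = fun t => f (phi x t) *: (1 : K^o).
      by apply/funext => t; rewrite [RHS]mulr1.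
    by apply: rm_tensor; apply: (ft_evall x (ft_comp Hphi Sf)).
  have ll : klinear (fun a : amod (L j') => din a * dmap (tens_const (S j') A) eta).
    split=> [a b|k a]; first by rewrite dinD mulrDl.
    by rewrite -scalerAl_dR -dinZ.
  rewrite -(avg_lin HG ll); last exact: regmod_precomp.
  congr avg; apply/funext => t; rewrite dmapM dmap_din; congr (_ * _).
  by apply: dmap_comp => a; apply: tens_eq.
- rewrite (_ : avg _ - avg _ = (avg (fun t => dmap (precomp_at Hpsi A t) w) -
          avg (fun t => dmap (precomp_at Hpsi' A t) w)) +
     (avg (fun t => dmap (precomp_at Hpsi A t) z) -
          avg (fun t => dmap (precomp_at Hpsi' A t) z))).
    exact: ig_add.
  under eq_fun do rewrite dmapD.
  under [X in _ - avg X = _]eq_fun do rewrite dmapD.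
  by rewrite !avgD // opprD addrACA.
Qed.
End CompareAverages.
End Integration.


(** * The homotopy *)

(* all_algebra exports another [form] *)
Local Notation form := Defs.form.

(** * Degrees and the mixed differential *)

Section Forms.
Variables (K : fieldType) (B C : cdga K).
Implicit Types (p : nat) (c : int).

Lemma dform0 p c : form p c (0 : dR B).
Proof. by case: c => [[|c]|c] //=; apply: dh_zero. Qed.

Lemma dformD p c (w z : dR B) : form p c w -> form p c z -> form p c (w + z).
Proof.
case: c => [[|c]|c] /=; try exact: dh_add.
by move=> -> ->; rewrite addr0.
Qed.

Lemma dformZ p c k (w : dR B) : form p c w -> form p c (k *: w).
Proof.
case: c => [[|c]|c] /=; try exact: dhomogZ.
by move=> ->; rewrite scaler0.
Qed.

Lemma dformN p c (w : dR B) : form p c w -> form p c (- w).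
Proof. by rewrite -scaleN1r; apply: dformZ. Qed.

Lemma dform_sign n p c (w : dR B) : form p c w -> form p c ((-1) ^+ n * w).
Proof. by rewrite signr_if; case: odd => //; apply: dformN. Qed.

Lemma dform_sum p c n (F : 'I_n -> dR B) :
  (forall i, form p c (F i)) -> form p c (\sum_i F i).
Proof.
by move=> hF; elim/big_rec: _ => [|i x _ hx]; [apply: dform0|apply: dformD].
Qed.

Lemma dform_dmap p c (f : cdga_hom B C) w : form p c w -> form p c (dmap f w).
Proof.
case: c => [[|c]|c] /=; try exact: dmap_dhomog.
by move=> ->; rewrite dmap0.
Qed.

Lemma dform_ddif p c (w : dR B) : form p c w -> form p (c + 1) (ddif w).
Proof.
case: c => [[|c]|[|n]] hw.
- by case: (ddif_dhomog (hw : dhomog p 0 w)) => _; apply.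
- by rewrite (hw : w = 0) (morph_add0 (@ddifD _ _)); apply: dform0.
- by case: (ddif_dhomog (hw : dhomog p 1 w)).
have -> : Negz n.+1 + 1 = Negz n by lia.
by case: (ddif_dhomog (hw : dhomog p n.+2 w)).
Qed.

Lemma dform_ddR p c (w : dR B) : form p c w -> form p.+1 (c - 1) (ddR w).
Proof.
case: c => [[|c]|n] hw.
- exact: (ddR_dhomog (hw : dhomog p 0 w)).
- by rewrite (hw : w = 0) (morph_add0 (@ddR_add _ _)); apply: dform0.
have -> : Negz n - 1 = Negz n.+1 by lia.
exact: (ddR_dhomog (hw : dhomog p n.+1 w)).
Qed.

(* the operator delta + tau d, without the sign (-1)^j *)
Definition mixed_dif (v : nat -> dR B) (i : nat) : dR B :=
  ddif (v i) + (if i is i'.+1 then ddR (v i') else 0).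

Lemma mixed_difD u v i :
  mixed_dif (fun i => u i + v i) i = mixed_dif u i + mixed_dif v i.
Proof.
rewrite /mixed_dif ddifD; case: i => [|i]; first by rewrite !addr0.
by rewrite ddR_add addrACA.
Qed.

Lemma mixed_difZ k v i : mixed_dif (fun i => k *: v i) i = k *: mixed_dif v i.
Proof.
rewrite /mixed_dif scalerDr ddifZ; case: i => [|i]; first by rewrite scaler0.
by rewrite ddRZ.
Qed.

Lemma mixed_dif_sign n v i :
  mixed_dif (fun i => (-1) ^+ n * v i) i = (-1) ^+ n * mixed_dif v i.
Proof.
rewrite /mixed_dif mulrDr (morph_sign (@ddifD _ _)).
by case: i => [|i]; rewrite ?mulr0 // (morph_sign (@ddR_add _ _)).
Qed.

Lemma mixed_dif_dif v i : mixed_dif (mixed_dif v) i = 0.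
Proof.
rewrite {1}/mixed_dif; case: i => [|i]; rewrite /mixed_dif ?addr0 ?ddif_ddif //.
rewrite ddifD ddR_add ddif_ddif ddif_ddR add0r addrA addNr add0r.
by case: i => [|i]; [exact: morph_add0 (@ddR_add _ _)|exact: ddR_ddR].
Qed.

End Forms.

Lemma mixed_dif_map (K : fieldType) (B C : cdga K) (l : dR B -> dR C) v i :
    {morph l : x y / x + y} -> (forall w, l (ddif w) = ddif (l w)) ->
    (forall w, l (ddR w) = ddR (l w)) ->
  mixed_dif (fun i => l (v i)) i = l (mixed_dif v i).
Proof.
move=> lD ld lR; rewrite /mixed_dif lD ld.
by case: i => [|i]; rewrite ?lR // (morph_add0 lD).
Qed.

(** The term at [(l, k)] with [k < l] cancels the one at [(k, l.-1)]; the row [l = 0] of the first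
    half and the row [l = n] of the second are empty. *)
Lemma alternating_sum_eq0 (V : pzRingType) n (X : nat -> nat -> V) :
    (forall k l, (k < l <= n)%N -> X l k = X k l.-1) ->
  \sum_(l < n.+1) \sum_(k < n) (-1) ^+ (l + k) * X l k = 0.
Proof.
move=> XE.
pose F (l k : nat) := (-1) ^+ (l + k) * X l k.
have -> : \sum_(l < n.+1) \sum_(k < n) (-1) ^+ (l + k) * X l k =
    \sum_(l < n.+1) \sum_(k < n) (if (k < l)%N then F l k else 0) +
    \sum_(l < n.+1) \sum_(k < n) (if (k < l)%N then 0 else F l k).
  rewrite -big_split; apply: eq_bigr => l _; rewrite -big_split.
  by apply: eq_bigr => k _ /=; case: ifP; rewrite ?addr0 ?add0r.
rewrite big_ord_recl big1 ?add0r => [|k _]; last by [].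
rewrite [X in _ + X]big_ord_recr /= [X in _ + (_ + X)]big1 ?addr0 => [|k _];
  last by rewrite ltn_ord.
rewrite exchange_big -big_split big1 // => k _; rewrite -big_split big1 // => l _.
rewrite /= /bump add1n ltnS leqNgt; case: ltnP => [|le_kl] /=; first by rewrite addr0.
rewrite /F XE /= ?ltnS ?le_kl //= addSn exprS mulN1r mulNr addnC.
by rewrite addNr.
Qed.

(** * The cosimplicial differential *)

Section Faces.
Variables (K : fieldType) (G : linalg_group K) (A : cdga K) (rho : action G A).
Local Notation S j := (@lpow_gen K G j).
Local Notation L j := (lvl G A j).

Lemma klinear_Delta j : klinear (@Delta K G A rho j).
Proof.
split=> [x y|k x]; rewrite /Delta.
  by rewrite -big_split; apply: eq_bigr => i _; rewrite dmapD mulrDr.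
by rewrite scaler_sumr; apply: eq_bigr => i _; rewrite dmapZ scalerAr_dR.
Qed.

Lemma Delta_ddif j (w : dR (L j)) : Delta rho (ddif w) = ddif (Delta rho w).
Proof.
rewrite /Delta (morph_add_sum (@ddifD _ _)); apply: eq_bigr => i _.
by rewrite (morph_sign (@ddifD _ _)) dmap_ddif.
Qed.

Lemma Delta_ddR j (w : dR (L j)) : Delta rho (ddR w) = ddR (Delta rho w).
Proof.
rewrite /Delta (morph_add_sum (@ddR_add _ _)); apply: eq_bigr => i _.
by rewrite (morph_sign (@ddR_add _ _)) dmap_ddR.
Qed.

Lemma face_face j k l (F : L j) : (k < l)%N ->
  face rho j.+1 l (face rho j k F) = face rho j.+1 k (face rho j l.-1 F).
Proof.
move=> lt_kl; apply: tens_eq => x.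
rewrite -[LHS]/(face_act rho l x (face_act rho k (face_pt l x)
  (F (face_pt k (face_pt l x))))).
rewrite -[RHS]/(face_act rho k x (face_act rho l.-1 (face_pt k x)
  (F (face_pt l.-1 (face_pt k x))))).
rewrite face_pt_face_pt // /face_act.
(* Only the face 0 moves Spec A. For [k = 0] and original [l = 1] the identity is the action law;
   for larger [l] the first coordinate is unchanged. *)
case: l lt_kl => // l; rewrite ltnS /= => le_kl.
case: k le_kl => [|k] le_kl /=; last by case: l le_kl.
rewrite /face_pt /=; case: l le_kl => [|l] _ /=; last first.
  by congr (rho (x _) _); apply: val_inj.
by rewrite -act_mul; congr (rho (lg_mul (x _) (x _)) _); apply: val_inj.
Qed.

Lemma Delta_Delta j (w : dR (L j)) : Delta rho (Delta rho w) = 0.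
Proof.
rewrite /Delta; under eq_bigr => l _.
  rewrite (morph_add_sum (@dmapD _ _ _ _)) mulr_sumr.
  under eq_bigr => k _.
    rewrite (morph_sign (@dmapD _ _ _ (face rho j.+1 l))) mulrA -exprD.
    over.
  over.
apply: (alternating_sum_eq0 (X := fun l k =>
  dmap (face rho j.+1 l) (dmap (face rho j k) w))) => k l /andP[lt_kl _].
by apply: dmap_square => F; apply: face_face.
Qed.

Lemma dform_Delta p c j (w : dR (L j)) : form p c w -> form p c (Delta rho w).
Proof.
by move=> hw; apply: dform_sum => k; apply: dform_sign; apply: dform_dmap.
Qed.

(** The action fixes scalars, so on functions from [G^j] a face is mere reindexing by [face_pt]. *)
Lemma Gideal_face j k (w : dR (L j)) : Gideal w -> Gideal (dmap (face rho j k) w).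
Proof.
apply: (Gideal_map (g := precomp (ground K) (@face_ptP K G j k))) => F.
apply: tens_eq => x.
rewrite -[LHS]/(face_act rho k x (scal A (F (face_pt k x)))).
by rewrite /face_act; case: eqP => // _; rewrite gca_map_scal.
Qed.

Lemma Gideal_Delta j (w : dR (L j)) : Gideal w -> Gideal (Delta rho w).
Proof.
by move=> Iw; apply: Gideal_sum => k _; apply: Gideal_sign; apply: Gideal_face.
Qed.

Definition pt0 : lpow G 0 := fun i => lg_one G.

Lemma lpow0_eq (x : lpow G 0) : x = pt0.
Proof. by apply: lpow_eq. Qed.

(** [G^0] is a point, so [L 0] is a copy of [A]. *)
Lemma dmap_const_ev (w : dR (L 0)) :
  dmap (tens_const (S 0) A) (dmap (tens_ev (S 0) A pt0) w) = w.
Proof.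
rewrite (dmap_comp _ (h := cdga_id (L 0))) ?dmap_id // => F.
by apply: tens_eq => x; rewrite (lpow0_eq x).
Qed.

Lemma Gideal0_eq0 (w : dR (L 0)) : Gideal w -> w = 0.
Proof. by move=> Iw; rewrite -(dmap_const_ev w) (Gideal_ev _ Iw) dmap0. Qed.

Lemma Delta0E (w : dR (L 0)) :
  Delta rho w = dmap (face rho 0 0) w - dmap (face rho 0 1) w.
Proof. by rewrite /Delta big_ord_recr big_ord1 /= expr0 expr1 mul1r mulN1r. Qed.

Lemma ev_const (eta : dR A) :
  dmap (tens_ev (S 0) A pt0) (dmap (tens_const (S 0) A) eta) = eta.
Proof. by rewrite (dmap_comp _ (h := cdga_id A)) // dmap_id. Qed.

(* G-invariance says that the difference of the two pullbacks to Spec A x G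
   vanishes on each fibre of the projection to G. *)
Lemma Gideal_Delta_invariant (eta : dR A) : invariant_form rho eta ->
  Gideal (Delta rho (dmap (tens_const (S 0) A) eta)).
Proof.
move=> eta_inv; apply: Gideal_ev_eq0 => x.
rewrite Delta0E dmapD (morph_addN (@dmapD _ _ _ _)).
rewrite (@dmap_square _ _ _ _ _ _ _ (rho (x ord0)) (tens_ev (S 0) A pt0)); last first.
  move=> F; rewrite -[LHS]/(rho (x ord0) (F (face_pt 0 x))).
  by rewrite (lpow0_eq (face_pt 0 x)).
rewrite [X in _ - X](@dmap_comp _ _ _ _ _ _ (tens_ev (S 0) A pt0)); last first.
  move=> F; rewrite -[LHS]/(F (face_pt 1 x)).
  by rewrite (lpow0_eq (face_pt 1 x)).
by rewrite ev_const eta_inv subrr.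
Qed.

End Faces.

(** * Integration over the last factor *)

Section Homotopy.
Variables (K : fieldType) (G : linalg_group K) (A : cdga K) (rho : action G A).
Hypothesis HG : linearly_reductive G.
Local Notation S j := (@lpow_gen K G j).
Local Notation L j := (lvl G A j).

Definition last_integral j (w : dR (L j.+1)) : dR (L j) :=
  avg (fun t => dmap (precomp_at (@section_ptP K G j) A t) w).
Local Notation h := last_integral.

Lemma regmod_section j (w : dR (L j.+1)) :
  regmod (fun t => dmap (precomp_at (@section_ptP K G j) A t) w).
Proof. by apply: regmod_dmap => a; apply: regmod_precomp. Qed.

Lemma last_integralD j : {morph @h j : w z / w + z}.
Proof.
move=> w z; rewrite /h -(avgD HG (regmod_section w) (regmod_section z)).
by under eq_fun do rewrite dmapD.
Qed.

Lemma last_integral_ddif j (w : dR (L j.+1)) : h (ddif w) = ddif (h w).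
Proof.
rewrite /h -(avg_lin HG (@klinear_ddif _ _)); last exact: regmod_section.
by under eq_fun do rewrite dmap_ddif.
Qed.

Lemma last_integral_ddR j (w : dR (L j.+1)) : h (ddR w) = ddR (h w).
Proof.
rewrite /h -(avg_lin HG (@klinear_ddR _ _)); last exact: regmod_section.
by under eq_fun do rewrite dmap_ddR.
Qed.

Lemma dform_last_integral p c j (w : dR (L j.+1)) : form p c w -> form p c (h w).
Proof.
case: c => [[|c]|n] hw.
- by apply: (dhomog_avg HG (regmod_section w)) => t; apply: dmap_dhomog hw.
- have w0 : w = 0 by [].
  by rewrite w0 (morph_add0 (@last_integralD j)); apply: dform0.
- by apply: (dhomog_avg HG (regmod_section w)) => t; apply: dmap_dhomog hw.
Qed.

Lemma Gideal_last_integral j (w : dR (L j.+1)) : Gideal w -> Gideal (h w).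
Proof.
move=> Iw; apply: (Gideal_avg HG (regmod_section w)) => t.
exact: Gideal_precomp.
Qed.

(** The coordinate that acts is the first one, the averaged one is the last. They coincide only for
    forms on [L 0], treated in [last_integral_Delta0]. *)
Lemma last_integral_face j k (w : dR (L j.+1)) : (k <= j)%N ->
  h (dmap (face rho j.+1 k) w) = dmap (face rho j k) (h w).
Proof.
move=> le_kj; rewrite /h -(avg_lin HG (klinear_dmap (face rho j k)));
  last exact: regmod_section.
congr avg; apply/funext => t; apply: dmap_square => F; apply: tens_eq => x.
rewrite -[LHS]/(face_act rho k (section_pt x t) (F (face_pt k (section_pt x t)))).
rewrite -[RHS]/(face_act rho k x (F (section_pt (face_pt k x) t))).
rewrite face_pt_section // /face_act; case: eqP => // _.
by rewrite -!comp_ord comp_mkpt.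
Qed.

Lemma last_integral_last_face j (w : dR (L j)) : h (dmap (face rho j j.+1) w) = w.
Proof.
rewrite /h -[RHS](avg_const HG); congr avg; apply/funext => t.
rewrite (dmap_comp _ (h := cdga_id (L j))) ?dmap_id // => F.
by apply: tens_eq => x; rewrite -[in RHS](face_pt_section_id x t).
Qed.

(** On functions, averaging over [x_j t] or over [t] is the same by translation invariance;
    differentials along [x_j] account for the ideal. *)
Lemma last_integral_mul_face j (w : dR (L j.+1)) :
  Gideal (h (dmap (face rho j.+1 j.+1) w) - dmap (face rho j j.+1) (h w)).
Proof.
have -> : h (dmap (face rho j.+1 j.+1) w) =
    avg (fun t => dmap (precomp_at (@mulr_lastP K G j) A t) w).
  congr avg; apply/funext => t; apply: dmap_comp => F; apply: tens_eq => x.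
  by rewrite -[RHS]/(F (mulr_last x t)) -face_pt_section_mulr.
have -> : dmap (face rho j j.+1) (h w) =
    avg (fun t => dmap (precomp_at (@set_lastP K G j) A t) w).
  rewrite /h -(avg_lin HG (klinear_dmap (face rho j j.+1))); last exact: regmod_section.
  congr avg; apply/funext => t; apply: dmap_comp => F; apply: tens_eq => x.
  by rewrite -[RHS]/(F (set_last x t)) -section_face_pt_last.
apply: Gideal_compare_avg => // f x Sf.
rewrite -(avg_translate HG (component x j) (F := fun t => f (set_last x t) : K^o)).
  by [].
have -> : (fun t => f (set_last x t) : K^o) = fun t => f (set_last x t) *: (1 : K^o).
  by apply/funext => t; rewrite [RHS]mulr1.
by apply: rm_tensor; apply: (ft_evall x (ft_comp (@set_lastP K G j) Sf)).
Qed.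

(** Of the [j + 3] faces the first [j + 1] commute with integration, the next one does so modulo the
    ideal, and the last one is undone by the section, with sign [(-1)^(j+2)]. *)
Lemma last_integral_Delta j (w : dR (L j.+1)) :
  Gideal (h (Delta rho w) - Delta rho (h w) - (-1) ^+ j * w).
Proof.
have hD := @last_integralD j.+1.
pose c := \sum_(k < j.+1) (-1) ^+ k * dmap (face rho j k) (h w).
have -> : Delta rho (h w) = c + (-1) ^+ j.+1 * dmap (face rho j j.+1) (h w).
  by rewrite /Delta big_ord_recr.
have -> : h (Delta rho w) = c +
    (-1) ^+ j.+1 * h (dmap (face rho j.+1 j.+1) w) + (-1) ^+ j * w.
  rewrite /Delta 2!big_ord_recr /= 2!hD (morph_add_sum hD) !(morph_sign hD).
  rewrite last_integral_last_face !exprS !mulN1r opprK; congr (_ + _ + _).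
  apply: eq_bigr => k _; rewrite (morph_sign hD) last_integral_face //.
  by rewrite -ltnS.
rewrite addrAC addrK opprD addrACA subrr add0r -mulrBr.
exact/Gideal_sign/last_integral_mul_face.
Qed.

End Homotopy.


(** The projection face cancels [w], and the action face leaves the average of all translates of
    [w]: the Reynolds operator, with no error in the ideal. *)
Lemma last_integral_Delta0 (K : fieldType) (G : linalg_group K) (A : cdga K)
    (rho : action G A) (w : dR (lvl G A 0)) : linearly_reductive G ->
  exists2 eta, invariant_form rho eta &
    w + last_integral (Delta rho w) = dmap (tens_const (@lpow_gen K G 0) A) eta.
Proof.
move=> HG; set w0 := dmap (tens_ev (@lpow_gen K G 0) A (pt0 G)) w.
have Srho : regmod (fun t => dmap (rho t) w0).
  apply: regmod_dmap => a; elim: (act_rational rho a) => [|f b Sf|F F' _ HF _ HF'].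
  - exact: rm_zero.
  - exact: (@rm_tensor _ _ (amod A) f b Sf).
  - exact: rm_add HF HF'.
exists (avg (fun t => dmap (rho t) w0)).
  move=> g; rewrite -(avg_lin HG (klinear_dmap (rho g)) Srho).
  rewrite -[RHS](avg_translate HG g Srho); congr avg; apply/funext => t.
  by apply: dmap_comp => a; rewrite act_mul.
rewrite Delta0E (last_integralD HG) (morph_addN (last_integralD HG (j := 0))).
rewrite (last_integral_last_face _ HG) addrC subrK.
rewrite -(avg_lin HG (klinear_dmap _) Srho); congr avg; apply/funext => t.
rewrite -[LHS]dmap_const_ev; congr dmap.
rewrite (@dmap_comp _ _ _ _ _ _
  (tens_ev (@lpow_gen K G 1) A (section_pt (pt0 G) t))) //.
apply: dmap_square => F.
rewrite -[LHS]/(rho t (F (face_pt 0 (section_pt (pt0 G) t)))).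
by rewrite (lpow0_eq (face_pt _ _)).
Qed.

(** * The complexes of closed forms and the homotopy identity *)

Section Complex.
Variables (K : fieldType) (G : linalg_group K) (A : cdga K) (rho : action G A).
Variable d : int.
Local Notation S j := (@lpow_gen K G j).
Local Notation L j := (lvl G A j).
Implicit Types w z : fseries G A.

(** Degree and strictness are kept apart from the cocycle condition in degree 0, since the homotopy
    respects each of the two separately. *)
Definition has_degree k w : Prop := forall j i,
  form (2 + i) ((- k%:Z + d - 2 - 2 * i%:Z - 2 * j%:Z) + j%:Z) (w j i).

Definition strict w : Prop :=
  (forall i, exists2 eta : dR A, invariant_form rho eta &
     w 0 i = dmap (tens_const (S 0) A) eta) /\
  (forall j i, (0 < j)%N -> Gideal (w j i)).

Lemma Dtot0E w i : Dtot rho w 0 i = mixed_dif (w 0) i.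
Proof. by rewrite /Dtot /= expr0 mul1r addr0. Qed.

Lemma DtotSE w j i :
  Dtot rho w j.+1 i = (-1) ^+ j.+1 * mixed_dif (w j.+1) i + Delta rho (w j i).
Proof. by []. Qed.

Lemma Dtot_lin a w z : Dtot rho (a *: w + z) = a *: Dtot rho w + Dtot rho z.
Proof.
apply: series_eq => -[|j] i.
  rewrite Dtot0E -[RHS]/(a *: Dtot rho w 0 i + Dtot rho z 0 i) !Dtot0E.
  by rewrite -mixed_difZ -mixed_difD.
rewrite DtotSE -[RHS]/(a *: Dtot rho w j.+1 i + Dtot rho z j.+1 i) !DtotSE.
rewrite -[w in RHS]/w scalerDr addrACA -scalerAr_dR -mulrDr -mixed_difZ -mixed_difD.
by have [DD DZ] := klinear_Delta rho j; rewrite -DZ -DD.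
Qed.

Lemma DtotD w z : Dtot rho (w + z) = Dtot rho w + Dtot rho z.
Proof. by rewrite -[w]scale1r Dtot_lin !scale1r. Qed.

Lemma DtotN w : Dtot rho (- w) = - Dtot rho w.
Proof. exact: (morph_addN DtotD). Qed.

Lemma Dtot_Dtot w : Dtot rho (Dtot rho w) = 0.
Proof.
apply: series_eq => -[|j] i; rewrite -[RHS]/(0 : dR (L _)).
  rewrite Dtot0E -[RHS](mixed_dif_dif (w 0) i); congr (mixed_dif _ i).
  by apply/funext => i'; apply: Dtot0E.
rewrite DtotSE; have [DD _] := klinear_Delta rho j.
have -> : mixed_dif (Dtot rho w j.+1) i = mixed_dif (fun i => Delta rho (w j i)) i.
  rewrite -[LHS]/(mixed_dif (fun i => (-1) ^+ j.+1 * mixed_dif (w j.+1) i +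
    Delta rho (w j i)) i).
  by rewrite mixed_difD mixed_dif_sign mixed_dif_dif mulr0 add0r.
rewrite (mixed_dif_map (l := @Delta K G A rho j)) //; last 2 first.
- exact: Delta_ddif.
- exact: Delta_ddR.
case: j => [|j] in DD *; first by rewrite Dtot0E expr1 mulN1r addNr.
rewrite DtotSE [Delta rho (_ * _ + _)]DD (morph_sign DD).
rewrite Delta_Delta addr0 exprS mulN1r mulNr.
exact: addNr.
Qed.

Lemma has_degree_lin k a w z :
  has_degree k w -> has_degree k z -> has_degree k (a *: w + z).
Proof. by move=> hw hz j i; exact: (dformD (dformZ a (hw j i)) (hz j i)). Qed.

Lemma has_degree_Dtot k w : has_degree k.+1 w -> has_degree k (Dtot rho w).
Proof.
move=> hw j i; apply: dformD.
  apply: dform_sign; apply: dformD.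
    have := dform_ddif (hw j i); congr (form _ _ _); lia.
  case: i => [|i]; first exact: dform0.
  have := dform_ddR (hw j i); congr (form _ _ _); lia.
case: j => [|j]; first exact: dform0.
have := dform_Delta rho (hw j i); congr (form _ _ _); lia.
Qed.

Lemma strict_lin a w z : strict w -> strict z -> strict (a *: w + z).
Proof.
move=> [w0 wI] [z0 zI]; split=> [i|j i j0].
  have [eta eta_inv etaE] := w0 i; have [zeta zeta_inv zetaE] := z0 i.
  exists (a *: eta + zeta); last by rewrite dmapD dmapZ -etaE -zetaE.
  by move=> g; rewrite dmapD dmapZ eta_inv zeta_inv.
exact: (ig_add (GidealZ a (wI j i j0)) (zI j i j0)).
Qed.

Lemma strict_Dtot w : strict w -> strict (Dtot rho w).
Proof.
move=> [w0 wI]; split=> [i|[|j] i // _].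
  (* All [eta i] are needed at once, because [mixed_dif] combines consecutive powers of [tau]. *)
  have /choice[eta etaP] : forall i, exists eta : dR A,
      invariant_form rho eta /\ w 0 i = dmap (tens_const (S 0) A) eta.
    by move=> i'; have [eta] := w0 i'; exists eta.
  exists (mixed_dif eta i).
    move=> g; rewrite -(mixed_dif_map (l := dmap (rho g))) //.
    - by congr (mixed_dif _ i); apply/funext => i'; apply: (etaP i').1.
    - exact: dmapD.
    - by move=> z; rewrite dmap_ddif.
    - by move=> z; rewrite dmap_ddR.
  rewrite Dtot0E -(mixed_dif_map (l := dmap (tens_const (S 0) A))) //.
  - by congr (mixed_dif _ i); apply/funext => i'; apply: (etaP i').2.
  - exact: dmapD.
  - by move=> z; rewrite dmap_ddif.
  - by move=> z; rewrite dmap_ddR.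
rewrite DtotSE; apply: ig_add.
  apply/Gideal_sign/ig_add; first exact/Gideal_ddif/wI.
  by case: i => [|i]; [apply: ig_zero|exact/Gideal_ddR/wI].
case: j => [|j]; last exact/Gideal_Delta/wI.
by have [eta eta_inv ->] := w0 i; apply: Gideal_Delta_invariant.
Qed.

Hypothesis HG : linearly_reductive G.

(** With this sign the terms of [delta + tau d] in D H + H D cancel, since integration commutes with
    both differentials; only those of Delta remain. *)
Definition homotopy w : fseries G A :=
  fun j i => (-1) ^+ j.+1 * last_integral (w j.+1 i).

Lemma has_degree_homotopy k w : has_degree k w -> has_degree k.+1 (homotopy w).
Proof.
move=> hw j i; apply/dform_sign/(dform_last_integral HG).
have := hw j.+1 i; congr (form _ _ _); lia.
Qed.

Lemma strict_homotopy w : strict w -> strict (homotopy w).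
Proof.
case=> _ wI; split=> [i|j i j0]; last first.
  by apply/Gideal_sign/(Gideal_last_integral HG)/wI.
(* Integration maps the ideal on [L 1] into the ideal on [L 0], which is zero. *)
exists 0; first by move=> g; rewrite dmap0.
rewrite dmap0 /homotopy (Gideal0_eq0 (w := last_integral _)) ?mulr0 //.
exact/(Gideal_last_integral HG)/wI.
Qed.

(** What remains is [w 0 i] plus the integral of its Delta for [j = 0], and up to sign the
    expression of [last_integral_Delta] for [j > 0]. *)
Lemma strict_homotopy_defect w :
  strict (w - Dtot rho (homotopy w) - homotopy (Dtot rho w)).
Proof.
pose h := @last_integral K G A.
have hD j : {morph @h j : x y / x + y} by apply: last_integralD.
have hdif j (v : nat -> dR (L j.+1)) i :
    mixed_dif (fun i => h j (v i)) i = h j (mixed_dif v i).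
  apply: mixed_dif_map => // x; rewrite /h.
    by rewrite last_integral_ddif.
  by rewrite last_integral_ddR.
have dh j i : mixed_dif (homotopy w j) i = (-1) ^+ j.+1 * h j (mixed_dif (w j.+1) i).
  by rewrite -hdif -mixed_dif_sign.
have hd j i : homotopy (Dtot rho w) j i = h j (mixed_dif (w j.+1) i) +
    (-1) ^+ j.+1 * h j (Delta rho (w j i)).
  rewrite /homotopy DtotSE -/(h j _) hD (morph_sign (hD j)) mulrDr.
  by rewrite signrMK.
split=> [i|[|j] i // _].
  have [eta eta_inv etaE] := last_integral_Delta0 rho (w 0 i) HG.
  exists eta => //; rewrite -etaE.
  rewrite -[LHS]/(w 0 i - Dtot rho (homotopy w) 0 i - homotopy (Dtot rho w) 0 i).
  rewrite Dtot0E dh hd expr1 !mulN1r opprK opprD opprK addrA addrK.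
  by [].
rewrite -[X in Gideal X]/(w j.+1 i - Dtot rho (homotopy w) j.+1 i -
  homotopy (Dtot rho w) j.+1 i).
rewrite DtotSE dh hd.
have [DD _] := klinear_Delta rho j.
rewrite -[homotopy w j i]/((-1) ^+ j.+1 * h j (w j.+1 i)) (morph_sign DD).
have := Gideal_sign j.+1 (last_integral_Delta rho HG (w j.+1 i)).
have sS (x : dR (L j.+1)) : (-1) ^+ j.+2 * x = - ((-1) ^+ j.+1 * x).
  by rewrite exprS mulN1r mulNr.
have sj (x : dR (L j.+1)) : (-1) ^+ j.+1 * ((-1) ^+ j * x) = - x.
  by rewrite exprS mulN1r mulNr signrMK.
rewrite !sS mulrN signrMK -/(h _ _) -/(h _ _) !mulrBr sj opprK.
set m := h _ (mixed_dif _ _); set a := _ * Delta rho _; set b := _ * h _ _.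
rewrite opprD opprK opprB -(addrA (w _ _)) (addrC b (- m)) (addrACA m) subrr add0r.
by rewrite (addrC (w _ _)) (addrC (- a)).
Qed.

Lemma strict_inclusion_weak_equivalence :
  inclusion_is_weak_equivalence (Dtot rho) (strict2 rho d) (closed2 rho d).
Proof.
have D0 : Dtot rho 0 = 0 := morph_add0 DtotD.
have hdeg0 k : has_degree k 0 by move=> j i; apply: dform0.
have closed0 k : closed2 rho d k 0 by split; first exact: hdeg0.
have strict20 k w : strict2 rho d k w <-> closed2 rho d k w /\ strict w.
  by split=> [[]|[wc []]] //; split.
have closed_D k w : has_degree k.+1 w -> closed2 rho d k (Dtot rho w).
  by move=> hw; split=> [|_]; [apply: has_degree_Dtot|apply: Dtot_Dtot].
have closed_lin k a x y : closed2 rho d k x -> closed2 rho d k y ->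
    closed2 rho d k (a *: x + y).
  move=> [hx Dx] [hy Dy]; split=> [|k0]; first exact: has_degree_lin.
  by rewrite Dtot_lin Dx // Dy // scaler0 addr0.
have strict0 : strict 0.
  split=> [i|j i _]; last exact: ig_zero.
  by exists 0; [move=> g; rewrite dmap0|rewrite dmap0].
split.
- split=> [k|k a x y _ _|k x /strict20[[hx _] sx]|k x _].
  + split; first by apply/strict20.
    move=> a x y /strict20[cx sx] /strict20[cy sy]; apply/strict20.
    by split; [apply: closed_lin|apply: strict_lin].
  + exact: Dtot_lin.
  + by apply/strict20; split; [apply: closed_D|apply: strict_Dtot].
  + exact: Dtot_Dtot.
- split=> [k|k a x y _ _|k x [hx _]|k x _].
  + by split=> // a x y; apply: closed_lin.
  + exact: Dtot_lin.
  + exact: closed_D.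
  + exact: Dtot_Dtot.
- by move=> k x [].
have subr_lin (x y : fseries G A) : x - y = -1 *: y + x.
  by rewrite scaleN1r addrC.
move=> k; split=> [x [/strict20[[hx _] sx] _] [y [hy _] Dy]|x [[hx Dx0] Dx]].
  exists (y - Dtot rho (homotopy y)).
    apply/strict20; split.
      split=> //; rewrite subr_lin; apply: has_degree_lin => //.
      exact/has_degree_Dtot/has_degree_homotopy.
    (* The homotopy defect of [y] is strict whatever [y] is, and [homotopy x] is strict because [x]
       is. *)
    have -> : y - Dtot rho (homotopy y) =
        1 *: (y - Dtot rho (homotopy y) - homotopy (Dtot rho y)) + homotopy x.
      by rewrite scale1r Dy subrK.
    apply: strict_lin; first exact: strict_homotopy_defect.
    exact: strict_homotopy.
  by rewrite DtotD DtotN Dtot_Dtot subr0.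
(* In degree 0 closedness comes from [closed2], in the other degrees from [cocycle]. *)
have {}Dx : Dtot rho x = 0.
  by case: k Dx0 Dx {hx} => [|k] Dx0 Dx; [apply: Dx0|apply: Dx].
have hHx := has_degree_homotopy hx.
have H0 : homotopy 0 = 0.
  apply: series_eq => j i; rewrite /homotopy.
  rewrite -[(0 : fseries G A) j.+1 i]/0.
  by rewrite (morph_add0 (last_integralD HG (j := j))) mulr0.
exists (x - Dtot rho (homotopy x)).
  split.
    apply/strict20; split.
      split=> [|_]; last by rewrite DtotD DtotN Dtot_Dtot Dx subr0.
      rewrite subr_lin; apply: has_degree_lin => //; exact: has_degree_Dtot.
    by have := strict_homotopy_defect x; rewrite Dx H0 subr0.
  by rewrite DtotD DtotN Dtot_Dtot Dx subr0.
exists (homotopy x); first by split.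
by rewrite opprB addrC subrK.
Qed.

End Complex.

Theorem proposition7 (R : realType) (G : linalg_group R[i]) (A : cdga R[i])
    (rho : action G A) (d : int) :
  affine_dg_manifold A -> linearly_reductive G ->
  inclusion_is_weak_equivalence (Dtot rho) (strict2 rho d) (closed2 rho d).
Proof. by move=> _; apply: strict_inclusion_weak_equivalence. Qed.
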